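(* Let $d\ge 1$ and let $E$ and $F$ be (Lebesgue measurable) subsets of $\mathbb{R}^d$. If both $E$ and $F$ are very thin at infinity, then the operator $Q_FP_E$ is a compact operator on $L^2(\mathbb{R}^d)$.
   Context: The Fourier transform is normalised by $\mathcal{F}(f)(\xi)=\widehat{f}(\xi)=\int_{\mathbb{R}^d}e^{-2\pi i\xi\cdot x}f(x)\,dx$ and extended to $L^2(\mathbb{R}^d)$ as a unitary operator. For measurable $E,F\subseteq\mathbb{R}^d$, with $\chi_E$ denoting the indicator function of $E$, the bounded operators $P_E$ and $Q_F$ on $L^2(\mathbb{R}^d)$ are defined by $P_Ef=\chi_Ef$ and $\widehat{Q_Ff}=\chi_F\widehat{f}$, so that $Q_FP_Ef=\mathcal{F}^{-1}(\chi_F\mathcal{F}(\chi_Ef))$ (the Fourier concentration operator). $|A|$ is the Lebesgue measure of $A$, $B(x,r)$ is the Euclidean ball in $\mathbb{R}^d$ with centre $x$ and radius $r$, and $\rho:\mathbb{R}^d\to(0,1]$ is $\rho(x)=\min\{1,1/|x|\}$ (with $\rho(0)=1$). A set $E\subseteq\mathbb{R}^d$ is called very thin at infinity if $$\lim_{|x|\to\infty}\frac{|E\cap B(x,\rho(x))|}{|B(x,\rho(x))|}=0.$$ *)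

(* Defs.v *)
From HB Require Import structures.
From mathcomp Require Import all_boot all_order all_algebra.
From mathcomp Require Import all_classical all_reals all_analysis.
From mathcomp Require Import complex.

Set Implicit Arguments.
Unset Strict Implicit.
Unset Printing Implicit Defensive.

Import Order.TTheory GRing.Theory Num.Theory.
Import numFieldNormedType.Exports.

Local Open Scope classical_set_scope.
Local Open Scope ring_scope.
Local Open Scope complex_scope.

Section BorelLebesgue.
Context (R : realType).
Local Notation U := (measurableTypeR R).

Definition tuple_cons (n : nat) (p : U * n.-tuple U) : n.+1.-tuple U :=
  [the n.+1.-tuple U of p.1 :: p.2].

Lemma measurable_tuple_cons (n : nat) :
  measurable_fun [set: U * n.-tuple U] (@tuple_cons n).
Proof. exact: measurable_cons. Qed.

HB.instance Definition _ (n : nat) :=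
  isMeasurableFun.Build _ _ _ _ (@tuple_cons n) (@measurable_tuple_cons n).

Section Step.
Context (n : nat) (mu : {sigma_finite_measure set (n.-tuple U) -> \bar R}).

Definition product_step : set (n.+1.-tuple U) -> \bar R :=
  pushforward (@lebesgue_measure R \x mu)%E (@tuple_cons n).

Let product_step0 : product_step set0 = 0%E.
Proof. by rewrite /product_step /pushforward preimage_set0 measure0. Qed.

Let product_step_ge0 A : (0 <= product_step A)%E.
Proof. exact: measure_ge0. Qed.

Let product_step_sigma_additive : semi_sigma_additive product_step.
Proof.
exact: (@measure_semi_sigma_additive _ _ _
  (measure_function_pushforward__canonical__measure_function_Measure
     (@lebesgue_measure R \x mu)%E (@measurable_tuple_cons n))).
Qed.

HB.instance Definition _ := isMeasure.Build _ _ _ product_step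
  product_step0 product_step_ge0 product_step_sigma_additive.

Let product_step_sigma_finite : sigma_finite setT product_step.
Proof.
have /sigma_finiteP[F [TF ndF Foo]] := sigma_finiteT (@lebesgue_measure R).
have /sigma_finiteP[G [TG ndG Goo]] := sigma_finiteT mu.
pose g (x : n.+1.-tuple U) := (thead x, [tuple of behead x] : n.-tuple U).
have mg : measurable_fun setT g.
  by apply/measurable_fun_pairP; split; [exact: measurable_tnth |
     exact: measurable_behead].
exists (fun k => g @^-1` (F k `*` G k)).
  apply/esym/seteqP; split => // x _.
  have [i _ Fi] : (\bigcup_i F i) (g x).1 by rewrite -TF.
  have [j _ Gj] : (\bigcup_i G i) (g x).2 by rewrite -TG.
  exists (maxn i j) => //; split.
  - by move: Fi; exact/subsetPset/ndF/leq_maxl.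
  - by move: Gj; exact/subsetPset/ndG/leq_maxr.
move=> k; have [mF Fk] := Foo k; have [mG Gk] := Goo k; split.
  by rewrite -[X in measurable X]setTI; apply: mg => //; exact: measurableX.
rewrite /product_step /pushforward -comp_preimage.
have -> : g \o @tuple_cons n = id.
  by apply/funext => -[x t] /=; congr pair; exact/val_inj.
by rewrite preimage_id product_measure1E// lte_mul_pinfty// ge0_fin_numE.
Qed.

HB.instance Definition _ := Measure_isSigmaFinite.Build _ _ _ product_step
  product_step_sigma_finite.

End Step.

Fixpoint borel_lebesgue (n : nat) :
    {sigma_finite_measure set (n.-tuple U) -> \bar R} :=
  match n with
  | 0 => \d_ ([tuple] : 0.-tuple U)
  | m.+1 => product_step (borel_lebesgue m)
  end.

End BorelLebesgue.

(* R^d as a measurable space: d-tuples with the sigma-algebra of Lebesgue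
   (Caratheodory) measurable sets, i.e. the completion of the Borel one. *)
Definition Rn (R : realType) (d : nat) : Type :=
  caratheodory_type (mu_ext (borel_lebesgue R d)).

HB.instance Definition _ (R : realType) (d : nat) :=
  Measurable.copy (Rn R d) (caratheodory_type (mu_ext (borel_lebesgue R d))).

Definition lebesgue (R : realType) (d : nat) : set (Rn R d) -> \bar R :=
  @completed_measure_extension _ _ _ (borel_lebesgue R d).

HB.instance Definition _ (R : realType) (d : nat) :=
  Measure.on (@lebesgue R d).

Section Euclidean.
Context (R : realType) (d : nat).
Implicit Types x y : Rn R d.

Definition coord x (i : 'I_d) : R := tnth (x : d.-tuple R) i.

Definition dotp x y : R := \sum_(i < d) coord x i * coord y i.

Definition enorm x : R := Num.sqrt (\sum_(i < d) coord x i ^+ 2).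

Definition edist x y : R := Num.sqrt (\sum_(i < d) (coord x i - coord y i) ^+ 2).

Definition eball x (r : R) : set (Rn R d) := [set y | edist x y < r].

(* The case split is needed because 0^-1 = 0. *)
Definition rho x : R := if enorm x == 0 then 1 else Num.min 1 (enorm x)^-1.

(* The filter of neighbourhoods of infinity: |x| -> oo. *)
Definition at_infinity : set_system (Rn R d) :=
  [set A | exists M : R, forall x, M < enorm x -> A x].

Definition very_thin_at_infinity (E : set (Rn R d)) : Prop :=
  (fine (lebesgue (E `&` eball x (rho x))) / fine (lebesgue (eball x (rho x))))
    @[x --> at_infinity] --> (0 : R).

End Euclidean.

Section L2.
Context (R : realType) (d : nat).
Local Notation X := (Rn R d).
Local Notation mu := (@lebesgue R d).
Local Notation C := R[i].
Implicit Types f g h : X -> C.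

Definition cmeasurable f : Prop :=
  measurable_fun [set: X] (fun x => complex.Re (f x)) /\
  measurable_fun [set: X] (fun x => complex.Im (f x)).

Definition cLnorm (p : \bar R) f : \bar R :=
  Lnorm mu p (fun x => (ComplexField.Normc.normc (f x))%:E).

Definition cLp (p : \bar R) : set (X -> C) :=
  [set f | cmeasurable f /\ (cLnorm p f < +oo)%E].

(* Elements of L^2 are represented by functions; two representatives are the
   same element iff they are at distance 0. *)
Definition L2dist f g : \bar R := cLnorm 2%:E (fun x => f x - g x).

Definition cintegral f : C :=
  (\int[mu]_x complex.Re (f x)) +i* (\int[mu]_x complex.Im (f x)).

Definition cexpi (t : R) : C := cos t +i* sin t.

Definition fourier_integral f (xi : X) : C :=
  cintegral (fun x => cexpi (- (2 * pi * dotp xi x)) * f x).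

(* g represents the L^2 Fourier transform of f: the extension by L^2-continuity
   of the integral formula from L^1 `&` L^2. *)
Definition is_fourier f g : Prop :=
  [/\ cLp 2%:E f, cLp 2%:E g &
    exists u : nat -> X -> C,
      [/\ forall n, cLp 1 (u n) /\ cLp 2%:E (u n),
          L2dist (u n) f @[n --> \oo] --> 0%E &
          L2dist (fourier_integral (u n)) g @[n --> \oo] --> 0%E]].

(* Representatives are selected by choice; the default value 0 is never used on
   L^2, by Plancherel's theorem. *)
Definition fourier f : X -> C := xget (fun=> 0) [set g | is_fourier f g].

Definition inv_fourier g : X -> C := xget (fun=> 0) [set f | is_fourier f g].

Definition restrict_to (E : set X) f : X -> C := fun x => (\1_E x)%:C * f x.

Definition P_ (E : set X) f : X -> C := restrict_to E f.

Definition Q_ (F : set X) f : X -> C := inv_fourier (restrict_to F (fourier f)).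

(* T, acting on representatives, induces a linear map L^2 -> L^2. *)
Definition linear_operator_L2 (T : (X -> C) -> X -> C) : Prop :=
  [/\ forall f, cLp 2%:E f -> cLp 2%:E (T f),
      forall f g, cLp 2%:E f -> cLp 2%:E g ->
        L2dist f g = 0%E -> L2dist (T f) (T g) = 0%E &
      forall (a : C) f g, cLp 2%:E f -> cLp 2%:E g ->
        L2dist (T (fun x => a * f x + g x)) (fun x => a * T f x + T g x) = 0%E].

Definition compact_operator_L2 (T : (X -> C) -> X -> C) : Prop :=
  linear_operator_L2 T /\
  forall f : nat -> X -> C,
    (forall n, cLp 2%:E (f n)) ->
    (exists M : R, forall n, (cLnorm 2%:E (f n) <= M%:E)%E) ->
    exists (k : nat -> nat) (g : X -> C),
      [/\ {homo k : m n / (m < n)%N}, cLp 2%:E g &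
          L2dist (T (f (k n))) g @[n --> \oo] --> 0%E].

End L2.

(* Submission.v *)
(** Proof idea. Write the Fourier transform in terms of the cosine and sine
transforms [K], and let [B_k] be the ball of radius [2^k] and
[S_k = B_(k+1) \ B_k]. With [a_k] a Gaussian of width about [2^k] and [G_k] its
transform, of width about [2^-k], one has [K (a_k u) = G_k * K u], and
[1_(B_k) = a_k + b_k m_k] where [b_k] is another such Gaussian and
[sum_k m_k^2] is bounded. For [F] thin at the scale [2^-k] on [S_k] (this is
where [rho x = 1/|x|] enters) the masses of [G_k] on the sets [F `&` S_k] add up to [O(e)]; hence
[sum_(k >= J) |1_(F `&` S_k) K (1_(B_k) u)|^2 <= C e |u|^2].
Summation by parts over the shells, together with the dual estimate for [E],
bounds [|1_F K u|^2], for [u] supported in [E], by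
[C e |u|^2 + 2 |1_(F `&` B_J) K (1_(B_J) u)|^2]. The last term is compact, since
[K (1_(B_J) u)] is bounded and equicontinuous for [u] in the unit ball; so
every bounded sequence has a subsequence whose image under [Q_F P_E] is Cauchy. *)

Require Import Defs.
From HB Require Import structures.
From mathcomp Require Import all_boot all_order all_algebra.
From mathcomp Require Import all_classical all_reals all_analysis.
From mathcomp Require Import measurable_realfun complex ring lra.
Set Implicit Arguments.
Unset Strict Implicit.
Unset Printing Implicit Defensive.
Import Order.TTheory GRing.Theory Num.Theory.
Import numFieldNormedType.Exports.
Local Open Scope classical_set_scope.
Local Open Scope ring_scope.

(** Convolution with [gauss s] averages over distances of order [1 / s]. Hence the thinness of [F]
    near [x], at the scale [1 / |x|], can be used only against inputs supported in [|y| <= C |x|];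
    where [y] is the larger variable, it is the other set that is thin at the right scale, and the
    transposed operator has to be used. Abel summation over the shells separates the two regions. In
    the splitting of a sharp cutoff [1_D = a + (1_D - a)] the remainder has no smoothing structure.
    Pulling a wider Gaussian [b] out of it restores one, so that the remainder also sees the
    thinness of [F]; since the quotient must stay small far away, [b] has to decay more slowly than
    [a]. The subsequence is extracted for all radii at once, before the accuracy [e] fixes the
    radius of the compact part. Since [fourier] and [inv_fourier] select representatives, the
    operator is studied through the graph of the transform: existence, surjectivity and isometry are
    all that is needed of it, and they are derived from Gaussian integrals alone. *)

Section integral_image.
Local Open Scope ereal_scope.
Context d1 d2 (X : measurableType d1) (Y : measurableType d2) (R : realType).
Context (phi : X -> Y) (mphi : measurable_fun setT phi).
Context (m1 : {measure set X -> \bar R}) (m2 : {measure set Y -> \bar R}).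
Context (phim : forall A, measurable A -> m1 (phi @^-1` A) = m2 A).

(** Used with three maps: a reflection of the line, [tuple_cons], and the identity from the Lebesgue
    to the Borel sigma-algebra of [Rn]. Asking only for equality on measurable sets lets [m2] keep
    its own structure. *)
Lemma ge0_integral_image (f : Y -> \bar R) : measurable_fun setT f -> (forall x, 0 <= f x) ->
  \int[m2]_y f y = \int[m1]_x f (phi x).
Proof.
move=> mf f0.
have := ge0_integral_pushforward mphi m1 measurableT mf (fun x _ => f0 x).
rewrite preimage_setT => <-.
by apply: eq_measure_integral => A mA _; rewrite -phim.
Qed.

Lemma integrable_image (f : Y -> \bar R) : measurable_fun setT f ->
  m2.-integrable setT f <-> m1.-integrable setT (f \o phi).
Proof.
move=> mf.
have maf : measurable_fun setT (abse \o f) by exact: measurableT_comp.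
have af0 x : 0 <= (abse \o f) x by exact: abse_ge0.
have e := ge0_integral_image maf af0.
split => /integrableP [_ fi]; apply/integrableP; split => //.
- exact: measurableT_comp.
- by rewrite -[ltLHS]e.
- by rewrite [ltLHS]e.
Qed.

Lemma integral_image (f : Y -> \bar R) : measurable_fun setT f ->
  \int[m2]_y f y = \int[m1]_x f (phi x).
Proof.
move=> mf; rewrite [LHS]integralE [RHS]integralE.
have mp := measurable_funepos mf; have mn := measurable_funeneg mf.
rewrite (ge0_integral_image mp)// (ge0_integral_image mn)//.
congr (_ - _); apply: eq_integral => x _.
  by rewrite -[f^\+ _]/((f^\+ \o phi) x) -funepos_comp.
by rewrite -[f^\- _]/((f^\- \o phi) x) -funeneg_comp.
Qed.
End integral_image.

(** * Gaussian integrals on the line *)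

Section gauss1D.
Context {R : realType}.
Local Notation leb := (@lebesgue_measure R).
Implicit Types (s y z theta eta : R).

(** The fundamental theorem of calculus on [[-(n+1), n+1]] and dominated convergence; only these
    intervals occur, so limits of [F] along the integers are enough. It stands for integration by
    parts in [gaussF_ode]. *)
Lemma Rintegral_derive0 (F f : R -> R) :
  (forall x : R, is_derive x (1 : R) F (f x)) -> continuous f ->
  leb.-integrable setT (EFin \o f) ->
  F n.+1%:R @[n --> \oo] --> (0 : R) -> F (- n.+1%:R) @[n --> \oo] --> (0 : R) ->
  \int[leb]_x f x = 0.
Proof.
move=> dF cf intf Fy FNy.
have mf : measurable_fun setT f by apply: continuous_measurable_fun.
pose I n : set R := `[- n.+1%:R, n.+1%:R]%classic.
have intI n : (\int[leb]_(x in I n) (f x)%:E = (F n.+1%:R - F (- n.+1%:R))%:E)%E.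
  rewrite (@continuous_FTC2 _ f F) //.
  - by rewrite (@lt_trans _ _ 0)// ?ltr0Sn // oppr_lt0.
  - exact: continuous_subspaceT.
  - split => //.
      apply: cvg_at_right_filter; apply: differentiable_continuous.
      by apply/derivable1_diffP; have [] := dF (- n.+1%:R).
    apply: cvg_at_left_filter; apply: differentiable_continuous.
    by apply/derivable1_diffP; have [] := dF (n.+1%:R).
  - by move=> x _; rewrite derive1E; apply: derive_val.
have mI n : measurable (I n) by exact: measurable_itv.
have mfI n : measurable_fun setT ((EFin \o f) \_ (I n)).
  apply/(measurable_restrict _ (mI n)) => //.
  by apply: measurable_funTS; exact/measurable_EFinP.
have mfE : measurable_fun setT (EFin \o f) by exact/measurable_EFinP.
have cvI : {ae leb, forall x, setT x -> ((EFin \o f) \_ (I n)) x @[n --> \oo] --> (EFin \o f) x}.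
  apply: aeW => x _; apply: cvg_near_cst.
  near=> n; rewrite patchE ifT// inE /I /= in_itv /= -ler_norml.
  rewrite (@le_trans _ _ n%:R)// ?ler_nat//; near: n; exact: nbhs_infty_ger.
have bI : {ae leb, forall x n, setT x -> (`|((EFin \o f) \_ (I n)) x| <= (abse \o (EFin \o f)) x)%E}.
  by apply: aeW => x n _; rewrite patchE; case: ifP => //= _; rewrite normr0 lee_fin.
have [_ _] := @dominated_convergence _ _ R leb setT measurableT _ _ _ mfI mfE cvI
  (integrable_abse intf) bI.
have -> : [sequence (\int[leb]_x ((EFin \o f) \_ (I n)) x)%E]_n = (fun n => (F n.+1%:R - F (- n.+1%:R))%:E).
  by apply/funext => n /=; rewrite -intI [RHS]integral_mkcond.
move=> h.
have h0 : (F n.+1%:R - F (- n.+1%:R))%:E @[n --> \oo] --> (0 : R)%:E.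
  by apply: cvg_EFin; [exact: nearW | rewrite -[X in _ --> X](subr0 0); exact: cvgB].
by rewrite /Rintegral (cvg_unique _ h h0).
Unshelve. all: by end_near. Qed.

(** The scale [s] is an inverse width, and the factor [s] makes the total mass 1. *)
Definition gauss1 s z : R := s * expR (- (pi * (s * z) ^+ 2)).

Lemma gauss1_ge0 s z : 0 <= s -> 0 <= gauss1 s z.
Proof. by move=> s0; rewrite mulr_ge0// expR_ge0. Qed.

Lemma continuous_gauss1 s : continuous (gauss1 s).
Proof.
move=> z; apply: differentiable_continuous; apply/derivable1_diffP.
by rewrite /gauss1; apply: ex_derive.
Qed.

Lemma gauss1_normal s : 0 < s ->
  gauss1 s = normal_pdf 0 (s * Num.sqrt (pi *+ 2))^-1.
Proof.
move=> s0; have p0 : 0 < pi *+ 2 :> R by rewrite mulrn_wgt0// pi_gt0.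
have q0 : 0 < s * Num.sqrt (pi *+ 2) by rewrite mulr_gt0// sqrtr_gt0.
rewrite normal_pdfE; last by rewrite gt_eqF// invr_gt0.
have sq : Num.sqrt (pi *+ 2) ^+ 2 = pi *+ 2 :> R by rewrite sqr_sqrtr// ltW.
have p1 : pi != 0 :> R by rewrite gt_eqF// pi_gt0.
have s1 : s != 0 by rewrite gt_eqF.
have sg : (s * Num.sqrt (pi *+ 2))^-1 ^+ 2 = (s ^+ 2 * (pi *+ 2))^-1 by rewrite exprVn exprMn sq.
apply/funext => z; rewrite /gauss1 /normal_peak /normal_fun sg.
congr (_ * _).
  have -> : (s ^+ 2 * (pi *+ 2))^-1 * pi *+ 2 = s ^- 2.
    move: p1; generalize (pi : R) => p p1.
    by field; rewrite p1 s1.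
  by rewrite -exprVn sqrtr_sqr ger0_norm ?invr_ge0 ?invrK// ltW.
congr expR; rewrite subr0.
move: p1; generalize (pi : R) => p p1.
by field; rewrite p1 s1.
Qed.

Lemma integral_gauss1 s : 0 < s -> (\int[leb]_z (gauss1 s z)%:E = 1)%E.
Proof. by move=> s0; rewrite gauss1_normal// integral_normal_pdf. Qed.

Lemma integrable_gauss1 s : 0 < s -> leb.-integrable setT (EFin \o gauss1 s).
Proof. by move=> s0; rewrite gauss1_normal//; exact: integrable_normal_pdf. Qed.

(** With [x = s * z], one has [|x| <= 1 + x^2 <= exp (x^2)], and halving the scale frees
    [3/4 * pi * x^2] in the exponent to absorb it. This is the integrable majorant for
    differentiating [gaussF]. *)
Lemma gauss1_moment s z : 0 < s -> `|z| * gauss1 s z <= 2 / s * gauss1 (s / 2) z.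
Proof.
move=> s0; rewrite /gauss1.
have -> : `|z| * (s * expR (- (pi * (s * z) ^+ 2))) = `|s * z| * expR (- (pi * (s * z) ^+ 2)).
  by rewrite normrM (gtr0_norm s0); ring.
have -> : 2 / s * (s / 2 * expR (- (pi * (s / 2 * z) ^+ 2))) =
   expR ((s * z) ^+ 2 * (pi * 3 / 4)) * expR (- (pi * (s * z) ^+ 2)).
  rewrite -expRD.
  have -> : (s * z) ^+ 2 * (pi * 3 / 4) + - (pi * (s * z) ^+ 2) = - (pi * (s / 2 * z) ^+ 2).
    by field.
  by field; rewrite gt_eqF.
rewrite ler_pM2r ?expR_gt0//; set x := s * z.
apply: (@le_trans _ _ (1 + x ^+ 2)).
  rewrite -(@real_normK _ x) ?num_real//; have := normr_ge0 x; nra.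
rewrite (le_trans (expR_ge1Dx _))// ler_expR ler_peMr ?sqr_ge0//.
have := pi_ge2 R; lra.
Qed.

Lemma is_derive_gauss1_sin s theta y z : is_derive z (1 : R)
  (fun z => gauss1 s z * sin (theta + 2 * pi * z * y))
  (- (2 * pi * s ^+ 2 * z) * gauss1 s z * sin (theta + 2 * pi * z * y)
   + 2 * pi * y * gauss1 s z * cos (theta + 2 * pi * z * y)).
Proof.
rewrite /gauss1; apply: is_derive_eq.
rewrite /GRing.scale /=; ring.
Qed.

(** The phase [theta] covers the cosine transform ([0]) and the sine transform ([- pi / 2])
    together, and it carries the other coordinates in the induction on the dimension. *)
Definition gaussF s theta y : R :=
  \int[leb]_z (gauss1 s z * cos (theta + 2 * pi * z * y)).

Lemma gauss1_trig_integrable s theta y (f : R -> R) : 0 < s -> measurable_fun setT f ->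
  (forall x, `|f x| <= 1) ->
  leb.-integrable setT (EFin \o (fun z => gauss1 s z * f (theta + 2 * pi * z * y))).
Proof.
move=> s0 mf f1; apply: (le_integrable measurableT _ _ (integrable_gauss1 s0)).
  apply/measurable_EFinP; apply: measurable_funM.
    by apply: continuous_measurable_fun; exact: continuous_gauss1.
  apply: (measurableT_comp mf).
  by apply: measurable_funD => //; apply: measurable_funM => //; apply: measurable_funM.
move=> z _ /=; rewrite lee_fin normrM ler_piMr//.
Qed.

Lemma derive_gaussF s theta y : 0 < s ->
  is_derive y (1 : R) (gaussF s theta) (\int[leb]_z (gauss1 s z * - (2 * pi * z * sin (theta + 2 * pi * z * y)))).
Proof.
move=> s0.
have y1 : `]y - 1, y + 1[%classic y by rewrite /= in_itv /= ; lra.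
pose f (x z : R) := gauss1 s z * cos (theta + 2 * pi * z * x).
have i1 (x : R) : `]y - 1, y + 1[%classic x -> leb.-integrable setT (EFin \o f x).
  move=> _; apply: gauss1_trig_integrable => //.
    by apply: continuous_measurable_fun; exact: continuous_cos.
  exact: cos_max.
have dd (x z : R) : is_derive x (1 : R) (f ^~ z) (gauss1 s z * - (2 * pi * z * sin (theta + 2 * pi * z * x))).
  apply: is_derive_eq.
  rewrite /GRing.scale /=; ring.
have i2 (x z : R) : `]y - 1, y + 1[%classic x -> setT z -> derivable (f ^~ z) x 1.
  by move=> _ _; have [] := dd x z.
have Ef (x z : R) : partial1of2 f x z = gauss1 s z * - (2 * pi * z * sin (theta + 2 * pi * z * x)).
  by rewrite partial1of2E; apply: derive_val.
pose G z := 2 * pi * (2 / s) * gauss1 (s / 2) z.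
have G0 z : 0 <= G z.
  by rewrite !mulr_ge0 ?pi_ge0 ?gauss1_ge0 ?invr_ge0 ?divr_ge0 // ltW.
have iG : leb.-integrable setT (EFin \o G).
  rewrite /comp /G.
  under eq_fun do rewrite EFinM.
  apply: integrableZl => //; apply: integrable_gauss1; exact: divr_gt0.
have bG x z : `]y - 1, y + 1[%classic x -> setT z -> `|partial1of2 f x z| <= G z.
  move=> _ _; rewrite Ef normrM normrN [`|2 * _ * _ * _|]normrM [`|2 * _ * _|]normrM [`|2 * _|]normrM.
  rewrite (ger0_norm (gauss1_ge0 z (ltW s0))) (ger0_norm (pi_ge0 R)) gtr0_norm//.
  have := @gauss1_moment s z s0; rewrite /G.
  set u := gauss1 s z; set v := gauss1 _ z => h.
  apply: (@le_trans _ _ (2 * pi * (`|z| * u))); last first.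
    by rewrite -(mulrA _ (2 / s)) ler_wpM2l// mulr_ge0 ?pi_ge0.
  rewrite (_ : _ * (_ * _) = 2 * pi * (`|z| * u) * `|sin (theta + 2 * pi * z * x)|); last ring.
  rewrite ler_piMr ?sin_max// !mulr_ge0 ?pi_ge0//.
  exact: ltW.
apply: DeriveDef.
  exact: (derivable_under_integral measurableT y1 i1 i2 G0 iG bG).
rewrite -derive1E (differentiation_under_integral measurableT y1 i1 i2 G0 iG bG).
by apply: eq_Rintegral => z _; rewrite Ef.
Qed.

Lemma cvg_gauss1_sin0 s theta y (v : R ^nat) : 0 < s ->
  (forall n, `|v n| = n.+1%:R) ->
  gauss1 s (v n) * sin (theta + 2 * pi * v n * y) @[n --> \oo] --> (0 : R).
Proof.
move=> s0 vn; apply: norm_cvg0.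
have : (s^-1 * (n.+1%:R : R)^-1) @[n --> \oo] --> (s^-1 * 0 : R).
  by apply: cvgMr; exact: cvg_harmonic.
rewrite mulr0.
apply: (@squeeze_cvgr _ _ _ _ (cst 0)); last exact: cvg_cst.
apply: nearW => n /=; rewrite normr_ge0 /= normrM.
rewrite (ger0_norm (gauss1_ge0 _ (ltW s0))).
apply: (@le_trans _ _ (gauss1 s (v n))).
  by rewrite ler_piMr ?sin_max// gauss1_ge0// ltW.
rewrite /gauss1 /harmonic /= /GRing.scale /= expRN.
rewrite -(@real_normK _ (s * v n)) ?num_real// normrM vn gtr0_norm//.
set m := n.+1%:R; have m1 : 1 <= m by rewrite ler1n.
have e1 := expR_ge1Dx (pi * (s * m) ^+ 2).
have p2 := pi_ge2 R.
(* Decay like [1 / m] is enough, for comparison with the harmonic sequence. *)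
have h : s ^+ 2 * m <= expR (pi * (s * m) ^+ 2).
  apply: le_trans e1; rewrite exprMn.
  have : s ^+ 2 * m <= s ^+ 2 * m ^+ 2 by rewrite ler_wpM2l ?sqr_ge0// ler_eXnr.
  have : 0 <= s ^+ 2 * m ^+ 2 by rewrite mulr_ge0// sqr_ge0.
  nra.
have sm : 0 < s ^+ 2 * m by rewrite mulr_gt0// exprn_gt0.
apply: (@le_trans _ _ (s * (s ^+ 2 * m)^-1)).
  rewrite ler_wpM2l ?(ltW s0)//.
  by rewrite lef_pV2// posrE expR_gt0.
have s1 : s != 0 by rewrite gt_eqF.
have m0 : m != 0 by rewrite gt_eqF// (lt_le_trans ltr01).
have e (k : R) : k != 0 -> s / (s ^+ 2 * k) = s^-1 / k by move=> k0; field; rewrite k0 s1.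
by rewrite e.
Qed.

(** The derivative of [gauss1 s z * sin (theta + 2 * pi * z * y)] in [z] has integral zero; its two
    terms are, up to constants, the integrand on the left and that of [gaussF]. *)
Lemma gaussF_ode s theta y : 0 < s ->
  \int[leb]_z (gauss1 s z * - (2 * pi * z * sin (theta + 2 * pi * z * y))) = - (2 * pi * y / s ^+ 2) * gaussF s theta y.
Proof.
move=> s0.
pose f z := - (2 * pi * s ^+ 2 * z) * gauss1 s z * sin (theta + 2 * pi * z * y)
   + 2 * pi * y * gauss1 s z * cos (theta + 2 * pi * z * y).
have cf : continuous f.
  move=> z; apply: differentiable_continuous; apply/derivable1_diffP.
  by rewrite /f /gauss1; apply: ex_derive.
have mgs : measurable_fun setT (fun z : R => - (2 * pi * s ^+ 2 * z) * gauss1 s z * sin (theta + 2 * pi * z * y)).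
  apply: continuous_measurable_fun => z; apply: differentiable_continuous; apply/derivable1_diffP.
  by rewrite /gauss1; apply: ex_derive.
have i1 : leb.-integrable setT (EFin \o (fun z : R => - (2 * pi * s ^+ 2 * z) * gauss1 s z * sin (theta + 2 * pi * z * y))).
  have s2 : 0 < s / 2 by exact: divr_gt0.
  have := integrableZl measurableT (2 * pi * s ^+ 2 * (2 / s)) (integrable_gauss1 s2).
  apply: le_integrable => //; first exact/measurable_EFinP.
  move=> z _ /=; rewrite lee_fin normrM.
  apply: (@le_trans _ _ `|- (2 * pi * s ^+ 2 * z) * gauss1 s z|).
    by rewrite ler_piMr ?sin_max.
  have g0 := gauss1_ge0 z (ltW s2).
  have c0 : 0 <= 2 * pi * s ^+ 2 :> R.
    by rewrite mulr_ge0 ?sqr_ge0// mulr_ge0// pi_ge0.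
  have d0 : 0 <= 2 / s by rewrite divr_ge0// ltW.
  rewrite [leRHS]ger0_norm; last by rewrite mulr_ge0// mulr_ge0.
  rewrite normrM normrN normrM (ger0_norm c0) (ger0_norm (gauss1_ge0 z (ltW s0))).
  rewrite -mulrA -[leRHS]mulrA ler_wpM2l//.
  exact: gauss1_moment.
have i2 : leb.-integrable setT (EFin \o (fun z : R => 2 * pi * y * gauss1 s z * cos (theta + 2 * pi * z * y))).
  rewrite /comp; under eq_fun do rewrite -mulrA EFinM.
  apply: integrableZl => //; apply: gauss1_trig_integrable => //.
    by apply: continuous_measurable_fun; exact: continuous_cos.
  exact: cos_max.
have intf : leb.-integrable setT (EFin \o f).
  rewrite /comp /f; under eq_fun do rewrite EFinD.
  exact: integrableD.
have := @Rintegral_derive0 _ f (is_derive_gauss1_sin s theta y) cf intf.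
move=> /(_ (cvg_gauss1_sin0 _ _ s0 _) (cvg_gauss1_sin0 _ _ s0 _)).
move=> /(_ (fun n => normr_nat _ _)) H.
have {H} : \int[leb]_x f x = 0.
  by apply: H => n; rewrite normrN normr_nat.
rewrite /f RintegralD// => H.
have Hc : \int[leb]_z (2 * pi * y * gauss1 s z * cos (theta + 2 * pi * z * y)) = 2 * pi * y * gaussF s theta y.
  rewrite -RintegralZl//.
    by apply: eq_Rintegral => z _; rewrite !mulrA.
  apply: gauss1_trig_integrable => //.
    by apply: continuous_measurable_fun; exact: continuous_cos.
  exact: cos_max.
rewrite Hc in H.
have s1 : s != 0 by rewrite gt_eqF.
have -> : \int[leb]_z (gauss1 s z * - (2 * pi * z * sin (theta + 2 * pi * z * y))) =
   s ^- 2 * \int[leb]_z (- (2 * pi * s ^+ 2 * z) * gauss1 s z * sin (theta + 2 * pi * z * y)).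
  rewrite -RintegralZl//.
  apply: eq_Rintegral => z _; field; by rewrite s1.
move/eqP : H; rewrite addr_eq0 => /eqP ->.
by field; rewrite s1.
Qed.

Lemma gaussF0 s theta : 0 < s -> gaussF s theta 0 = cos theta.
Proof.
move=> s0; rewrite /gaussF.
under eq_Rintegral do rewrite mulr0 addr0 mulrC.
rewrite RintegralZl ?integrable_gauss1//.
by rewrite /Rintegral integral_gauss1//= mulr1.
Qed.

(** By the differential equation, [gaussF] divided by the expected Gaussian has derivative zero, so
    it keeps its value [cos theta] at [y = 0]. *)
Lemma gaussFE s theta y : 0 < s -> gaussF s theta y = cos theta * expR (- (pi * (y / s) ^+ 2)).
Proof.
move=> s0.
pose h (y : R) := expR (pi * (y / s) ^+ 2) * gaussF s theta y.
have dh (x : R) : is_derive x (1 : R) h 0.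
  have dF := derive_gaussF theta x s0.
  rewrite gaussF_ode// in dF.
  apply: is_derive_eq.
  rewrite /GRing.scale /=; field; by rewrite gt_eqF.
have hc := is_derive_0_is_cst y 0 dh.
have : h y = cos theta by rewrite hc /h gaussF0// mul0r expr0n mulr0 expR0 mul1r.
rewrite /h expRN => <-.
by rewrite mulrC mulrA mulVf ?mul1r// gt_eqF// expR_gt0.
Qed.
Lemma lebesgue_measure_reflect (eta : R) (A : set R) : measurable A ->
  pushforward leb ((fun z => eta - z) : _ -> measurableTypeR R) A = leb A.
Proof.
move=> mA; apply/esym.
have mphi : measurable_fun setT ((fun z : R => eta - z) : measurableTypeR R -> measurableTypeR R).
  by apply: measurable_funB.
apply: (lebesgue_measure_unique (mu := pushforward leb ((fun z => eta - z) : _ -> measurableTypeR R))) => //= _ [[a b]] _ <-.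
rewrite /pushforward.
have -> : (fun z : R => eta - z) @^-1` `]a, b]%classic = `[eta - b, eta - a[%classic.
  by apply/seteqP; split => z /=; rewrite !in_itv/= => /andP[? ?]; apply/andP; split; lra.
rewrite !lebesgue_measure_itv/= !lte_fin.
rewrite ltrD2l ltrN2; case: ifP => // _; rewrite -!EFinB; congr EFin; ring.
Qed.

Lemma Rintegral_reflect (eta : R) (f : R -> R) : measurable_fun setT f ->
  \int[leb]_z f (eta - z) = \int[leb]_z f z.
Proof.
move=> mf.
have mphi : measurable_fun setT ((fun z : R => eta - z) : measurableTypeR R -> measurableTypeR R).
  by apply: measurable_funB.
have mfE : measurable_fun setT (EFin \o f) by apply/measurable_EFinP.
rewrite /Rintegral; congr fine; apply/esym.
by rewrite (integral_image mphi (m1 := leb) (m2 := leb) _ mfE)// => A mA; exact: lebesgue_measure_reflect.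
Qed.

Lemma integral_gauss1_shift s eta : 0 < s -> (\int[leb]_z (gauss1 s (eta - z))%:E = 1)%E.
Proof.
move=> s0; rewrite -(integral_gauss1 s0).
have mphi : measurable_fun setT ((fun z : R => eta - z) : measurableTypeR R -> measurableTypeR R).
  by apply: measurable_funB.
have mfE : measurable_fun setT (EFin \o gauss1 s).
  by apply/measurable_EFinP; apply: continuous_measurable_fun; exact: continuous_gauss1.
have g0 x : (0 <= (EFin \o gauss1 s) x)%E by rewrite lee_fin gauss1_ge0// ltW.
apply/esym.
by rewrite (ge0_integral_image mphi (m1 := leb) (m2 := leb) _ mfE)// => A mA; exact: lebesgue_measure_reflect.
Qed.

(** The reflection [z -> eta - z] reduces this to [gaussFE] at [- y] with phase
    [theta + 2 * pi * eta * y]. *)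
Lemma gauss1_conv_cos s eta theta y : 0 < s ->
  \int[leb]_z (gauss1 s (eta - z) * cos (theta + 2 * pi * z * y)) =
  cos (theta + 2 * pi * eta * y) * expR (- (pi * (y / s) ^+ 2)).
Proof.
move=> s0.
rewrite -(@Rintegral_reflect eta).
  have := @gaussFE s (theta + 2 * pi * eta * y) (- y) s0; rewrite mulNr sqrrN => <-.
  apply: eq_Rintegral => z _; congr (gauss1 _ _ * cos _); ring.
apply: measurable_funM.
  apply: measurableT_comp; last exact: measurable_funB.
  by apply: continuous_measurable_fun; exact: continuous_gauss1.
apply: measurableT_comp; first by apply: continuous_measurable_fun; exact: continuous_cos.
by apply: measurable_funD => //; apply: measurable_funM => //; apply: measurable_funM.
Qed.

End gauss1D.

(** * Lebesgue measure on [R^d] *)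

Section Rn_measure.
Context {R : realType} (d : nat).
Local Notation X := (Rn R d).
Local Notation U := (measurableTypeR R).
Local Notation mu := (@lebesgue R d).
Local Notation bl := (borel_lebesgue R d).

Lemma Rn_measurable_borel (A : set (d.-tuple U)) : measurable A -> measurable (A : set X).
Proof. by move=> mA; exact: caratheodory_measurable_mu_ext. Qed.

Lemma lebesgue_borel (A : set (d.-tuple U)) : measurable A -> mu A = bl A.
Proof. by move=> mA; exact: measurable_mu_extE. Qed.

Lemma lebesgue_sigma_finite : sigma_finite setT mu.
Proof. exact: completed_measure_extension_sigma_finite (sigma_finiteT bl). Qed.

HB.instance Definition _ := Measure_isSigmaFinite.Build _ _ _ mu lebesgue_sigma_finite.



Lemma measurable_fun_id_Rn : measurable_fun setT (id : X -> d.-tuple U).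
Proof. by move=> _ A mA; rewrite setTI; exact: Rn_measurable_borel. Qed.

Lemma measurable_coord (i : 'I_d) : measurable_fun setT ((fun x : X => Defs.coord x i) : X -> R).
Proof.
apply: (measurableT_comp (measurable_tnth i) measurable_fun_id_Rn).
Qed.

Lemma ge0_integral_lebesgue_borel (f : d.-tuple U -> \bar R) : measurable_fun setT f -> (forall x, 0 <= f x)%E ->
  (\int[bl]_x f x = \int[mu]_x f x)%E.
Proof. exact: (ge0_integral_image measurable_fun_id_Rn (m1 := mu) (fun A mA => lebesgue_borel mA)). Qed.

Lemma integral_lebesgue_borel (f : d.-tuple U -> \bar R) : measurable_fun setT f ->
  (\int[bl]_x f x = \int[mu]_x f x)%E.
Proof. exact: (integral_image measurable_fun_id_Rn (m1 := mu) (fun A mA => lebesgue_borel mA)). Qed.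

End Rn_measure.
HB.instance Definition _ (R : realType) (d : nat) := Measure_isSigmaFinite.Build _ _ _ (@lebesgue R d) (@lebesgue_sigma_finite R d).


(** * Product measure and tensor products of Gaussians *)

Section tensor.
Context {R : realType}.
Local Notation U := (measurableTypeR R).
Local Notation leb := (@lebesgue_measure R).

Lemma ge0_integral_borelS n (f : n.+1.-tuple U -> \bar R) : measurable_fun setT f -> (forall x, 0 <= f x)%E ->
  (\int[borel_lebesgue R n.+1]_x f x = \int[leb]_a \int[borel_lebesgue R n]_t f (tuple_cons (a, t)))%E.
Proof.
move=> mf f0.
rewrite (@ge0_integral_image _ _ _ _ _ _ (@measurable_tuple_cons R n) (leb \x borel_lebesgue R n)%E (borel_lebesgue R n.+1) _ f)//.
rewrite fubini_tonelli1//.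
by apply: measurableT_comp => //; exact: measurable_tuple_cons.
Qed.

Lemma integrable_borelS n (f : n.+1.-tuple U -> \bar R) : measurable_fun setT f ->
  (borel_lebesgue R n.+1).-integrable setT f <-> (leb \x borel_lebesgue R n)%E.-integrable setT (f \o (@tuple_cons R n)).
Proof.
exact: (@integrable_image _ _ _ _ _ _ (@measurable_tuple_cons R n) (leb \x borel_lebesgue R n)%E (borel_lebesgue R n.+1) _ f).
Qed.

Lemma integral_borelS n (f : n.+1.-tuple U -> \bar R) : (borel_lebesgue R n.+1).-integrable setT f ->
  (\int[borel_lebesgue R n.+1]_x f x = \int[leb]_a \int[borel_lebesgue R n]_t f (tuple_cons (a, t)))%E.
Proof.
move=> fi; have mf := measurable_int _ fi.
rewrite (@integral_image _ _ _ _ _ _ (@measurable_tuple_cons R n) (leb \x borel_lebesgue R n)%E (borel_lebesgue R n.+1) _ f)//.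
by rewrite -integral12_prod_meas1//; apply/integrable_borelS.
Qed.

Lemma ge0_integral_prod n (f : nat -> R -> R) : (forall i, measurable_fun setT (f i)) -> (forall i x, 0 <= f i x) ->
  (\int[borel_lebesgue R n]_t (\prod_(i < n) f i (tnth t i))%:E = \prod_(i < n) \int[leb]_x (f i x)%:E)%E.
Proof.
elim: n f => [|n IH] f mf f0.
  rewrite /= integral_dirac// ?diracT ?big_ord0 ?mul1e//.
    rewrite (_ : (fun x => _) = cst 1%:E)//.
    by apply/funext => x; rewrite big_ord0.
rewrite ge0_integral_borelS//; first last.
- by move=> x; rewrite lee_fin prodr_ge0.
- apply/measurable_EFinP; apply: measurable_prod => i _.
  exact: (measurableT_comp (mf i) (measurable_tnth i)).
rewrite big_ord_recl.
have E (a : R) (t : n.-tuple U) : (\prod_(i < n.+1) f i (tnth (tuple_cons (a, t)) i))%:E =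
   ((f 0%N a)%:E * (\prod_(i < n) f i.+1 (tnth t i))%:E)%E.
  rewrite big_ord_recl EFinM; congr (_ * _)%E; congr EFin.
  by apply: eq_bigr => i _; rewrite tnthS.
under eq_integral do under eq_integral do rewrite E.
under eq_integral => a _.
  rewrite ge0_integralZl//; first last.
  - by rewrite lee_fin.
  - by move=> x _; rewrite lee_fin prodr_ge0.
  - apply/measurable_EFinP; apply: measurable_prod => i _.
    exact: (measurableT_comp (mf i.+1) (measurable_tnth i)).
  over.
rewrite (IH (fun i => f i.+1))//.
rewrite ge0_integralZr//.
- by apply/measurable_EFinP; exact: mf.
- by move=> x _; rewrite lee_fin.
- by apply: prode_ge0 => i _; apply: integral_ge0 => x _; rewrite lee_fin.
Qed.

Lemma measurable_gauss1 s : measurable_fun setT (gauss1 s : R -> R).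
Proof. by apply: continuous_measurable_fun; exact: continuous_gauss1. Qed.

Lemma measurable_cosR : measurable_fun setT (cos : R -> R).
Proof. by apply: continuous_measurable_fun; exact: continuous_cos. Qed.

Lemma measurable_prod_gauss1 n s (e : nat -> R) :
  measurable_fun setT (fun t : n.-tuple U => \prod_(i < n) gauss1 s (e i - tnth t i)).
Proof.
apply: measurable_prod => i _.
apply: (measurableT_comp (measurable_gauss1 s)); apply: measurable_funB => //.
exact: measurable_tnth.
Qed.

Lemma integral_prod_gauss1 n s (e : nat -> R) : 0 < s ->
  (\int[borel_lebesgue R n]_t (\prod_(i < n) gauss1 s (e i - tnth t i))%:E = 1)%E.
Proof.
move=> s0; rewrite (@ge0_integral_prod n (fun i z => gauss1 s (e i - z))).
- by rewrite big1// => i _; exact: integral_gauss1_shift.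
- move=> i; apply: (measurableT_comp (measurable_gauss1 s)); exact: measurable_funB.
- by move=> i x; rewrite gauss1_ge0// ltW.
Qed.

Lemma measurable_gauss_cos n (s theta : R) (e y : nat -> R) :
  measurable_fun setT (fun t : n.-tuple U => (\prod_(i < n) gauss1 s (e i - tnth t i)) * cos (theta + 2 * pi * \sum_(i < n) tnth t i * y i)).
Proof.
apply: measurable_funM; first exact: measurable_prod_gauss1.
apply: (measurableT_comp measurable_cosR); apply: measurable_funD => //.
apply: measurable_funM => //; apply: measurable_sum => i.
by apply: measurable_funM => //; exact: measurable_tnth.
Qed.

Lemma integrable_gauss_cos n (s theta : R) (e y : nat -> R) : 0 < s ->
  (borel_lebesgue R n).-integrable setT (fun t : n.-tuple U => ((\prod_(i < n) gauss1 s (e i - tnth t i)) * cos (theta + 2 * pi * \sum_(i < n) tnth t i * y i))%:E).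
Proof.
move=> s0; have mg := @measurable_gauss_cos n s theta e y.
apply/integrableP; split; first exact/measurable_EFinP.
apply: (@le_lt_trans _ _ (\int[borel_lebesgue R n]_t (\prod_(i < n) gauss1 s (e i - tnth t i))%:E)%E); last first.
  by rewrite integral_prod_gauss1// ltry.
apply: ge0_le_integral => //.
- by apply: measurableT_comp => //; exact/measurable_EFinP.
- by apply/measurable_EFinP; exact: measurable_prod_gauss1.
- move=> t _ /=; rewrite lee_fin normrM.
  have p0 : 0 <= \prod_(i < n) gauss1 s (e i - tnth t i) by apply: prodr_ge0 => i _; rewrite gauss1_ge0// ltW.
  by rewrite (ger0_norm p0) ler_piMr// cos_max.
Qed.

(** Induction on the dimension with the phase generalised: once the first coordinate [a] is fixed,
    [2 * pi * a * y 0] joins [theta]. The vectors [e] and [y] are sequences on [nat], so that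
    dropping a coordinate is a shift of the index. *)
Lemma Rintegral_gauss_cos n (s theta : R) (e y : nat -> R) : 0 < s ->
  \int[borel_lebesgue R n]_t ((\prod_(i < n) gauss1 s (e i - tnth t i)) * cos (theta + 2 * pi * \sum_(i < n) tnth t i * y i)) =
  cos (theta + 2 * pi * \sum_(i < n) e i * y i) * \prod_(i < n) expR (- (pi * (y i / s) ^+ 2)).
Proof.
move=> s0; elim: n theta e y => [|n IH] theta e y.
  rewrite /Rintegral /= integral_dirac//=.
    by rewrite indicE in_setT !big_ord0 !mul1r mulr1.
  by apply/measurable_EFinP; exact: measurable_gauss_cos.
rewrite /Rintegral integral_borelS; last exact: integrable_gauss_cos.
have E (a : R) (t : n.-tuple U) :
   (\prod_(i < n.+1) gauss1 s (e i - tnth (tuple_cons (a, t)) i)) * cos (theta + 2 * pi * \sum_(i < n.+1) tnth (tuple_cons (a, t)) i * y i) =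
   gauss1 s (e 0%N - a) * ((\prod_(i < n) gauss1 s (e i.+1 - tnth t i)) * cos (theta + 2 * pi * a * y 0%N + 2 * pi * \sum_(i < n) tnth t i * y i.+1)).
  rewrite big_ord_recl [in LHS]big_ord_recl /= -mulrA; congr (_ * (_ * cos _)).
    by apply: eq_bigr => i _; rewrite tnthS.
  rewrite mulrDr !addrA !mulrA; congr (_ + _ * _).
  by apply: eq_bigr => i _; rewrite tnthS.
pose P := \prod_(i < n) expR (- (pi * (y i.+1 / s) ^+ 2)).
pose c := theta + 2 * pi * \sum_(i < n) e i.+1 * y i.+1.
transitivity (\int[leb]_a (P * (gauss1 s (e 0%N - a) * cos (c + 2 * pi * a * y 0%N)))).
  rewrite /Rintegral; congr fine; apply: eq_integral => a _.
  under eq_integral do rewrite E EFinM.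
  have ig := @integrable_gauss_cos n s (theta + 2 * pi * a * y 0%N) (fun i => e i.+1) (fun i => y i.+1) s0.
  rewrite integralZl//.
  rewrite -(fineK (integrable_fin_num measurableT ig)) -/(Rintegral _ _ _).
  have := IH (theta + 2 * pi * a * y 0%N) (fun i => e i.+1) (fun i => y i.+1).
  rewrite /Rintegral => ->.
  rewrite -EFinM -/P /c; congr EFin.
  by rewrite addrAC; ring.
rewrite RintegralZl//; last first.
  have ig : leb.-integrable setT (EFin \o (fun a => gauss1 s (e 0%N - a))).
    apply/integrableP; split.
      by apply/measurable_EFinP; apply: (measurableT_comp (measurable_gauss1 s)); exact: measurable_funB.
    under eq_integral do rewrite /= ger0_norm ?gauss1_ge0 ?(ltW s0)//.
    by rewrite integral_gauss1_shift// ltry.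
  apply: le_integrable ig => //.
    apply/measurable_EFinP; apply: measurable_funM.
      by apply: (measurableT_comp (measurable_gauss1 s)); exact: measurable_funB.
    apply: (measurableT_comp measurable_cosR); apply: measurable_funD => //.
    by apply: measurable_funM => //; exact: measurable_funM.
  by move=> a _ /=; rewrite lee_fin normrM ler_piMr// cos_max.
rewrite gauss1_conv_cos// big_ord_recl [in RHS]big_ord_recl /= -/P.
rewrite mulrCA [P * _]mulrC; congr (cos _ * _).
have -> : \sum_(i < n) e (bump 0 i) * y (bump 0 i) = \sum_(i < n) e i.+1 * y i.+1 by [].
by rewrite /c; generalize (\sum_(i < n) e i.+1 * y i.+1) => S; ring.
Qed.
End tensor.

(** * Euclidean coordinates on an abstract measure space *)

Section euclidean_coordinates.
Context dX (X : measurableType dX) (R : realType) (d : nat) (coord : X -> 'I_d -> R).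
Implicit Types (x y z : X) (s : R).

Definition sqdist x y : R := \sum_(i < d) (coord x i - coord y i) ^+ 2.
Definition sqnorm x : R := \sum_(i < d) coord x i ^+ 2.
Definition dot x y : R := \sum_(i < d) coord x i * coord y i.

Definition gauss s x y : R := s ^+ d * expR (- (pi * s ^+ 2 * sqdist x y)).
(** The transform of a [gauss s] centred at the origin. Its width is of order [s], whereas that of
    [gauss s] is of order [1 / s]. *)
Definition gaussw s x : R := expR (- (pi * sqnorm x / s ^+ 2)).

Definition cube x (r : R) : set X := [set y | forall i, `|coord y i - coord x i| < r].

(** Euclidean openness, with squared distances to avoid square roots. *)
Definition qopen (A : set X) :=
  forall x, A x -> exists2 delta : R, 0 < delta & forall y, sqdist x y < delta -> A y.

(* An interface to Lebesgue measure on [R^d]: working over an abstract space keeps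
   unification from unfolding [Rn]. *)
Record euclidean (mu : {sigma_finite_measure set X -> \bar R}) : Prop := Euclidean {
  euclidean_coord : forall i, measurable_fun setT (coord ^~ i) ;
  euclidean_gauss : forall s x, 0 < s -> (\int[mu]_y (gauss s x y)%:E = 1)%E ;
  euclidean_gauss_cos : forall s theta x y, 0 < s ->
    \int[mu]_z (gauss s x z * cos (theta + 2 * pi * dot z y)) = cos (theta + 2 * pi * dot x y) * gaussw s y ;
  euclidean_cube : forall x r, 0 <= r -> mu (cube x r) = ((2 * r) ^+ d)%:E ;
  euclidean_regular : forall (A : set X) (e : R), measurable A -> (mu A < +oo)%E -> 0 < e ->
    exists B : set X, [/\ <<s [set O | measurable O /\ qopen O] >> B, A `<=` B & (mu (B `\` A) <= e%:E)%E] ;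
  euclidean_origin : exists o, forall i, coord o i = 0 ;
  euclidean_sub : forall x y, exists z, forall i, coord z i = coord x i - coord y i }.

Lemma gauss_prod s x y : gauss s x y = \prod_(i < d) gauss1 s (coord x i - coord y i).
Proof.
rewrite /gauss /gauss1 big_split /= prodr_const card_ord -expR_sum; congr (_ * expR _).
rewrite /sqdist mulr_sumr -sumrN; apply: eq_bigr => i _; congr (- _).
by rewrite -mulrA exprMn.
Qed.

Lemma sqdist_ge0 x y : 0 <= sqdist x y.
Proof. by apply: sumr_ge0 => i _; exact: sqr_ge0. Qed.

Lemma sqnorm_ge0 x : 0 <= sqnorm x.
Proof. by apply: sumr_ge0 => i _; exact: sqr_ge0. Qed.

Lemma sqdistC x y : sqdist x y = sqdist y x.
Proof. by apply: eq_bigr => i _; rewrite -sqrrN opprB. Qed.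

Lemma dotC x y : dot x y = dot y x.
Proof. by apply: eq_bigr => i _; rewrite mulrC. Qed.

Lemma gauss_ge0 s x y : 0 <= s -> 0 <= gauss s x y.
Proof. by move=> s0; rewrite mulr_ge0 ?exprn_ge0 ?expR_ge0. Qed.

Lemma gaussC s x y : gauss s x y = gauss s y x.
Proof. by rewrite /gauss sqdistC. Qed.

Lemma gauss_le s x y : 0 < s -> gauss s x y <= s ^+ d.
Proof.
move=> s0; rewrite /gauss ler_piMr ?exprn_ge0 ?(ltW s0)//.
rewrite -expR0 ler_expR oppr_le0 mulr_ge0 ?sqdist_ge0//.
by rewrite mulr_ge0 ?pi_ge0// sqr_ge0.
Qed.

Context (mcoord : forall i, measurable_fun setT (coord ^~ i)).

Lemma measurable_coordB i :
  measurable_fun setT ((fun z : X * X => coord z.1 i - coord z.2 i) : X * X -> R).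
Proof.
apply: measurable_funB.
  exact: (measurableT_comp (mcoord i) measurable_fst).
exact: (measurableT_comp (mcoord i) measurable_snd).
Qed.

Lemma measurable_sqdist : measurable_fun setT (fun z : X * X => sqdist z.1 z.2).
Proof.
apply: measurable_sum => i; apply: measurable_funX; exact: measurable_coordB.
Qed.

Lemma measurable_gauss s : measurable_fun setT (fun z : X * X => gauss s z.1 z.2).
Proof.
apply: measurable_funM => //; apply: measurableT_comp => //.
apply: measurableT_comp => //; apply: measurable_funM => //; exact: measurable_sqdist.
Qed.

Lemma measurable_dot : measurable_fun setT (fun z : X * X => dot z.1 z.2).
Proof.
apply: measurable_sum => i; apply: measurable_funM.
  exact: (measurableT_comp (mcoord i) measurable_fst).
exact: (measurableT_comp (mcoord i) measurable_snd).
Qed.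

Lemma measurable_sqnorm : measurable_fun setT sqnorm.
Proof. by apply: measurable_sum => i; apply: measurable_funX; exact: mcoord. Qed.

Lemma cubeE x (r : R) y : (\1_(cube x r) y : R) = \prod_(i < d) \1_(`]coord x i - r, coord x i + r[%classic) (coord y i).
Proof.
have fE (i : 'I_d) : \1_(`]coord x i - r, coord x i + r[%classic) (coord y i) = (`|coord y i - coord x i| < r)%R%:R :> R.
  rewrite indicE mem_setE; congr (nat_of_bool _)%:R.
  by rewrite in_itv /= ltr_distl.
have [Ay|Ay] := pselect (cube x r y).
  rewrite indicE mem_set// big1// => i _.
  by rewrite fE Ay.
rewrite indicE memNset//.
move/existsNP : Ay => [i ni].
by rewrite (bigD1 i)//= fE; move/negP/negbTE : ni => ->; rewrite mul0r.
Qed.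

Lemma measurable_cubes (r : R) : measurable_fun setT (fun z : X * X => (\1_(cube z.1 r) z.2 : R)).
Proof.
under eq_fun do rewrite cubeE.
apply: measurable_prod => i _.
rewrite (_ : (fun z : X * X => _) = \1_(`]- r, r[%classic) \o (fun z : X * X => coord z.2 i - coord z.1 i)).
  apply: measurableT_comp; first exact: measurable_indic.
  apply: measurable_funB.
    exact: (measurableT_comp (mcoord i) measurable_snd).
  exact: (measurableT_comp (mcoord i) measurable_fst).
apply/funext => z /=; rewrite !indicE !mem_setE !in_itv /=; congr (nat_of_bool _)%:R.
by apply/idP/idP => /andP[? ?]; apply/andP; split; lra.
Qed.

Lemma measurable_cube x (r : R) : measurable (cube x r).
Proof.
have mi : measurable_fun setT (fun y => (\1_(cube x r) y : R)).
  exact: (measurableT_comp (measurable_cubes r) (@measurable_pair1 _ _ _ _ x)).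
have -> : cube x r = (fun y => (\1_(cube x r) y : R)) @^-1` [set 1].
  apply/seteqP; split => y /=; rewrite indicE.
    by move=> Ay; rewrite mem_set.
  by case: (boolP (y \in _)) => [/set_mem//|_ /eqP]; rewrite eq_sym oner_eq0.
by rewrite -[X in measurable X]setTI; apply: mi => //; exact: measurable_set1.
Qed.

Lemma measurable_qball x (t : R) : measurable [set y | sqdist x y < t].
Proof.
have mf : measurable_fun setT (sqdist x).
  exact: (measurableT_comp measurable_sqdist (@measurable_pair1 _ _ _ _ x)).
rewrite -[X in measurable X]setTI (_ : [set y | _] = sqdist x @^-1` `]-oo, t[%classic).
  exact: mf.
by apply/seteqP; split => y /=; rewrite in_itv.
Qed.

Lemma measurable_qnorm (t : R) : measurable [set y | sqnorm y < t].
Proof.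
rewrite -[X in measurable X]setTI (_ : [set y | _] = sqnorm @^-1` `]-oo, t[%classic).
  exact: measurable_sqnorm.
by apply/seteqP; split => y /=; rewrite in_itv.
Qed.
End euclidean_coordinates.

Section Rn_euclidean.
Context {R : realType} (d : nat).
Local Notation X := (Rn R d).
Local Notation U := (measurableTypeR R).
Local Notation mu := (@lebesgue R d).
Local Notation coord := (@Defs.coord R d).
Implicit Types (x y z : X) (s : R).

Definition nth_coord x (i : nat) : R := nth 0 (x : d.-tuple R) i.

Lemma nth_coordE x (i : 'I_d) : nth_coord x i = coord x i.
Proof. by rewrite /nth_coord /Defs.coord (tnth_nth 0). Qed.

Lemma integral_gauss s x : 0 < s -> (\int[mu]_y (gauss coord s x y)%:E = 1)%E.
Proof.
move=> s0; rewrite -(@integral_prod_gauss1 R d s (nth_coord x) s0).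
rewrite ge0_integral_lebesgue_borel.
- apply: eq_integral => y _; rewrite gauss_prod; congr EFin; apply: eq_bigr => i _.
  by rewrite nth_coordE.
- by apply/measurable_EFinP; exact: measurable_prod_gauss1.
- by move=> y; rewrite lee_fin; apply: prodr_ge0 => i _; rewrite gauss1_ge0// ltW.
Qed.

Lemma Rintegral_gauss_dotp s theta x y : 0 < s ->
  \int[mu]_z (gauss coord s x z * cos (theta + 2 * pi * dotp z y)) = cos (theta + 2 * pi * dotp x y) * gaussw coord s y.
Proof.
move=> s0.
have := @Rintegral_gauss_cos R d s theta (nth_coord x) (nth_coord y) s0.
rewrite {1}/Rintegral integral_lebesgue_borel -?/(Rintegral _ _ _); last first.
  by apply/measurable_EFinP; exact: measurable_gauss_cos.
have -> : \sum_(i < d) nth_coord x i * nth_coord y i = dotp x y.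
  by apply: eq_bigr => i _; rewrite !nth_coordE.
have -> : \prod_(i < d) expR (- (pi * (nth_coord y i / s) ^+ 2)) = gaussw coord s y.
  rewrite -expR_sum /gaussw; congr expR; rewrite sumrN; congr (- _).
  rewrite /sqnorm mulr_sumr mulr_suml; apply: eq_bigr => i _.
  by rewrite nth_coordE exprMn exprVn mulrA.
move=> <-; rewrite /Rintegral; congr fine; apply: eq_integral => z _.
congr ((_ * cos (_ + _ * _))%:E).
  by rewrite gauss_prod; apply: eq_bigr => i _; rewrite nth_coordE.
by apply: eq_bigr => i _; rewrite nth_coordE.
Qed.

Lemma lebesgue_cube x (r : R) : 0 <= r -> mu (cube coord x r) = ((2 * r) ^+ d)%:E.
Proof.
move=> r0.
pose f (i : nat) (z : R) : R := \1_(`]nth_coord x i - r, nth_coord x i + r[%classic) z.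
have mf i : measurable_fun setT (f i) by exact: measurable_indic.
have f0 i (z : R) : 0 <= f i z by rewrite /f indicE.
have := @ge0_integral_prod R d f mf f0.
have -> : (\prod_(i < d) \int[@lebesgue_measure R]_z (f i z)%:E)%E = ((2 * r) ^+ d)%:E.
  have If i : (\int[@lebesgue_measure R]_z (f i z)%:E = (2 * r)%:E)%E.
    rewrite /f integral_indic//.
    rewrite setIT.
    apply: (etrans (lebesgue_measure_itv (`]nth_coord x i - r, nth_coord x i + r[))).
    rewrite /= lte_fin.
    case: ifPn => [_|]; first by rewrite -EFinB; congr EFin; ring.
    by rewrite -leNgt => h; congr EFin; lra.
  under eq_bigr do rewrite If.
  by rewrite big_const_ord; elim: (d) => [|k IH]; rewrite ?expr0 //= IH exprS EFinM.
have mA : measurable (cube coord x r) by apply: measurable_cube => i; exact: measurable_coord.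
move=> <-; rewrite -[X in mu X](setIT) -integral_indic//.
rewrite ge0_integral_lebesgue_borel.
- apply: eq_integral => y _; congr EFin.
  by rewrite cubeE; apply: eq_bigr => i _; rewrite -nth_coordE.
- apply/measurable_EFinP; apply: measurable_prod => i _.
  exact: (measurableT_comp (mf i) (measurable_tnth i)).
- by move=> y; rewrite lee_fin; apply: prodr_ge0 => i _.
Qed.

(** Coordinate preimages generate the sigma-algebra of tuples and half-lines generate that of the
    line; the preimage of an open half-line under a coordinate is open. *)
Lemma borel_qopen (A : set (d.-tuple U)) : measurable A ->
  <<s [set O : set X | measurable O /\ qopen coord O] >> A.
Proof.
set G := [set O : set X | measurable O /\ qopen coord O].
apply: smallest_sub; first exact: smallest_sigma_algebra.
rewrite -bigcup_seq; apply: bigcup_sub => i _ _ [Y mY <-]; rewrite setTI.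
have mi : measurable_fun setT ((fun x : g_sigma_algebraType G => coord x i) : g_sigma_algebraType G -> R).
  apply: (measurability _ (RGenOInfty.measurableE R)) => _ [_ [a ->] <-].
  rewrite setTI; apply: sub_sigma_algebra; split.
    rewrite -[X in measurable X]setTI; apply: measurable_coord => //; exact: measurable_itv.
  move=> x; rewrite /= in_itv /= andbT => ax.
  exists ((coord x i - a) ^+ 2); first by rewrite exprn_gt0// subr_gt0.
  move=> y xy; rewrite in_itv /= andbT ltNge; apply/negP => ya.
  move: xy; apply/negP; rewrite -leNgt /sqdist (bigD1 i)//=.
  apply: (@le_trans _ _ ((coord x i - coord y i) ^+ 2)).
    by rewrite ler_sqr ?nnegrE ?subr_ge0 ?(ltW ax)// ?lerD2l ?lerN2// (le_trans ya)// ltW.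
  by rewrite lerDl; apply: sumr_ge0 => j _; exact: sqr_ge0.
have := mi measurableT Y mY; rewrite setTI; exact.
Qed.

(** The Lebesgue measure is an infimum over countable covers by Borel sets, and the union of a cover
    within [e] of the infimum serves as [B]. *)
Lemma lebesgue_regular (A : set X) (e : R) : measurable A -> (mu A < +oo)%E -> 0 < e ->
    exists B : set X, [/\ <<s [set O : set X | measurable O /\ qopen coord O] >> B, A `<=` B & (mu (B `\` A) <= e%:E)%E].
Proof.
move=> mA Aoo e0.
have muA : mu A = mu_ext (borel_lebesgue R d) A by [].
have Afin : mu A \is a fin_num by rewrite ge0_fin_numE.
have Afin' := Afin; rewrite muA /mu_ext in Afin'.
have [_ [F [mF AF] <-] lte0] := lb_ereal_inf_adherent e0 Afin'.
have lte : (\sum_(k <oo) borel_lebesgue R d (F k) < mu A + e%:E)%E by rewrite muA; exact: lte0.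
have mUF : measurable (\bigcup_k F k) by exact: bigcup_measurable.
exists (\bigcup_k F k); split => //; first exact: borel_qopen.
have leU : (mu (\bigcup_k F k) <= mu A + e%:E)%E.
  apply: le_trans (ltW lte).
  rewrite lebesgue_borel//; exact: measure_sigma_subadditive.
rewrite measureD//; first last.
- by apply: le_lt_trans leU _; rewrite lte_add_pinfty// ltry.
- exact: Rn_measurable_borel.
rewrite setIidr// leeBlDr//; by rewrite addeC.
Qed.

Lemma lebesgue_euclidean : euclidean coord mu.
Proof.
split.
- exact: measurable_coord.
- exact: integral_gauss.
- exact: Rintegral_gauss_dotp.
- exact: lebesgue_cube.
- exact: lebesgue_regular.
- exists [tuple of nseq d 0] => i.
  by rewrite /Defs.coord tnth_nseq.
- move=> x y; exists (mktuple (fun i => coord x i - coord y i)) => i.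
  by rewrite {1}/Defs.coord tnth_mktuple.
Qed.
End Rn_euclidean.

(** * Square-integrable functions and kernel operators *)

Section L2real.
Context dX (X : measurableType dX) (R : realType) (mu : {sigma_finite_measure set X -> \bar R}).
Implicit Types (u v w h : X -> R) (F A : set X).

Definition L1 u := mu.-integrable setT (EFin \o u).
(** The squared [L2] norm. Squared, it is additive over disjoint supports; extended-real valued, it
    makes sense before square integrability is known. *)
Definition N2 u : \bar R := (\int[mu]_x (u x ^+ 2)%:E)%E.
Definition L2 u := measurable_fun setT u /\ (N2 u < +oo)%E.

Lemma L1_measurable u : L1 u -> measurable_fun setT u.
Proof. by move=> /integrableP[/measurable_EFinP]. Qed.

Lemma L1D u v : L1 u -> L1 v -> L1 (fun x => u x + v x).
Proof.
move=> iu iv; rewrite /L1 (_ : _ \o _ = (EFin \o u) \+ (EFin \o v))%E; last exact/funext.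
exact: integrableD.
Qed.

Lemma L1Z c u : L1 u -> L1 (fun x => c * u x).
Proof.
move=> iu; rewrite /L1 (_ : _ \o _ = (fun x => c%:E * (EFin \o u) x))%E; last exact/funext.
exact: integrableZl.
Qed.

Lemma L1_le u v : measurable_fun setT u -> L1 v -> (forall x, `|u x| <= `|v x|) -> L1 u.
Proof.
move=> mu' iv uv; apply: le_integrable iv => //; first exact/measurable_EFinP.
by move=> x _; rewrite /= lee_fin.
Qed.

Lemma L1_bounded_mul (c : R) h u : measurable_fun setT h -> (forall x, `|h x| <= c) -> L1 u -> L1 (fun x => h x * u x).
Proof.
move=> mh hc iu; apply: (@L1_le _ (fun x => c * u x)); last 1 first.
- by move=> x; rewrite !normrM ler_wpM2r// (le_trans (hc x))// ler_norm.
- by apply: measurable_funM => //; exact: L1_measurable.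
- exact: L1Z.
Qed.

Lemma L1N u : L1 u -> L1 (fun x => - u x).
Proof. by move=> iu; have := L1Z (-1) iu; under [X in L1 X -> _]eq_fun do rewrite mulN1r. Qed.

Lemma L1B u v : L1 u -> L1 v -> L1 (fun x => u x - v x).
Proof. by move=> iu iv; apply: L1D => //; exact: L1N. Qed.

Lemma L1_sum (I : Type) (r : seq I) (P : pred I) (f : I -> X -> R) :
  (forall i, P i -> L1 (f i)) -> L1 (fun x => \sum_(i <- r | P i) f i x).
Proof.
move=> fi; elim: r => [|i r IH].
  under eq_fun do rewrite big_nil; exact: integrable0.
under eq_fun do rewrite big_cons.
case Pi : (P i) => //; apply: L1D => //; exact: fi.
Qed.

Lemma N2_ge0 u : (0 <= N2 u)%E.
Proof. by apply: integral_ge0 => x _; rewrite lee_fin sqr_ge0. Qed.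

Lemma measurable_sqr_EFin u : measurable_fun setT u -> measurable_fun setT (fun x => (u x ^+ 2)%:E).
Proof. by move=> mu'; apply/measurable_EFinP; exact: measurable_funX. Qed.

Lemma L2_sqr_L1 u : L2 u <-> measurable_fun setT u /\ L1 (fun x => u x ^+ 2).
Proof.
split => [[mu' Nu]|[mu' iu]]; split => //.
  apply/integrableP; split; first exact: measurable_sqr_EFin.
  by under eq_integral do rewrite /= ger0_norm ?sqr_ge0//.
by rewrite /N2; apply: integrable_lty iu.
Qed.

Lemma le_N2 u v : measurable_fun setT u -> measurable_fun setT v -> (forall x, `|u x| <= `|v x|) -> (N2 u <= N2 v)%E.
Proof.
move=> mu' mv uv; apply: ge0_le_integral => //.
- by move=> x _; rewrite lee_fin sqr_ge0.
- exact: measurable_sqr_EFin.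
- exact: measurable_sqr_EFin.
- move=> x _; rewrite lee_fin -(@real_normK _ (u x)) ?num_real// -(@real_normK _ (v x)) ?num_real//.
  by rewrite ler_sqr.
Qed.

Lemma N2Z c u : measurable_fun setT u -> N2 (fun x => c * u x) = ((c ^+ 2)%:E * N2 u)%E.
Proof.
move=> mu'; rewrite /N2; under eq_integral do rewrite exprMn EFinM.
rewrite ge0_integralZl//; first exact: measurable_sqr_EFin.
- by move=> x _; rewrite lee_fin sqr_ge0.
- by rewrite lee_fin sqr_ge0.
Qed.

Lemma N2N u : N2 (fun x => - u x) = N2 u.
Proof. by apply: eq_integral => x _; rewrite sqrrN. Qed.

Lemma N2D_le u v : measurable_fun setT u -> measurable_fun setT v ->
  (N2 (fun x => u x + v x)%R <= 2%:E * N2 u + 2%:E * N2 v)%E.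
Proof.
move=> mu' mv; rewrite /N2.
rewrite -ge0_integralZl//; first last.
- by move=> x _; rewrite lee_fin sqr_ge0.
- exact: measurable_sqr_EFin.
rewrite -[X in (_ <= _ + X)%E]ge0_integralZl//; first last.
- by move=> x _; rewrite lee_fin sqr_ge0.
- exact: measurable_sqr_EFin.
rewrite -ge0_integralD//; first last.
- by apply: measurable_funeM; exact: measurable_sqr_EFin.
- by move=> x _; rewrite -EFinM lee_fin mulr_ge0// sqr_ge0.
- by apply: measurable_funeM; exact: measurable_sqr_EFin.
- by move=> x _; rewrite -EFinM lee_fin mulr_ge0// sqr_ge0.
apply: ge0_le_integral => //.
- by move=> x _; rewrite lee_fin sqr_ge0.
- by apply: measurable_sqr_EFin; exact: measurable_funD.
- by apply: emeasurable_funD; apply: measurable_funeM; exact: measurable_sqr_EFin.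
- move=> x _; rewrite -!EFinM -EFinD lee_fin.
  have := sqr_ge0 (u x - v x); nra.
Qed.

Lemma L2D u v : L2 u -> L2 v -> L2 (fun x => u x + v x).
Proof.
move=> [mu' Nu] [mv Nv]; split; first exact: measurable_funD.
apply: le_lt_trans (N2D_le mu' mv) _.
by rewrite lte_add_pinfty// lte_mul_pinfty.
Qed.

Lemma L2Z c u : L2 u -> L2 (fun x => c * u x).
Proof.
move=> [mu' Nu]; split; first exact: measurable_funM.
by rewrite N2Z// lte_mul_pinfty// ?lee_fin ?sqr_ge0.
Qed.

Lemma L2_le u v : measurable_fun setT u -> L2 v -> (forall x, `|u x| <= `|v x|) -> L2 u.
Proof. by move=> mu' [mv Nv] uv; split => //; apply: le_lt_trans Nv; exact: le_N2. Qed.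

Lemma L2_bounded_mul (c : R) h u : measurable_fun setT h -> (forall x, `|h x| <= c) -> L2 u -> L2 (fun x => h x * u x).
Proof.
move=> mh hc L2u; apply: (@L2_le _ (fun x => c * u x)); last 1 first.
- by move=> x; rewrite !normrM ler_wpM2r// (le_trans (hc x))// ler_norm.
- by apply: measurable_funM => //; case: L2u.
- exact: L2Z.
Qed.

Lemma L2N u : L2 u -> L2 (fun x => - u x).
Proof. by move=> iu; have := L2Z (-1) iu; under [X in L2 X -> _]eq_fun do rewrite mulN1r. Qed.

Lemma L2B u v : L2 u -> L2 v -> L2 (fun x => u x - v x).
Proof. by move=> iu iv; apply: L2D => //; exact: L2N. Qed.

Lemma L2_mul_L1 u v : L2 u -> L2 v -> L1 (fun x => u x * v x).
Proof.
move=> /L2_sqr_L1[mu' iu] /L2_sqr_L1[mv iv].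
apply: (@L1_le _ (fun x => u x ^+ 2 + v x ^+ 2)); last 1 first.
- move=> x; rewrite [leRHS]ger0_norm ?addr_ge0 ?sqr_ge0// normrM.
  rewrite -(@real_normK _ (u x)) ?num_real// -(@real_normK _ (v x)) ?num_real//.
  have := sqr_ge0 (`|u x| - `|v x|); have := sqr_ge0 (`|u x| + `|v x|); nra.
- exact: measurable_funM.
- exact: L1D.
Qed.

Lemma L2_indic A : measurable A -> (mu A < +oo)%E -> L2 (\1_A).
Proof.
move=> mA Aoo; split; first exact: measurable_indic.
rewrite /N2 (_ : (fun _ => _) = fun x => (\1_A x)%:E); last first.
  by apply/funext => x; rewrite indicE; case: (_ \in _); rewrite ?expr1n ?expr0n.
by rewrite integral_indic// setIT.
Qed.

Lemma norm_indic_le1 A x : `|\1_A x : R| <= 1.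
Proof. by rewrite indicE; case: (_ \in _); rewrite ?normr1 ?normr0. Qed.

Lemma L2_indic_mul A u : measurable A -> L2 u -> L2 (fun x => \1_A x * u x).
Proof. by move=> mA; apply: (@L2_bounded_mul 1) => //; exact: norm_indic_le1. Qed.

Lemma L1_indic_mul A u : measurable A -> L1 u -> L1 (fun x => \1_A x * u x).
Proof. by move=> mA; apply: (@L1_bounded_mul 1) => //; exact: norm_indic_le1. Qed.

Lemma L2_indic_L1 A u : measurable A -> (mu A < +oo)%E -> L2 u -> L1 (fun x => \1_A x * u x).
Proof. by move=> mA Aoo L2u; apply: L2_mul_L1 => //; exact: L2_indic. Qed.

(** Expand the nonnegative variance of [h] under the probability density [w], with [m] the mean. *)
Lemma jensen_sqr w h : (forall x, 0 <= w x) -> L1 w -> \int[mu]_x w x = 1 -> measurable_fun setT h ->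
  L1 (fun x => w x * h x ^+ 2) -> (\int[mu]_x (w x * h x)) ^+ 2 <= \int[mu]_x (w x * h x ^+ 2).
Proof.
move=> w0 iw w1 mh iwh2.
have mw := L1_measurable iw.
(* [|h| <= 1 + h^2], and [w] has finite mass. *)
have iwh : L1 (fun x => w x * h x).
  apply: (@L1_le _ (fun x => w x + w x * h x ^+ 2)); last 1 first.
  - move=> x.
    have wh0 : 0 <= w x * h x ^+ 2 by rewrite mulr_ge0// sqr_ge0.
    rewrite [leRHS]ger0_norm; last by rewrite addr_ge0.
    rewrite normrM (ger0_norm (w0 x)).
    rewrite -[X in _ <= X + _]mulr1 -mulrDr ler_wpM2l//.
    rewrite -(@real_normK _ (h x)) ?num_real//; have := sqr_ge0 (`|h x| - 1); have := normr_ge0 (h x); nra.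
  - exact: measurable_funM.
  - exact: L1D.
set m := \int[mu]_x (w x * h x).
have : 0 <= \int[mu]_x (w x * (h x - m) ^+ 2).
  by apply: Rintegral_ge0 => x _; rewrite mulr_ge0// sqr_ge0.
have -> : \int[mu]_x (w x * (h x - m) ^+ 2) =
  \int[mu]_x (w x * h x ^+ 2 + (- (2 * m) * (w x * h x) + m ^+ 2 * w x)).
  by apply: eq_Rintegral => x _; ring.
have i1 := L1Z (- (2 * m)) iwh.
have i2 := L1Z (m ^+ 2) iw.
rewrite RintegralD//; last exact: L1D.
rewrite RintegralD// !RintegralZl// w1 -/m.
nra.
Qed.

(** At each point the truncation error is eventually zero, and [u^2] dominates its square. *)
Lemma cvg_N2_truncate (A : nat -> set X) u : (forall n, measurable (A n)) ->
  (forall x, \forall n \near \oo, A n x) -> L2 u ->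
  N2 (fun x => u x - \1_(A n) x * u x) @[n --> \oo] --> 0%E.
Proof.
move=> mA Ax /L2_sqr_L1[mu' iu].
have mf n : measurable_fun setT (fun x => ((u x - \1_(A n) x * u x) ^+ 2)%:E).
  by apply: measurable_sqr_EFin; apply: measurable_funB => //; apply: measurable_funM.
have m0 : measurable_fun setT (cst 0%E : X -> \bar R) by [].
have cv : {ae mu, forall x, setT x -> ((u x - \1_(A n) x * u x) ^+ 2)%:E @[n --> \oo] --> (cst 0%E x : \bar R)}.
  apply: aeW => x _ /=; apply: cvg_near_cst.
  have := Ax x; apply: filterS => n Anx.
  by rewrite indicE mem_set// mul1r subrr expr0n.
have bd : {ae mu, forall x n, setT x -> (`|((u x - \1_(A n) x * u x) ^+ 2)%:E| <= (EFin \o (fun x => u x ^+ 2)%R) x)%E}.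
  apply: aeW => x n _ /=; rewrite lee_fin ger0_norm ?sqr_ge0// indicE.
  by case: (_ \in _); rewrite ?mul1r ?mul0r ?subrr ?subr0 ?expr0n //= sqr_ge0.
have [_ _] := @dominated_convergence _ _ R mu setT measurableT _ _ _ mf m0 cv iu bd.
by rewrite integral0.
Qed.
End L2real.

(** * Integral operators with bounded kernels *)

Section kernel_operator.
Context dX (X : measurableType dX) (R : realType) (mu : {sigma_finite_measure set X -> \bar R}).
Implicit Types (u v w h : X -> R) (F A : set X) (k : X -> X -> R).
Local Notation L1 := (L1 mu).
Local Notation L2 := (L2 mu).
Local Notation N2 := (N2 mu).

Definition kop k u x : R := \int[mu]_y (k x y * u y).

Definition bounded_kernel k := measurable_fun setT (fun z : X * X => k z.1 z.2) /\ exists c, forall x y, `|k x y| <= c.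

Lemma bounded_kernel_tr k : bounded_kernel k -> bounded_kernel (fun x y => k y x).
Proof.
move=> [mk [c kc]]; split; last by exists c => x y.
exact: (measurableT_comp mk (@measurable_swap _ _ _ _)).
Qed.

Lemma kernel_section_measurable k x : bounded_kernel k -> measurable_fun setT (k x).
Proof. by move=> [mk _]; exact: (measurableT_comp mk (@measurable_pair1 _ _ _ _ x)). Qed.

Lemma measurable_kernel2 k u : bounded_kernel k -> measurable_fun setT u ->
  measurable_fun setT (fun z : X * X => k z.1 z.2 * u z.2).
Proof. by move=> [mk _] mu'; apply: measurable_funM => //; exact: measurableT_comp. Qed.

Lemma kernel_L1 k u x : bounded_kernel k -> L1 u -> L1 (fun y => k x y * u y).
Proof.
move=> bk iu; have [_ [c kc]] := bk.
by apply: (@L1_bounded_mul _ _ _ _ c) => //; exact: kernel_section_measurable.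
Qed.

Lemma kopE k u x : bounded_kernel k -> L1 u -> (kop k u x)%:E = (\int[mu]_y (k x y * u y)%:E)%E.
Proof. by move=> bk iu; rewrite /kop /Rintegral fineK//; apply: integrable_fin_num => //; exact: kernel_L1. Qed.

Lemma measurable_kop k u : bounded_kernel k -> measurable_fun setT u -> measurable_fun setT (kop k u).
Proof.
move=> bk mu'; rewrite /kop /Rintegral.
have mf : measurable_fun setT (fun z : X * X => (k z.1 z.2 * u z.2)%:E).
  by apply/measurable_EFinP; exact: measurable_kernel2.
have mp0 := measurable_funepos mf; have mn0 := measurable_funeneg mf.
have := measurable_fun_fubini_tonelli_F (m2 := mu) _ mp0 (funepos_ge0 _).
have := measurable_fun_fubini_tonelli_F (m2 := mu) _ mn0 (funeneg_ge0 _).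
rewrite /fubini_F => mn mp.
under eq_fun do rewrite integralE.
rewrite (_ : (fun x => fine _) = fine \o (fun x =>
   \int[mu]_y ((fun z : X * X => (k z.1 z.2 * u z.2)%:E)^\+ (x, y)) -
   \int[mu]_y ((fun z : X * X => (k z.1 z.2 * u z.2)%:E)^\- (x, y)))%E).
  by apply: measurableT_comp => //; exact: emeasurable_funB.
apply/funext => x /=; congr (fine (_ - _)%E); apply: eq_integral => y _.
  by rewrite !funeposE.
by rewrite !funenegE.
Qed.

Lemma kop_bound k u c x : bounded_kernel k -> (forall x y, `|k x y| <= c) -> L1 u -> `|kop k u x| <= c * \int[mu]_y `|u y|.
Proof.
move=> bk kc iu; have ik := kernel_L1 x bk iu.
apply: le_trans (le_normr_Rintegral measurableT ik) _.
have iu' : L1 (fun y => `|u y|).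
  by apply: (@L1_le _ _ _ _ _ u) => //; [exact: measurableT_comp (L1_measurable iu)|move=> y; rewrite normr_id].
rewrite -RintegralZl//; apply: le_Rintegral => //.
- by apply: (@L1_le _ _ _ _ _ (fun y => k x y * u y)) => //; [exact: measurableT_comp (L1_measurable ik)|move=> y; rewrite normr_id].
- exact: L1Z.
- by move=> y _; rewrite normrM ler_wpM2r.
Qed.

Lemma kop_bounded k u : bounded_kernel k -> L1 u -> exists c, forall x, `|kop k u x| <= c.
Proof. by move=> bk iu; have [_ [c kc]] := bk; exists (c * \int[mu]_y `|u y|) => x; exact: kop_bound. Qed.

(** Fubini for [v x * k x y * u y], which is integrable on the product because [k] is bounded. *)
Lemma kop_swap k u v : bounded_kernel k -> L1 u -> L1 v ->
  \int[mu]_x (v x * kop k u x) = \int[mu]_y (u y * kop (fun x y => k y x) v y).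
Proof.
move=> bk iu iv; have [_ [c kc]] := bk.
have mu' := L1_measurable iu; have mv := L1_measurable iv.
pose f (z : X * X) : R := v z.1 * (k z.1 z.2 * u z.2).
have mf : measurable_fun setT f.
  by apply: measurable_funM; [exact: measurableT_comp|exact: measurable_kernel2].
have imf : (mu \x mu)%E.-integrable setT (EFin \o f).
  have mfE : measurable_fun setT (EFin \o f) by exact/measurable_EFinP.
  apply/(integrable12ltyP mu mu mfE).
  have iu' : L1 (fun y => `|u y|).
    by apply: (@L1_le _ _ _ _ _ u) => //; [exact: measurableT_comp|move=> y; rewrite normr_id].
  have iv' : L1 (fun y => `|v y|).
    by apply: (@L1_le _ _ _ _ _ v) => //; [exact: measurableT_comp|move=> y; rewrite normr_id].
  pose C := c * \int[mu]_y `|u y|.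
  apply: (@le_lt_trans _ _ (\int[mu]_x (C * `|v x|)%:E)%E); last first.
    by apply: integrable_lty => //; exact: (L1Z C iv').
  apply: ge0_le_integral => //.
  - by move=> x _; exact: integral_ge0.
  - have maf : measurable_fun setT (abse \o (EFin \o f)) by exact: measurableT_comp.
    exact: (measurable_fun_fubini_tonelli_F (m2 := mu) _ maf (fun z => abse_ge0 _)).
  - by apply/measurable_EFinP; apply: measurable_funM => //; exact: measurableT_comp.
  move=> x _.
  apply: (@le_trans _ _ (\int[mu]_y (`|v x| * c * `|u y|)%:E)%E).
    apply: ge0_le_integral => //.
    - apply: measurableT_comp => //; apply/measurable_EFinP; rewrite /f /=; apply: measurable_funM => //.
      by apply: measurable_funM => //; exact: kernel_section_measurable.
    - by apply/measurable_EFinP; apply: measurable_funM => //; exact: measurableT_comp.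
    - move=> y _ /=; rewrite lee_fin /f /= !normrM -mulrA ler_wpM2l//.
      by rewrite ler_wpM2r.
  under eq_integral do rewrite EFinM.
  rewrite integralZl// -(fineK (integrable_fin_num measurableT iu')) -EFinM lee_fin.
  by rewrite -/(Rintegral _ _ _) /C [leRHS]mulrC mulrA.
have := Fubini imf.
rewrite /Rintegral => H; congr fine; rewrite [LHS](_ : _ = \int[mu]_x \int[mu]_y (EFin \o f) (x, y))%E.
  rewrite H; apply: eq_integral => y _ /=; rewrite EFinM kopE//; last exact: bounded_kernel_tr.
  rewrite -integralZl//; last exact: kernel_L1 (bounded_kernel_tr bk) iv.
  by apply: eq_integral => x _; rewrite -EFinM /f /=; congr EFin; ring.
by apply: eq_integral => x _ /=; rewrite EFinM kopE// -integralZl//; exact: kernel_L1.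
Qed.

Lemma kopD k u v x : bounded_kernel k -> L1 u -> L1 v -> kop k (fun y => u y + v y) x = kop k u x + kop k v x.
Proof.
move=> bk iu iv; rewrite /kop -RintegralD//; try exact: kernel_L1.
by apply: eq_Rintegral => y _; rewrite mulrDr.
Qed.

Lemma kopZ k c u x : bounded_kernel k -> L1 u -> kop k (fun y => c * u y) x = c * kop k u x.
Proof.
move=> bk iu; rewrite /kop -RintegralZl//; last exact: kernel_L1.
by apply: eq_Rintegral => y _; rewrite mulrCA.
Qed.

Lemma kopB k u v x : bounded_kernel k -> L1 u -> L1 v -> kop k (fun y => u y - v y) x = kop k u x - kop k v x.
Proof.
move=> bk iu iv; rewrite kopD//; last exact: L1N.
by congr (_ + _); rewrite -mulN1r -kopZ//; congr kop; apply/funext => y; rewrite mulN1r.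
Qed.

(* Jensen's inequality for the probability densities [k x], integrated over [x]. *)
Lemma kop_N2_le k h u : bounded_kernel k -> (forall x y, 0 <= k x y) ->
  (forall x, \int[mu]_y (k x y)%:E = 1)%E -> measurable_fun setT h -> L2 u ->
  (N2 (fun x => h x * kop k u x)%R <= \int[mu]_y ((u y ^+ 2)%:E * \int[mu]_x (h x ^+ 2 * k x y)%:E))%E.
Proof.
move=> bk k0 k1 mh /L2_sqr_L1[mu' iu].
have [mk _] := bk.
have jen x : (kop k u x) ^+ 2 <= kop k (fun y => u y ^+ 2) x.
  apply: jensen_sqr => //.
  - apply/integrableP; split; first by apply/measurable_EFinP; exact: kernel_section_measurable.
    by under eq_integral do rewrite /= ger0_norm//; rewrite k1 ltry.
  - by rewrite /Rintegral k1.
  - exact: kernel_L1.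
pose f (z : X * X) := (h z.1 ^+ 2 * (k z.1 z.2 * u z.2 ^+ 2))%:E.
have mf : measurable_fun setT f.
  apply/measurable_EFinP; apply: measurable_funM.
    by apply: measurable_funX; exact: measurableT_comp.
  by apply: measurable_funM => //; apply: measurable_funX; exact: measurableT_comp.
have f0 z : (0 <= f z)%E by rewrite lee_fin mulr_ge0 ?sqr_ge0// mulr_ge0 ?sqr_ge0.
apply: (@le_trans _ _ (\int[mu]_x \int[mu]_y f (x, y))%E).
  apply: ge0_le_integral => //.
  - by move=> x _; rewrite lee_fin sqr_ge0.
  - by apply: measurable_sqr_EFin; apply: measurable_funM => //; exact: measurable_kop.
  - exact: (measurable_fun_fubini_tonelli_F (m2 := mu) _ mf f0).
  - move=> x _; rewrite /f /=; under eq_integral do rewrite EFinM.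
    rewrite integralZl//; last exact: kernel_L1.
    by rewrite -kopE// -EFinM lee_fin exprMn ler_wpM2l ?sqr_ge0.
rewrite (fubini_tonelli f mf f0) le_eqVlt; apply/orP; left; apply/eqP.
apply: eq_integral => y _; rewrite -ge0_integralZl//.
- by apply: eq_integral => x _; rewrite -EFinM /f /=; congr EFin; ring.
- apply/measurable_EFinP; apply: measurable_funM; first exact: measurable_funX.
  exact: (kernel_section_measurable y (bounded_kernel_tr bk)).
- by move=> x _; rewrite lee_fin mulr_ge0// sqr_ge0.
- by rewrite lee_fin sqr_ge0.
Qed.
End kernel_operator.

(** * Convergence to zero in the extended reals *)

Section ecvg.
Context {R : realType}.

Lemma ecvg0P (f : nat -> \bar R) : (forall n, 0 <= f n)%E ->
  f n @[n --> \oo] --> 0%E <-> (forall e : R, 0 < e -> \forall n \near \oo, (f n <= e%:E)%E).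
Proof.
move=> f0; split=> [/fine_cvgP[ffin /cvgrPdist_le fcv] e e0|h].
  near=> n.
  have fn : f n \is a fin_num by near: n.
  have : `|0 - (fine \o f) n| <= e by near: n; exact: fcv.
  by rewrite sub0r normrN /= ger0_norm ?fine_ge0// -{2}(fineK fn) lee_fin.
apply/fine_cvgP; split.
  have := h 1 ltr01; apply: filterS => n fn1.
  by rewrite ge0_fin_numE// (le_lt_trans fn1)// ltry.
apply/cvgrPdist_le => e e0; have := h e e0; apply: filterS => n fne.
rewrite sub0r normrN /= ger0_norm ?fine_ge0// -lee_fin fineK//.
by rewrite ge0_fin_numE// (le_lt_trans fne)// ltry.
Unshelve. all: by end_near. Qed.

Lemma ecvg0_le (f g : nat -> \bar R) : (forall n, 0 <= f n <= g n)%E -> g n @[n --> \oo] --> 0%E -> f n @[n --> \oo] --> 0%E.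
Proof.
move=> fg g0; apply: (@squeeze_cvge _ _ _ _ (cst 0%E) _ g) => //; last exact: cvg_cst.
exact: nearW.
Qed.

Lemma ecvg0D (f g : nat -> \bar R) : f n @[n --> \oo] --> 0%E -> g n @[n --> \oo] --> 0%E -> (f n + g n)%E @[n --> \oo] --> 0%E.
Proof. by move=> f0 g0; rewrite -[X in _ --> X]adde0; apply: cvgeD. Qed.

Lemma ecvg0Z (c : R) (f : nat -> \bar R) : f n @[n --> \oo] --> 0%E -> (c%:E * f n)%E @[n --> \oo] --> 0%E.
Proof. by move=> f0; rewrite -[X in _ --> X](mule0 c%:E); apply: cvgeZl. Qed.
End ecvg.

Section dominated.
Context dX (X : measurableType dX) (R : realType) (mu : {sigma_finite_measure set X -> \bar R}).

Lemma cvg_N2_dominated (f : nat -> X -> R) (u g : X -> R) :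
  (forall n, measurable_fun setT (f n)) -> measurable_fun setT u -> L2 mu g ->
  (forall x, f n x @[n --> \oo] --> u x) -> (forall n x, `|f n x - u x| <= `|g x|) ->
  N2 mu (fun x => f n x - u x) @[n --> \oo] --> 0%E.
Proof.
move=> mf mu' /L2_sqr_L1[mg ig] fu fg.
have mfu n : measurable_fun setT (fun x => ((f n x - u x) ^+ 2)%:E).
  by apply: measurable_sqr_EFin; apply: measurable_funB.
have m0 : measurable_fun setT (cst 0%E : X -> \bar R) by [].
have cv : {ae mu, forall x, setT x -> ((f n x - u x) ^+ 2)%:E @[n --> \oo] --> (cst 0%E x : \bar R)}.
  apply: aeW => x _ /=; apply: cvg_EFin; first exact: nearW.
  rewrite /comp /=.
  have h : (f n x - u x) @[n --> \oo] --> (0 : R).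
    by rewrite -(subrr (u x)); apply: cvgB => //; exact: cvg_cst.
  have -> : (0 : R) = 0 * 0 by rewrite mulr0.
  by under eq_fun do rewrite expr2; exact: cvgM.
have bd : {ae mu, forall x n, setT x -> (`|((f n x - u x) ^+ 2)%:E| <= (EFin \o (fun x => g x ^+ 2)%R) x)%E}.
  apply: aeW => x n _ /=; rewrite lee_fin ger0_norm ?sqr_ge0//.
  rewrite -(@real_normK _ (_ - _)) ?num_real// -(@real_normK _ (g x)) ?num_real//.
  by rewrite ler_sqr ?nnegrE.
have [_ _] := @dominated_convergence _ _ R mu setT measurableT _ _ _ mfu m0 cv ig bd.
by rewrite integral0.
Qed.
End dominated.

(** * Gaussian approximate identity *)

Section approximate_identity.
Context dX (X : measurableType dX) (R : realType) (mu : {sigma_finite_measure set X -> \bar R}).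
Context (d : nat) (coord : X -> 'I_d -> R) (E : euclidean coord mu).
Local Notation L1 := (L1 mu).
Local Notation L2 := (L2 mu).
Local Notation N2 := (N2 mu).
Local Notation gauss := (gauss coord).
Local Notation sqdist := (sqdist coord).
Local Notation qopen := (qopen coord).
Implicit Types (x y : X) (u v : X -> R) (s : R) (A B F : set X).

Local Notation conv s := (kop mu (gauss s)).

Lemma bounded_kernel_gauss s : 0 < s -> bounded_kernel (gauss s).
Proof.
move=> s0; split; first exact: measurable_gauss (euclidean_coord E) _.
by exists (s ^+ d) => x y; rewrite ger0_norm ?gauss_le// gauss_ge0// ltW.
Qed.

Lemma conv_N2_le s (h : X -> R) u : 0 < s -> measurable_fun setT h -> L2 u ->
  (N2 (fun x => h x * conv s u x)%R <= \int[mu]_y ((u y ^+ 2)%:E * \int[mu]_x (h x ^+ 2 * gauss s x y)%:E))%E.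
Proof.
move=> s0 mh L2u; apply: kop_N2_le => //.
- exact: bounded_kernel_gauss.
- by move=> x y; rewrite gauss_ge0// ltW.
- by move=> x; exact: (euclidean_gauss E).
Qed.

Lemma conv_contraction s u : 0 < s -> L2 u -> (N2 (conv s u) <= N2 u)%E.
Proof.
move=> s0 L2u; have := @conv_N2_le s (cst 1) u s0 (measurable_cst _) L2u.
rewrite (_ : (fun x => _) = conv s u); last by apply/funext => x; rewrite /= mul1r.
move=> /le_trans; apply; rewrite le_eqVlt; apply/orP; left; apply/eqP.
apply: eq_integral => y _; under eq_integral do rewrite /= expr1n mul1r gaussC.
by rewrite (euclidean_gauss E)// mule1.
Qed.

Lemma conv_L2 s u : 0 < s -> L2 u -> L2 (conv s u).
Proof.
move=> s0 L2u; split; last by apply: le_lt_trans (conv_contraction s0 L2u) _; case: L2u.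
by apply: measurable_kop; [exact: bounded_kernel_gauss|case: L2u].
Qed.

(** The class on which the Gaussian approximate identity converges in [L2]. It is enlarged from
    indicators of open sets to every function in both [L1] and [L2]. *)
Definition approx u := [/\ L1 u, L2 u &
  N2 (fun x => conv n.+1%:R u x - u x) @[n --> \oo] --> 0%E].

Lemma measurable_conv s u : 0 < s -> measurable_fun setT u -> measurable_fun setT (conv s u).
Proof. by move=> s0; apply: measurable_kop; exact: bounded_kernel_gauss. Qed.

(** Smoothing is a contraction of [L2], so replacing [u] by [v] costs no more after smoothing than
    before. *)
Lemma approx_closed u : L1 u -> L2 u ->
  (forall e : R, 0 < e -> exists v, approx v /\ (N2 (fun x => u x - v x)%R <= e%:E)%E) -> approx u.
Proof.
move=> L1u L2u h; split => //; apply/ecvg0P; first by move=> n; exact: N2_ge0.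
(* The factors 2 of two nested uses of [N2D_le] add up to [10 / 16]. *)
move=> e e0; have e8 : 0 < e / 16 by rewrite divr_gt0.
have [v [[L1v L2v av] uv]] := h _ e8.
move/ecvg0P : av => /(_ (fun n => N2_ge0 _ _)) /(_ _ e8).
apply: filterS => n vn.
have n0 : 0 < n.+1%:R :> R by rewrite ltr0n.
have mu' : measurable_fun setT u by case: L2u.
have mv' : measurable_fun setT v by case: L2v.
have bk := bounded_kernel_gauss n0.
have -> : (fun x => conv n.+1%:R u x - u x) =
  (fun x => conv n.+1%:R (fun y => u y - v y) x + ((conv n.+1%:R v x - v x) + - (u x - v x))).
  by apply/funext => x; rewrite kopB//; ring.
have muv : measurable_fun setT (fun x => u x - v x) by exact: measurable_funB.
have mcv : measurable_fun setT (fun x => conv n.+1%:R v x - v x).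
  by apply: measurable_funB => //; exact: measurable_conv.
have m1 : measurable_fun setT (conv n.+1%:R (fun y => u y - v y)) by exact: measurable_conv.
have m2 : measurable_fun setT (fun x => - (u x - v x)) by exact: measurableT_comp.
have m3 := measurable_funD mcv m2.
apply: (le_trans (N2D_le mu m1 m3)).
apply: (@le_trans _ _ (2%:E * (e / 16)%:E + 2%:E * (2%:E * (e / 16)%:E + 2%:E * (e / 16)%:E))%E); last first.
  by rewrite -!EFinM -!EFinD lee_fin; lra.
apply: leeD.
  rewrite lee_pmul2l//; apply: le_trans uv; apply: conv_contraction => //; exact: L2B.
rewrite lee_pmul2l//; apply: (le_trans (N2D_le mu mcv m2)).
by apply: leeD; rewrite lee_pmul2l// N2N.
Qed.

Lemma approxD u v : approx u -> approx v -> approx (fun x => u x + v x).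
Proof.
move=> [L1u L2u au] [L1v L2v av]; split; [exact: L1D|exact: L2D|].
apply: ecvg0_le (ecvg0D (ecvg0Z 2 au) (ecvg0Z 2 av)) => n; rewrite N2_ge0 /=.
have n0 : 0 < n.+1%:R :> R by rewrite ltr0n.
have mu' : measurable_fun setT u by case: L2u.
have mv' : measurable_fun setT v by case: L2v.
have bk := bounded_kernel_gauss n0.
rewrite (_ : (fun x => _) = fun x => (conv n.+1%:R u x - u x) + (conv n.+1%:R v x - v x)).
  by apply: N2D_le; apply: measurable_funB => //; exact: measurable_conv.
by apply/funext => x; rewrite kopD//; ring.
Qed.

Lemma approxZ (c : R) u : approx u -> approx (fun x => c * u x).
Proof.
move=> [L1u L2u au]; split; [exact: L1Z|exact: L2Z|].
have mu' : measurable_fun setT u by case: L2u.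
apply: ecvg0_le (ecvg0Z (c ^+ 2) au) => n; rewrite N2_ge0 /=.
have n0 : 0 < n.+1%:R :> R by rewrite ltr0n.
have bk := bounded_kernel_gauss n0.
rewrite -N2Z; last by apply: measurable_funB => //; exact: measurable_conv.
rewrite le_eqVlt; apply/orP; left; apply/eqP; congr (N2 _); apply/funext => x.
by rewrite kopZ//; ring.
Qed.

Lemma approxB u v : approx u -> approx v -> approx (fun x => u x - v x).
Proof.
move=> au av; have := approxD au (approxZ (-1) av).
by congr approx; apply/funext => x; ring.
Qed.

Lemma approx_sum (I : Type) (r : seq I) (P : pred I) (f : I -> X -> R) :
  (forall i, P i -> approx (f i)) -> approx (fun x => \sum_(i <- r | P i) f i x).
Proof.
move=> fi; elim: r => [|i r IH].
  have L10 : L1 (fun=> 0) by exact: integrable0.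
  have L20 : L2 (fun=> 0).
    by split => //; rewrite /N2; under eq_integral do rewrite expr0n; rewrite integral0.
  under eq_fun do rewrite big_nil; split => //.
  rewrite (_ : (fun n => _) = cst 0%E); first exact: cvg_cst.
  apply/funext => n; rewrite /N2 -[RHS](@integral0 _ _ _ mu setT); apply: eq_integral => x _.
  rewrite subr0 /kop; under eq_Rintegral do rewrite mulr0.
  by rewrite /Rintegral integral0 expr0n.
under eq_fun do rewrite big_cons.
case Pi : (P i) => //; apply: approxD => //; exact: fi.
Qed.

(** Passing to half the scale costs a factor [2^d] and keeps a quarter of the exponent; more than
    half of it remains to produce decay. The factor that is left over is a density of total mass
    1. *)
Lemma gauss_tail s (delta : R) x y : 0 < s -> 0 < delta -> delta <= sqdist x y ->
  gauss s x y <= 2 ^+ d * expR (- (pi * s ^+ 2 * delta / 2)) * gauss (s / 2) x y.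
Proof.
move=> s0 d0 dxy; rewrite /gauss.
have -> : s ^+ d = 2 ^+ d * (s / 2) ^+ d by rewrite -exprMn; congr (_ ^+ d); field.
rewrite [leRHS]mulrACA ler_wpM2l ?mulr_ge0 ?exprn_ge0 ?divr_ge0 ?(ltW s0)//.
rewrite -expRD ler_expR.
have p0 : 0 <= pi * s ^+ 2 :> R by rewrite mulr_ge0 ?pi_ge0// sqr_ge0.
have -> : pi * (s / 2) ^+ 2 * sqdist x y = (pi * s ^+ 2) * sqdist x y / 4 by field.
have : pi * s ^+ 2 * delta <= pi * s ^+ 2 * sqdist x y by rewrite ler_wpM2l.
have : 0 <= pi * s ^+ 2 * delta by rewrite mulr_ge0// ltW.
lra.
Qed.

Lemma sqr_indic A x : (\1_A x : R) ^+ 2 = \1_A x.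
Proof. by rewrite indicE; case: (_ \in _); rewrite ?expr1n ?expr0n. Qed.

Lemma N2_indic A : measurable A -> N2 \1_A = mu A.
Proof.
move=> mA; rewrite /Submission.N2; under eq_integral do rewrite sqr_indic.
by rewrite integral_indic// setIT.
Qed.

Lemma L1_indic A : measurable A -> (mu A < +oo)%E -> L1 \1_A.
Proof.
move=> mA Aoo; rewrite (_ : \1_A = fun x => \1_A x * \1_A x); first exact/L2_indic_L1/L2_indic.
by apply/funext => x; rewrite indicE; case: (_ \in _); rewrite ?mulr1 ?mulr0.
Qed.

Lemma kop_indic s A x : 0 < s -> measurable A -> (mu A < +oo)%E -> 0 <= conv s \1_A x <= 1.
Proof.
move=> s0 mA Aoo.
have bk := bounded_kernel_gauss s0.
have L1A : L1 \1_A by exact: L1_indic.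
rewrite -!lee_fin (kopE _ bk L1A); apply/andP; split.
  by apply: integral_ge0 => y _; rewrite lee_fin mulr_ge0 ?gauss_ge0// ltW.
rewrite -(euclidean_gauss E x s0); apply: ge0_le_integral => //.
- by move=> y _; rewrite lee_fin mulr_ge0 ?gauss_ge0// ltW.
- apply/measurable_EFinP; apply: measurable_funM => //; exact: kernel_section_measurable.
- by apply/measurable_EFinP; exact: kernel_section_measurable.
- by move=> y _; rewrite lee_fin ler_piMr ?gauss_ge0 ?(ltW s0)// indicE; case: (_ \in _).
Qed.

Lemma conv_qopen_ge s (delta : R) A x : 0 < s -> 0 < delta -> measurable A -> (mu A < +oo)%E ->
  (forall y, sqdist x y < delta -> A y) -> 1 - conv s \1_A x <= 2 ^+ d * expR (- (pi * s ^+ 2 * delta / 2)).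
Proof.
move=> s0 d0 mA Aoo Ad.
have bk := bounded_kernel_gauss s0.
have s20 : 0 < s / 2 by rewrite divr_gt0.
have L1A : L1 \1_A by exact: L1_indic.
have L1g (t : R) : 0 < t -> L1 (gauss t x).
  move=> t0; have mk := kernel_section_measurable x (bounded_kernel_gauss t0).
  apply/integrableP; split; first exact/measurable_EFinP.
  under eq_integral do rewrite /= ger0_norm ?gauss_ge0 ?(ltW t0)//.
  by rewrite (euclidean_gauss E)// ltry.
have I1 t : 0 < t -> \int[mu]_y (gauss t x y) = 1.
  by move=> t0; rewrite /Rintegral (euclidean_gauss E).
rewrite -{1}(I1 s s0) /kop -RintegralB//; [|exact: L1g|exact: kernel_L1].
set c := 2 ^+ d * _.
rewrite -[leRHS]mulr1 -(I1 _ s20) -RintegralZl//; last exact: L1g.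
apply: le_Rintegral => //.
- by apply: L1B; [exact: L1g|exact: kernel_L1].
- exact: L1Z (L1g _ s20).
move=> y _; rewrite indicE; have [Ay|nAy] := boolP (y \in A).
  have c0 : 0 <= c by rewrite mulr_ge0 ?expR_ge0// exprn_ge0.
  by rewrite mulr1 subrr (mulr_ge0 c0 (gauss_ge0 _ _ _ (ltW s20))).
rewrite mulr0 subr0; apply: gauss_tail => //.
by rewrite leNgt; apply: contra nAy => /Ad; rewrite inE.
Qed.

Lemma cvg_gauss_tail (delta : R) : 0 < delta ->
  2 ^+ d * expR (- (pi * (n.+1%:R : R) ^+ 2 * delta / 2)) @[n --> \oo] --> (0 : R).
Proof.
move=> d0.
have : (2 ^+ d * delta^-1) * (n.+1%:R : R)^-1 @[n --> \oo] --> ((2 ^+ d * delta^-1) * 0 : R).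
  by apply: cvgMr; exact: cvg_harmonic.
rewrite mulr0; apply: (@squeeze_cvgr _ _ _ _ (cst 0)); last exact: cvg_cst.
apply: nearW => n /=.
have c0 : 0 <= 2 ^+ d :> R by rewrite exprn_ge0.
apply/andP; split; first by rewrite mulr_ge0 ?expR_ge0.
rewrite -[leRHS]mulrA ler_wpM2l//.
rewrite expRN -invfM lef_pV2 ?posrE ?expR_gt0 ?mulr_gt0 ?ltr0Sn//.
apply: le_trans (expR_ge1Dx _).
have m1 : 1 <= n.+1%:R :> R by rewrite ler1n.
have p2 := pi_ge2 R.
set m := n.+1%:R in m1 *.
have : m <= m ^+ 2 by rewrite ler_eXnr.
have : 0 <= m ^+ 2 * delta by rewrite mulr_ge0 ?sqr_ge0// ltW.
nra.
Qed.

(** Because [conv] is a contraction, expanding the square bounds the error by twice the difference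
    between [N2 1_A] and the pairing of [1_A] with its smoothing; this is the integral of [g n]. The
    function [g n] is supported in [A], all of whose points are interior, so nothing has to be known
    about the boundary of [A]. *)
Lemma approx_qopen A : measurable A -> (mu A < +oo)%E -> qopen A -> approx \1_A.
Proof.
move=> mA Aoo oA.
have L1A : L1 \1_A by exact: L1_indic.
have L2A : L2 \1_A by exact: L2_indic.
split => //.
have n0 n : 0 < n.+1%:R :> R by rewrite ltr0n.
have L2c n := conv_L2 (n0 n) L2A.
have mc n : measurable_fun setT (conv n.+1%:R \1_A) by have [] := L2c n.
pose g n x := 2 * (\1_A x * (1 - conv n.+1%:R \1_A x)).
have g0 n x : 0 <= g n x.
  by rewrite mulr_ge0// mulr_ge0 ?indicE// subr_ge0; case/andP: (kop_indic x (n0 n) mA Aoo).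
have mg n : measurable_fun setT (g n).
  by apply: measurable_funM => //; apply: measurable_funM => //; exact: measurable_funB.
suff gcv : (\int[mu]_x (g n x)%:E)%E @[n --> \oo] --> 0%E.
  apply: ecvg0_le gcv => n; rewrite N2_ge0 /=.
  have /L2_sqr_L1[_ i1] := L2c n.
  have /L2_sqr_L1[_ i2] := L2A.
  have i3 := L2_mul_L1 L2A (L2c n).
  have i4 := L1Z 2 i3.
  have I0 : L1 (fun x => (conv n.+1%:R \1_A x - \1_A x) ^+ 2).
    by have /L2_sqr_L1[] := L2B (L2c n) L2A.
  have ig : L1 (g n).
    rewrite (_ : g n = fun x => 2 * \1_A x - 2 * (\1_A x * conv n.+1%:R \1_A x)).
      by apply: L1B => //; exact: L1Z.
    by apply/funext => x; rewrite /g; ring.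
  have toE f : L1 f -> (\int[mu]_x (f x)%:E)%E = (\int[mu]_x f x)%:E.
    by move=> If; rewrite /Rintegral fineK//; exact: integrable_fin_num.
  rewrite /Submission.N2 toE// toE// lee_fin.
  have := conv_contraction (n0 n) L2A; rewrite /Submission.N2 toE// toE// lee_fin => ctr.
  have -> : \int[mu]_x (conv n.+1%:R \1_A x - \1_A x) ^+ 2 =
    \int[mu]_x (conv n.+1%:R \1_A x ^+ 2) + \int[mu]_x (\1_A x ^+ 2) - 2 * \int[mu]_x (\1_A x * conv n.+1%:R \1_A x).
    rewrite -RintegralZl// -RintegralD// -RintegralB//; last exact: L1D.
    by apply: eq_Rintegral => x _; ring.
  have -> : \int[mu]_x g n x = 2 * \int[mu]_x (\1_A x ^+ 2) - 2 * \int[mu]_x (\1_A x * conv n.+1%:R \1_A x).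
    rewrite -!RintegralZl// -RintegralB//; last exact: L1Z.
    apply: eq_Rintegral => x _; rewrite /g sqr_indic; ring.
  lra.
have mgE n : measurable_fun setT (EFin \o g n) by exact/measurable_EFinP.
have m0 : measurable_fun setT (cst 0%E : X -> \bar R) by [].
have cv : {ae mu, forall x, setT x -> (EFin \o g n) x @[n --> \oo] --> (cst 0%E x : \bar R)}.
  apply: aeW => x _ /=; apply: cvg_EFin; first exact: nearW.
  have [Ax|nAx] := pselect (A x); last first.
    rewrite (_ : _ \o _ = cst 0); first exact: cvg_cst.
    by apply/funext => n /=; rewrite /g indicE memNset// mul0r mulr0.
  have [delta d0 Ad] := oA x Ax.
  have : 2 * (2 ^+ d * expR (- (pi * (n.+1%:R : R) ^+ 2 * delta / 2))) @[n --> \oo] --> (2 * 0 : R).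
    by apply: cvgMr; exact: cvg_gauss_tail.
  rewrite mulr0.
  apply: (@squeeze_cvgr _ _ _ _ (cst 0)); last exact: cvg_cst.
  apply: nearW => n /=; rewrite g0 /= /g ler_wpM2l// indicE mem_set// mul1r.
  exact: conv_qopen_ge.
have bd : {ae mu, forall x n, setT x -> (`|(EFin \o g n) x| <= (EFin \o (fun x => 2 * \1_A x)%R) x)%E}.
  apply: aeW => x n _ /=; rewrite lee_fin ger0_norm// /g ler_wpM2l// ler_piMr ?indicE//.
  by rewrite gerBl; case/andP: (kop_indic x (n0 n) mA Aoo).
have [_ _] := @dominated_convergence _ _ R mu setT measurableT _ _ _ mgE m0 cv (L1Z 2 L1A) bd.
by rewrite integral0.
Qed.

Lemma cube_qopen x (r : R) : qopen (cube coord x r).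
Proof.
move=> y yx.
pose m := \big[Order.min/(1 : R)]_(i < d) (r - `|coord y i - coord x i|).
have m0 : 0 < m by apply: lt_bigmin => // i _; rewrite subr_gt0; exact: yx.
exists (m ^+ 2); first by rewrite exprn_gt0.
move=> z yz i.
have : (coord y i - coord z i) ^+ 2 < m ^+ 2.
  apply: le_lt_trans yz; rewrite /Submission.sqdist (bigD1 i)//= lerDl.
  by apply: sumr_ge0 => j _; exact: sqr_ge0.
rewrite -(@real_normK _ (_ - _)) ?num_real// ltr_sqr ?nnegrE ?(ltW m0)// => yzm.
have mi : m <= r - `|coord y i - coord x i| by exact: bigmin_le_cond.
have := ler_distD (coord y i) (coord z i) (coord x i).
rewrite (distrC (coord z i) (coord y i)); lra.
Qed.

(** A pi-lambda argument. The cube keeps all measures finite, and complements are taken relative to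
    it. *)
Lemma approx_borel A (m : nat) x0 : <<s [set O | measurable O /\ qopen O] >> A ->
  measurable A /\ approx \1_(A `&` cube coord x0 m%:R).
Proof.
set Q := cube coord x0 m%:R.
have mQ : measurable Q := measurable_cube (euclidean_coord E) _ _.
have Qoo : (mu Q < +oo)%E by rewrite (euclidean_cube E)// ltry.
have finI B : measurable B -> (mu (B `&` Q) < +oo)%E.
  by move=> mB; apply: le_lt_trans Qoo; apply: le_measure; rewrite ?inE//; exact: measurableI.
have aQ : approx \1_Q by apply: approx_qopen => //; exact: cube_qopen.
pose P := [set B | measurable B /\ approx \1_(B `&` Q)].
suff : <<s [set O | measurable O /\ qopen O] >> `<=` P by move=> h /h.
apply: lambda_system_subset => //.
- move=> B C [mB oB] [mC oC]; split; first exact: measurableI.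
  move=> x [Bx Cx]; have [d1 d10 h1] := oB x Bx; have [d2 d20 h2] := oC x Cx.
  exists (Order.min d1 d2); first by rewrite lt_min d10.
  by move=> y; rewrite lt_min => /andP[? ?]; split; [exact: h1|exact: h2].
- apply/dynkin_lambda_system; split.
  + by split => //; rewrite setTI.
  + move=> B [mB aB]; split; first exact: measurableC.
    have := approxB aQ aB; congr approx; apply/funext => x.
    rewrite !indicE !in_setI in_setC; case: (x \in B); case: (x \in Q) => /=; ring.
  + move=> F tF PF.
    have mF k : measurable (F k) by have [] := PF k.
    have mUF : measurable (\bigcup_k F k) by exact: bigcup_measurable.
    split => //.
    have au n : approx \1_((\big[setU/set0]_(k < n) F k) `&` Q).
      elim: n => [|n IH].
        rewrite big_ord0 set0I indic0.
        have := approxZ 0 aQ; congr approx; apply/funext => x; exact: mul0r.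
      rewrite big_ord_recr /=.
      have := approxD IH (proj2 (PF n)); congr approx; apply/funext => x.
      rewrite !indicE !in_setI in_setU.
      have [xn|xn] := boolP (x \in F n); last by rewrite /= addr0 orbF.
      rewrite (negbTE (_ : x \notin \big[setU/set0]_(i < n) F i)) /= ?add0r//.
      apply/negP; rewrite inE -bigcup_mkord => -[k /= kn Fkx].
      move/trivIsetP : tF => /(_ k n I I); rewrite (ltn_eqF kn) => /(_ isT).
      move/seteqP => [/(_ x) + _]; apply; split => //; exact: set_mem.
    have mUn n : measurable (\big[setU/set0]_(k < n) F k) by exact: bigsetU_measurable.
    (* Adding the complement of the whole union puts every point in almost all [A' n], as
       [cvg_N2_truncate] requires. Multiplying the indicator of the union by that of [A' n] leaves
       the partial union. *)
    pose A' n := (\big[setU/set0]_(k < n) F k) `|` ~` (\bigcup_k F k).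
    have L2u : L2 \1_((\bigcup_k F k) `&` Q) by apply: L2_indic; [exact: measurableI|exact: finI].
    apply: approx_closed => //.
      by apply: L1_indic; [exact: measurableI|exact: finI].
    move=> e e0.
    have cv : N2 (fun x => \1_((\bigcup_k F k) `&` Q) x - \1_(A' n) x * \1_((\bigcup_k F k) `&` Q) x) @[n --> \oo] --> 0%E.
      apply: cvg_N2_truncate => // [n|x].
        by apply: measurableU => //; exact: measurableC.
      have [[k _ Fkx]|nUx] := pselect ((\bigcup_k F k) x); last by apply: nearW => n; right.
      exists k.+1 => // n /= kn; left; rewrite -bigcup_mkord; exists k => //.
    move/ecvg0P : cv => /(_ (fun n => N2_ge0 _ _)) /(_ _ e0) [N _ /(_ N (leqnn _)) hN].
    exists \1_((\big[setU/set0]_(k < N) F k) `&` Q); split => //.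
    apply: le_trans hN; rewrite le_eqVlt; apply/orP; left; apply/eqP; congr N2; apply/funext => x; congr (_ - _).
    rewrite !indicE !in_setI in_setU in_setC.
    have [xU|xU] := boolP (x \in \bigcup_k F k) => /=.
      by rewrite orbF -natrM mulnb; congr (nat_of_bool _)%:R.
    rewrite mulr0 (negbTE (_ : x \notin _)) //; apply: contra xU.
    rewrite !inE -bigcup_mkord => -[k _ Fkx]; by exists k.
- move=> O [mO oO]; split => //; apply: approx_qopen; [exact: measurableI|exact: finI|].
  move=> x [Ox Qx]; have [d1 d10 h1] := oO x Ox; have [d2 d20 h2] := cube_qopen Qx.
  exists (Order.min d1 d2); first by rewrite lt_min d10.
  by move=> y; rewrite lt_min => /andP[? ?]; split; [exact: h1|exact: h2].
Qed.

Lemma cubes_cover x0 x : \forall n \near \oo, cube coord x0 n%:R x.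
Proof.
pose S := \sum_(i < d) `|coord x i - coord x0 i|.
near=> n => i.
have Sn : S < n%:R by near: n; exact: nbhs_infty_gtr.
apply: le_lt_trans Sn; rewrite /S (bigD1 i)//= lerDl.
exact: sumr_ge0.
Unshelve. all: by end_near. Qed.

(** Regularity gives a Borel set [B] above [A] with small excess, then a large cube cuts [B]. The
    two errors are the indicator of the excess and the part of [1_B] outside the cube. *)
Lemma approx_indic A : measurable A -> (mu A < +oo)%E -> approx \1_A.
Proof.
move=> mA Aoo.
apply: approx_closed; [exact: L1_indic|exact: L2_indic|].
move=> e e0; have e4 : 0 < e / 4 by rewrite divr_gt0.
have [B [sB AB BA]] := euclidean_regular E mA Aoo e4.
have [org _] := euclidean_origin E.
have [mB _] := approx_borel 0 org sB.
have Boo : (mu B < +oo)%E.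
  have -> : B = A `|` (B `\` A).
    apply/seteqP; split => [x Bx|x [/AB//|[]//]].
    by have [Ax|nAx] := pselect (A x); [left|right].
  apply: le_lt_trans (measureU2 _ mA (measurableD mB mA)) _.
  by rewrite lte_add_pinfty// (le_lt_trans BA)// ltry.
have mQ n : measurable (cube coord org n%:R) := measurable_cube (euclidean_coord E) _ _.
have := cvg_N2_truncate mQ (cubes_cover org) (L2_indic mB Boo).
move/ecvg0P => /(_ (fun n => N2_ge0 _ _)) /(_ _ e4) [N _ /(_ N (leqnn _)) hN].
have [_ aN] := approx_borel N org sB.
exists \1_(B `&` cube coord org N%:R); split => //.
have -> : (fun x => \1_A x - \1_(B `&` cube coord org N%:R) x : R) =
  (fun x => - \1_(B `\` A) x + (\1_B x - \1_(cube coord org N%:R) x * \1_B x)).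
  apply/funext => x; rewrite !indicE in_setI in_setD.
  have := AB x; rewrite -(in_setE A x) -(in_setE B x).
  by case: (x \in A); case: (x \in B); case: (x \in _) => //= h; first [ring | have := h isT].
have mBA : measurable (B `\` A) by exact: measurableD.
have m1 : measurable_fun setT (fun x => - (\1_(B `\` A) x : R)).
  by apply: measurableT_comp => //; exact: measurable_indic.
have m2 : measurable_fun setT (fun x => \1_B x - \1_(cube coord org N%:R) x * \1_B x : R).
  apply: measurable_funB; first exact: measurable_indic.
  by apply: measurable_funM; apply: measurable_indic.
apply: (le_trans (N2D_le mu m1 m2)).
rewrite N2N.
rewrite N2_indic//.
apply: (@le_trans _ _ (2%:E * (e / 4)%:E + 2%:E * (e / 4)%:E)%E).
  by apply: leeD; rewrite lee_pmul2l.
by rewrite -!EFinM -EFinD lee_fin; lra.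
Qed.

Import HBNNSimple.

(** Simple functions increase to [u], and [u] itself dominates the errors. *)
Lemma approx_ge0 u : L1 u -> L2 u -> (forall x, 0 <= u x) -> approx u.
Proof.
move=> L1u L2u u0; have mu' := L1_measurable L1u.
have muE : measurable_fun setT (EFin \o u) by exact/measurable_EFinP.
pose f n := nnsfun_approx measurableT muE n.
have cf x : (f n x) @[n --> \oo] --> u x.
  have := @cvg_nnsfun_approx _ _ _ _ measurableT _ muE (fun x _ => u0 x) x I.
  by move/fine_cvgP => [].
have f0 n x : 0 <= f n x by [].
have fu n x : f n x <= u x.
  rewrite -(cvg_lim _ (cf x))//; apply: (@nondecreasing_cvgn_le _ (fun n => f n x)).
    by move=> m k mk; have /lefP := nd_nnsfun_approx measurableT muE mk; exact.
  by apply/cvg_ex; exists (u x); exact: cf.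
have mf n : measurable_fun setT (f n) by [].
have cN : N2 (fun x => f n x - u x) @[n --> \oo] --> 0%E.
  apply: (@cvg_N2_dominated _ _ _ _ _ _ u) => // n x.
  rewrite ler0_norm ?subr_le0// opprB ger0_norm ?u0// gerBl; exact: f0.
have af n : approx (f n).
  rewrite (_ : (f n : X -> R) = fun x => \sum_(y <- finmap.enum_fset (fset_set (range (f n)))) y * \1_(f n @^-1` [set y]) x); last first.
    by apply/funext => x; rewrite fimfunE fsbig_finite.
  (* The level set of [0] may have infinite measure, but its term vanishes. For [y > 0] the function
     [y^-1 * u] dominates the indicator of the level set, whose measure is therefore finite. *)
  apply: approx_sum => y _; have [y0|y0] := leP y 0.
    rewrite (_ : (fun x => _) = fun x => 0 * \1_set0 x).
      by apply: approxZ; apply: approx_indic => //; rewrite measure0.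
    apply/funext => x; rewrite mul0r indicE; have [|_] := boolP (x \in _); last by rewrite mulr0.
    by rewrite inE /= => fxy; rewrite mulr1; apply/eqP; rewrite eq_le y0 -fxy f0.
  have mS : measurable (f n @^-1` [set y]) by exact: measurable_sfunP.
  apply: approxZ; apply: approx_indic => //.
  have iy : L1 (fun x => y^-1 * u x) by exact: L1Z.
  apply: le_lt_trans (integrable_lty measurableT iy).
  rewrite -[X in (mu X <= _)%E]setIT -integral_indic//; apply: ge0_le_integral => //.
  - by apply/measurable_EFinP; exact: measurable_indic.
  - by apply/measurable_EFinP; exact: (L1_measurable iy).
  - move=> x _; rewrite lee_fin indicE.
    have [|_] := boolP (x \in _); last by rewrite mulr_ge0// invr_ge0 ltW.
    by rewrite inE /= => fxy; rewrite ler_pdivlMl// mulr1 -fxy.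
apply: approx_closed => // e e0.
move/ecvg0P : cN => /(_ (fun n => N2_ge0 _ _)) /(_ _ e0) [N _ /(_ N (leqnn _)) hN].
exists (f N); split => //; apply: le_trans hN; rewrite -N2N.
by rewrite le_eqVlt; apply/orP; left; apply/eqP; congr N2; apply/funext => x; rewrite opprB.
Qed.

Lemma approx_all u : L1 u -> L2 u -> approx u.
Proof.
move=> L1u L2u; have mu' := L1_measurable L1u.
pose p (v : X -> R) x := Num.max (v x) 0.
have pv v x : `|p v x| <= `|v x|.
  rewrite /p; have [v0|v0] := leP (v x) 0; first by rewrite normr0.
  by [].
have mp v : measurable_fun setT v -> measurable_fun setT (p v).
  by move=> mv; apply: measurable_maxr.
have L1p v : L1 v -> L1 (p v).
  by move=> L1v; have mv := L1_measurable L1v; apply: L1_le L1v (pv v); exact: mp.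
have L2p v : L2 v -> L2 (p v).
  by move=> L2v; have [mv _] := L2v; apply: L2_le L2v (pv v); exact: mp.
have p0 v x : 0 <= p v x by rewrite /p le_max lexx orbT.
have := approxB (approx_ge0 (L1p _ L1u) (L2p _ L2u) (p0 _)) (approx_ge0 (L1p _ (L1N L1u)) (L2p _ (L2N L2u)) (p0 _)).
congr approx; apply/funext => x; rewrite /p.
have [u0|u0] := leP (u x) 0.
  by rewrite max_l ?oppr_ge0// sub0r opprK.
by rewrite max_r ?subr0// oppr_le0 ltW.
Qed.
End approximate_identity.

Section Rintegral_extra.
Context dX (X : measurableType dX) (R : realType) (mu : {sigma_finite_measure set X -> \bar R}).
Local Notation L1 := (L1 mu).
Local Notation L2 := (L2 mu).
Local Notation N2 := (N2 mu).
Implicit Types u v w : X -> R.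

Lemma Rintegral_eq0 u : (forall x, u x = 0) -> \int[mu]_x u x = 0.
Proof.
move=> u0; rewrite /Rintegral; under eq_integral do rewrite u0.
by rewrite integral0.
Qed.

Lemma EFin_Rintegral u : L1 u -> (\int[mu]_x u x)%:E = (\int[mu]_x (u x)%:E)%E.
Proof. by move=> iu; rewrite /Rintegral fineK//; exact: integrable_fin_num. Qed.

Lemma N2E u : L2 u -> N2 u = (\int[mu]_x (u x ^+ 2))%:E.
Proof. by move=> /L2_sqr_L1[_ iu]; rewrite EFin_Rintegral. Qed.

(** Young's inequality in place of Cauchy-Schwarz: it avoids roots of integrals, and [l] is free for
    the caller to tune. *)
Lemma norm_Rintegral_mul_le u w (l : R) : L2 u -> L2 w -> 0 < l ->
  `|\int[mu]_x (u x * w x)| <= l / 2 * \int[mu]_x (u x ^+ 2) + (2 * l)^-1 * \int[mu]_x (w x ^+ 2).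
Proof.
move=> L2u L2w l0; have iuw := L2_mul_L1 L2u L2w.
move: (L2u) (L2w) => /L2_sqr_L1[mu' iu] /L2_sqr_L1[mw iw].
have iu' := L1Z (l / 2) iu; have iw' := L1Z ((2 * l)^-1) iw.
apply: le_trans (le_normr_Rintegral measurableT iuw) _.
rewrite -!RintegralZl// -RintegralD//; apply: le_Rintegral => //.
- apply: (@L1_le _ _ _ _ _ (fun x => u x * w x)) => //.
    by apply: measurableT_comp => //; exact: measurable_funM.
  by move=> x; rewrite normr_id.
- exact: L1D.
move=> x _; rewrite normrM -(@real_normK _ (u x)) ?num_real// -(@real_normK _ (w x)) ?num_real//.
set a := `|u x|; set b := `|w x|.
have : 0 <= (2 * l)^-1 * (l * a - b) ^+ 2 by rewrite mulr_ge0 ?sqr_ge0// invr_ge0 mulr_ge0// ltW.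
have -> : (2 * l)^-1 * (l * a - b) ^+ 2 = l / 2 * a ^+ 2 + (2 * l)^-1 * b ^+ 2 - a * b.
  by field; rewrite gt_eqF.
by rewrite subr_ge0.
Qed.
End Rintegral_extra.

(** * Plancherel identity *)

Section plancherel.
Context dX (X : measurableType dX) (R : realType) (mu : {sigma_finite_measure set X -> \bar R}).
Context (d : nat) (coord : X -> 'I_d -> R) (E : euclidean coord mu).
Local Notation L1 := (L1 mu).
Local Notation L2 := (L2 mu).
Local Notation N2 := (N2 mu).
Local Notation gauss := (gauss coord).
Local Notation gaussw := (gaussw coord).
Local Notation sqdist := (sqdist coord).
Local Notation sqnorm := (sqnorm coord).
Local Notation dot := (dot coord).
Local Notation conv s := (kop mu (gauss s)).
Implicit Types (x y z : X) (u v : X -> R) (s : R).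

Definition kcos x y : R := cos (2 * pi * dot x y).
Definition ksin x y : R := sin (2 * pi * dot x y).
Local Notation Co := (kop mu kcos).
Local Notation Si := (kop mu ksin).

Let mphase : measurable_fun setT (fun z : X * X => 2 * pi * dot z.1 z.2).
Proof. by apply: measurable_funM => //; exact: (measurable_dot (euclidean_coord E)). Qed.

Lemma norm_kcos_le1 x y : `|kcos x y| <= 1. Proof. exact: cos_max. Qed.
Lemma norm_ksin_le1 x y : `|ksin x y| <= 1. Proof. exact: sin_max. Qed.

Lemma bounded_kernel_cos : bounded_kernel kcos.
Proof.
split; last by exists 1; exact: norm_kcos_le1.
apply: (measurableT_comp _ mphase); apply: continuous_measurable_fun; exact: continuous_cos.
Qed.

Lemma bounded_kernel_sin : bounded_kernel ksin.
Proof.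
split; last by exists 1; exact: norm_ksin_le1.
apply: (measurableT_comp _ mphase); apply: continuous_measurable_fun; exact: continuous_sin.
Qed.

Lemma kcosC x y : kcos x y = kcos y x. Proof. by rewrite /kcos dotC. Qed.
Lemma ksinC x y : ksin x y = ksin y x. Proof. by rewrite /ksin dotC. Qed.

Let kcos_tr : (fun x y => kcos y x) = kcos.
Proof. by apply/funext => x; apply/funext => y; rewrite kcosC. Qed.
Let ksin_tr : (fun x y => ksin y x) = ksin.
Proof. by apply/funext => x; apply/funext => y; rewrite ksinC. Qed.

Lemma kcos_swap u v : L1 u -> L1 v -> \int[mu]_x (v x * Co u x) = \int[mu]_x (u x * Co v x).
Proof. by move=> iu iv; rewrite (kop_swap bounded_kernel_cos iu iv) kcos_tr. Qed.

Lemma ksin_swap u v : L1 u -> L1 v -> \int[mu]_x (v x * Si u x) = \int[mu]_x (u x * Si v x).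
Proof. by move=> iu iv; rewrite (kop_swap bounded_kernel_sin iu iv) ksin_tr. Qed.

Lemma cosNpihalfD (t : R) : cos (- (pi / 2) + t) = sin t.
Proof. by rewrite cosD cosN cos_pihalf sinN sin_pihalf; ring. Qed.

Lemma gauss_kcos s x y : 0 < s -> \int[mu]_z (gauss s x z * kcos z y) = kcos x y * gaussw s y.
Proof.
move=> s0; have := euclidean_gauss_cos E 0 x y s0; rewrite add0r => <-.
by apply: eq_Rintegral => z _; rewrite add0r.
Qed.

Lemma gauss_ksin s x y : 0 < s -> \int[mu]_z (gauss s x z * ksin z y) = ksin x y * gaussw s y.
Proof.
move=> s0; have := euclidean_gauss_cos E (- (pi / 2)) x y s0; rewrite cosNpihalfD => <-.
by apply: eq_Rintegral => z _; rewrite cosNpihalfD.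
Qed.

Lemma L1_gauss s x : 0 < s -> L1 (gauss s x).
Proof.
move=> s0; have mk := kernel_section_measurable x (bounded_kernel_gauss E s0).
apply/integrableP; split; first exact/measurable_EFinP.
under eq_integral do rewrite /= ger0_norm ?(gauss_ge0 _ _ _ (ltW s0))//.
by rewrite (euclidean_gauss E)// ltry.
Qed.

(** The kernel is symmetric, so it can be moved onto [gauss s x], whose cosine transform at [y] is
    [kcos x y * gaussw s y]. *)
Lemma conv_kcos s u x : 0 < s -> L1 u -> conv s (Co u) x = Co (fun y => gaussw s y * u y) x.
Proof.
move=> s0 iu; rewrite {1}/kop (kcos_swap iu (L1_gauss x s0)).
apply: eq_Rintegral => y _.
rewrite mulrA -(gauss_kcos _ _ s0) mulrC; congr (_ * _).
by apply: eq_Rintegral => z _; rewrite mulrC kcosC.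
Qed.

Lemma conv_ksin s u x : 0 < s -> L1 u -> conv s (Si u) x = Si (fun y => gaussw s y * u y) x.
Proof.
move=> s0 iu; rewrite {1}/kop (ksin_swap iu (L1_gauss x s0)).
apply: eq_Rintegral => y _.
rewrite mulrA -(gauss_ksin _ _ s0) mulrC; congr (_ * _).
by apply: eq_Rintegral => z _; rewrite mulrC ksinC.
Qed.

Lemma gaussw_gt0 s x : 0 < gaussw s x. Proof. exact: expR_gt0. Qed.

Lemma gaussw_le1 s x : gaussw s x <= 1.
Proof.
rewrite -expR0 ler_expR oppr_le0 divr_ge0 ?sqr_ge0// mulr_ge0 ?pi_ge0//; exact: sqnorm_ge0.
Qed.

Lemma norm_gaussw_le1 s x : `|gaussw s x| <= 1.
Proof. by rewrite ger0_norm ?gaussw_le1// ltW// gaussw_gt0. Qed.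

Lemma measurable_gaussw s : measurable_fun setT (gaussw s).
Proof.
apply: measurableT_comp => //; apply: measurableT_comp => //.
apply: measurable_funM => //; apply: measurable_funM => //.
exact: (measurable_sqnorm (euclidean_coord E)).
Qed.

Lemma gaussw_gauss s : 0 < s -> exists org, (forall i, coord org i = 0) /\ forall x, gaussw s x = s ^+ d * gauss s^-1 org x.
Proof.
move=> s0; have [org og0] := euclidean_origin E; exists org; split => // x.
rewrite /Submission.gauss mulrA -exprMn mulfV ?gt_eqF// expr1n mul1r.
have -> : sqdist org x = sqnorm x.
  by apply: eq_bigr => i _; rewrite og0 sub0r sqrrN.
by rewrite /Submission.gaussw exprVn mulrAC.
Qed.

Lemma L1_gaussw s : 0 < s -> L1 (gaussw s).
Proof.
move=> s0; have [org [_ h]] := gaussw_gauss s0.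
have -> : gaussw s = fun x => s ^+ d * gauss s^-1 org x by apply/funext.
by apply: L1Z; apply: L1_gauss; rewrite invr_gt0.
Qed.

(** [gaussw s] is a multiple of the Gaussian of scale [s^-1] at the origin, so its transform is
    known in turn. It is evaluated at [w], a point whose coordinates are those of [x - y]. *)
Lemma gaussw_cos s theta x y : 0 < s ->
  \int[mu]_z (gaussw s z * cos (theta + 2 * pi * (dot z x - dot z y))) = cos theta * gauss s x y.
Proof.
move=> s0; have [org [og0 h]] := gaussw_gauss s0; have [w wE] := euclidean_sub E x y.
have is0 : 0 < s^-1 by rewrite invr_gt0.
have ig : L1 (fun z => gauss s^-1 org z * cos (theta + 2 * pi * dot z w)).
  have mh : measurable_fun setT (fun z => cos (theta + 2 * pi * dot z w)).
    apply: measurableT_comp; first by apply: continuous_measurable_fun; exact: continuous_cos.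
    apply: measurable_funD => //; apply: measurable_funM => //.
    exact: (measurableT_comp (measurable_dot (euclidean_coord E)) (@measurable_pair2 _ _ _ _ w)).
  have := L1_bounded_mul mh (fun z => cos_max _) (L1_gauss org is0).
  by congr L1; apply/funext => z; rewrite mulrC.
transitivity (\int[mu]_z (s ^+ d * (gauss s^-1 org z * cos (theta + 2 * pi * dot z w)))).
  apply: eq_Rintegral => z _; rewrite h -mulrA; congr (_ * (_ * cos (_ + _ * _))).
  by rewrite /Submission.dot -sumrB; apply: eq_bigr => i _; rewrite wE mulrBr.
rewrite RintegralZl// (euclidean_gauss_cos E)//.
have -> : dot org w = 0 by rewrite /Submission.dot big1// => i _; rewrite og0 mul0r.
rewrite mulr0 addr0 mulrCA; congr (_ * _).
rewrite /Submission.gaussw /Submission.gauss; congr (_ * expR (- _)).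
rewrite exprVn invrK mulrAC; congr (_ * _).
by apply: eq_bigr => i _; rewrite wE.
Qed.

Lemma kop_gaussw_kop (k1 k2 : X -> X -> R) s v x : bounded_kernel k1 -> bounded_kernel k2 -> 0 < s -> L1 v ->
  kop mu k1 (fun z => gaussw s z * kop mu k2 v z) x =
  \int[mu]_y (v y * \int[mu]_z (gaussw s z * (k1 x z * k2 z y))).
Proof.
move=> b1 b2 s0 iv.
have i1 : L1 (fun z => k1 x z * gaussw s z) by apply: kernel_L1 => //; exact: L1_gaussw.
transitivity (\int[mu]_z ((k1 x z * gaussw s z) * kop mu k2 v z)).
  by apply: eq_Rintegral => z _; rewrite mulrA.
rewrite (kop_swap b2 iv i1); apply: eq_Rintegral => y _; congr (_ * _).
by apply: eq_Rintegral => z _; ring.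
Qed.

Lemma L1_gaussw_mul s (k1 k2 : X -> X -> R) x y : bounded_kernel k1 -> bounded_kernel k2 -> 0 < s ->
  L1 (fun z => gaussw s z * (k1 x z * k2 z y)).
Proof.
move=> b1 b2 s0.
have := kernel_L1 x b1 (kernel_L1 y (bounded_kernel_tr b2) (L1_gaussw s0)).
by congr L1; apply/funext => z; ring.
Qed.

Lemma L1_mul_Rintegral_kernel s (k1 k2 : X -> X -> R) x v : bounded_kernel k1 -> bounded_kernel k2 -> 0 < s -> L1 v ->
  L1 (fun y => v y * \int[mu]_z (gaussw s z * (k1 x z * k2 z y))).
Proof.
move=> b1 b2 s0 iv.
have i1 : L1 (fun z => k1 x z * gaussw s z) by apply: kernel_L1 => //; exact: L1_gaussw.
have b2' := bounded_kernel_tr b2.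
have [c hc] := kop_bounded b2' i1.
have := L1_bounded_mul (measurable_kop mu b2' (L1_measurable i1)) hc iv.
congr L1; apply/funext => y; rewrite mulrC; congr (_ * _).
by apply: eq_Rintegral => z _; ring.
Qed.

(** The real part of Fourier inversion damped by [gaussw s]: exchanging the integrals leaves the
    cosine of a phase difference, whose damped integral is [gauss s x y]. *)
Lemma inversion_cos_sin s v x : 0 < s -> L1 v ->
  Co (fun z => gaussw s z * Co v z) x + Si (fun z => gaussw s z * Si v z) x = conv s v x.
Proof.
move=> s0 iv.
have bc := bounded_kernel_cos; have bs := bounded_kernel_sin.
rewrite !kop_gaussw_kop// -RintegralD//; try exact: L1_mul_Rintegral_kernel.
apply: eq_Rintegral => y _; rewrite -mulrDr mulrC; congr (_ * _).
rewrite -RintegralD//; try exact: L1_gaussw_mul.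
have := gaussw_cos 0 x y s0; rewrite cos0 mul1r => <-.
apply: eq_Rintegral => z _; rewrite -mulrDr; congr (_ * _).
by rewrite (kcosC x) (ksinC x) /kcos /ksin add0r mulrBr cosB.
Qed.

(** The imaginary part of the damped inversion: the inner integrand is odd in [z], which
    [gaussw_cos] sees through the phase [- pi / 2]. *)
Lemma inversion_sin_cos s v x : 0 < s -> L1 v ->
  Si (fun z => gaussw s z * Co v z) x - Co (fun z => gaussw s z * Si v z) x = 0.
Proof.
move=> s0 iv.
have bc := bounded_kernel_cos; have bs := bounded_kernel_sin.
rewrite !kop_gaussw_kop// -RintegralB//; try exact: L1_mul_Rintegral_kernel.
apply: Rintegral_eq0 => y; rewrite -mulrBr.
rewrite -RintegralB//; try exact: L1_gaussw_mul.
have := gaussw_cos (- (pi / 2)) x y s0; rewrite cosN cos_pihalf mul0r => h.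
rewrite -[RHS](mulr0 (v y)) -h; congr (_ * _).
apply: eq_Rintegral => z _; rewrite -mulrBr; congr (_ * _).
by rewrite (kcosC x) (ksinC x) /kcos /ksin cosNpihalfD mulrBr sinB.
Qed.

(** Real part of the transform of [u + i v]; the imaginary part is [F2]. *)
Definition F1 u v x := Co u x + Si v x.
Definition F2 u v x := Co v x - Si u x.

Lemma measurable_Co u : measurable_fun setT u -> measurable_fun setT (Co u).
Proof. exact: measurable_kop bounded_kernel_cos. Qed.

Lemma measurable_Si u : measurable_fun setT u -> measurable_fun setT (Si u).
Proof. exact: measurable_kop bounded_kernel_sin. Qed.

(** Symmetry of the kernels turns the squares into damped inversions, and the terms mixing [u] and
    [v] cancel by [inversion_sin_cos]. *)
Lemma gaussw_energy s u v : 0 < s -> L1 u -> L1 v ->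
  \int[mu]_x (gaussw s x * (F1 u v x ^+ 2 + F2 u v x ^+ 2)) =
  \int[mu]_x (u x * conv s u x) + \int[mu]_x (v x * conv s v x).
Proof.
move=> s0 iu iv.
have bc := bounded_kernel_cos; have bs := bounded_kernel_sin.
have gi (k : X -> X -> R) w : bounded_kernel k -> L1 w -> L1 (fun x => gaussw s x * kop mu k w x).
  move=> bk iw; have [c hc] := kop_bounded bk iw.
  have := L1_bounded_mul (measurable_kop mu bk (L1_measurable iw)) hc (L1_gaussw s0).
  by congr L1; apply/funext => x; rewrite mulrC.
have gi2 (k k' : X -> X -> R) w w' : bounded_kernel k -> bounded_kernel k' -> L1 w -> L1 w' ->
    L1 (fun x => gaussw s x * kop mu k w x * kop mu k' w' x).
  move=> bk bk' iw iw'; have [c hc] := kop_bounded bk' iw'.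
  have := L1_bounded_mul (measurable_kop mu bk' (L1_measurable iw')) hc (gi _ _ bk iw).
  by congr L1; apply/funext => x; rewrite mulrC.
have ip (k k' : X -> X -> R) w w' : bounded_kernel k -> bounded_kernel k' -> L1 w -> L1 w' ->
    L1 (fun x => w' x * kop mu k' (fun x => gaussw s x * kop mu k w x) x).
  move=> bk bk' iw iw'; have [c hc] := kop_bounded bk' (gi _ _ bk iw).
  have := L1_bounded_mul (measurable_kop mu bk' (L1_measurable (gi _ _ bk iw))) hc iw'.
  by congr L1; apply/funext => x; rewrite mulrC.
have ec w w' : L1 w -> L1 w' -> \int[mu]_x (gaussw s x * Co w x * Co w' x) = \int[mu]_x (w' x * Co (fun x => gaussw s x * Co w x) x).
  by move=> iw iw'; rewrite (kcos_swap iw' (gi _ _ bc iw)).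
have es w w' : L1 w -> L1 w' -> \int[mu]_x (gaussw s x * Si w x * Si w' x) = \int[mu]_x (w' x * Si (fun x => gaussw s x * Si w x) x).
  by move=> iw iw'; rewrite (ksin_swap iw' (gi _ _ bs iw)).
have inv w : L1 w -> \int[mu]_x (w x * conv s w x) = \int[mu]_x (gaussw s x * Co w x * Co w x) + \int[mu]_x (gaussw s x * Si w x * Si w x).
  move=> iw; rewrite ec// es// -RintegralD//; try exact: ip.
  by apply: eq_Rintegral => x _; rewrite -inversion_cos_sin// mulrDr.
have cross : \int[mu]_x (gaussw s x * Co u x * Si v x) - \int[mu]_x (gaussw s x * Si u x * Co v x) = 0.
  rewrite (ksin_swap iv (gi _ _ bc iu)) (kcos_swap iv (gi _ _ bs iu)) -RintegralB//; try exact: ip.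
  apply: Rintegral_eq0 => x; by rewrite -mulrBr inversion_sin_cos// mulr0.
rewrite (inv _ iu) (inv _ iv).
transitivity (\int[mu]_x ((gaussw s x * Co u x * Co u x + gaussw s x * Si u x * Si u x) +
   (gaussw s x * Co v x * Co v x + gaussw s x * Si v x * Si v x) + 2 * (gaussw s x * Co u x * Si v x - gaussw s x * Si u x * Co v x))).
  by apply: eq_Rintegral => x _; rewrite /F1 /F2; ring.
have a1 := gi2 _ _ _ _ bc bc iu iu; have a2 := gi2 _ _ _ _ bs bs iu iu.
have a3 := gi2 _ _ _ _ bc bc iv iv; have a4 := gi2 _ _ _ _ bs bs iv iv.
have a5 := gi2 _ _ _ _ bc bs iu iv; have a6 := gi2 _ _ _ _ bs bc iu iv.
have a56 := L1B a5 a6.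
rewrite RintegralD//; [|by apply: L1D; exact: L1D|exact: L1Z].
rewrite RintegralZl// RintegralB// cross mulr0 addr0.
by rewrite RintegralD ?RintegralD//; exact: L1D.
Qed.

Lemma cvg_conv_energy u : L1 u -> L2 u ->
  \int[mu]_x (u x * conv n.+1%:R u x) @[n --> \oo] --> \int[mu]_x (u x ^+ 2).
Proof.
move=> iu L2u; have [_ _ au] := approx_all E iu L2u.
have U0 : 0 <= \int[mu]_x (u x ^+ 2) by apply: Rintegral_ge0 => x _; exact: sqr_ge0.
set U := \int[mu]_x (u x ^+ 2) in U0 *.
apply/cvgrPdist_le => e e0.
(* With this [l] the two terms of Young's inequality, [l / 2 * (U + 1)] and [(2 * l)^-1 * (l * e)],
   are each [e / 2]; adding 1 to [U] covers [U = 0]. *)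
pose l := e / (U + 1).
have U1 : 0 < U + 1 by rewrite ltr_wpDl.
have l0 : 0 < l by rewrite divr_gt0.
have le0 : 0 < l * e by rewrite mulr_gt0.
move/ecvg0P : au => /(_ (fun n => N2_ge0 _ _)) /(_ _ le0).
apply: filterS => n hn.
have n0 : 0 < n.+1%:R :> R by rewrite ltr0n.
have L2c := conv_L2 E n0 L2u.
have L2d := L2B L2c L2u.
have i1 := L2_mul_L1 L2u L2c.
have /L2_sqr_L1[_ i2] := L2u.
rewrite N2E// lee_fin in hn.
rewrite distrC.
have -> : \int[mu]_x (u x * conv n.+1%:R u x) - U = \int[mu]_x (u x * (conv n.+1%:R u x - u x)).
  by rewrite -RintegralB//; apply: eq_Rintegral => x _; ring.
apply: le_trans (norm_Rintegral_mul_le L2u L2d l0) _.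
rewrite -/U.
have -> : e = l / 2 * (U + 1) + (2 * l)^-1 * (l * e).
  rewrite /l; move: (gt_eqF U1) (gt_eqF e0) => /negbT h1 /negbT h2; field; rewrite h1 h2; by [].
apply: lerD.
  by apply: ler_wpM2l; [rewrite divr_ge0 ?(ltW l0)|rewrite lerDl].
by rewrite ler_wpM2l// invr_ge0 mulr_ge0// ltW.
Qed.

Lemma gaussw_nd x : {homo (fun n : nat => gaussw n.+1%:R x) : m n / (m <= n)%N >-> m <= n}.
Proof.
move=> m n mn; rewrite ler_expR lerN2 ler_wpM2l ?mulr_ge0 ?pi_ge0 ?sqnorm_ge0//.
by rewrite lef_pV2 ?posrE ?exprn_gt0 ?ltr0n// ler_sqr ?nnegrE ?ler0n// ler_nat.
Qed.

Lemma cvg_gaussw x : gaussw n.+1%:R x @[n --> \oo] --> (1 : R).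
Proof.
rewrite [X in _ --> X](_ : 1 = expR (- (pi * sqnorm x * 0))); last by rewrite mulr0 oppr0 expR0.
apply: continuous_cvg; first exact: continuous_expR.
apply: cvgN; apply: cvgMr.
have h : (n.+1%:R : R)^-1 @[n --> \oo] --> (0 : R) by exact: cvg_harmonic.
rewrite [X in _ --> X](_ : 0 = 0 * 0); last by rewrite mulr0.
by under eq_fun do rewrite expr2 invfM; exact: cvgM.
Qed.

(** Let the damping disappear in [gaussw_energy]: monotone convergence on the left, where square
    integrability is not yet known, and the approximate identity on the right. *)
Theorem plancherel u v : L1 u -> L2 u -> L1 v -> L2 v ->
  (N2 (F1 u v) + N2 (F2 u v) = N2 u + N2 v)%E.
Proof.
move=> iu L2u iv L2v.
have mF1 : measurable_fun setT (F1 u v).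
  by apply: measurable_funD; [apply: measurable_Co (L1_measurable iu)|apply: measurable_Si (L1_measurable iv)].
have mF2 : measurable_fun setT (F2 u v).
  by apply: measurable_funB; [apply: measurable_Co (L1_measurable iv)|apply: measurable_Si (L1_measurable iu)].
pose h x := F1 u v x ^+ 2 + F2 u v x ^+ 2.
have h0 x : 0 <= h x by rewrite addr_ge0 ?sqr_ge0.
have mh : measurable_fun setT h by apply: measurable_funD; exact: measurable_funX.
rewrite /Submission.N2 -ge0_integralD//; first last.
- exact: measurable_sqr_EFin.
- by move=> x _; rewrite lee_fin sqr_ge0.
- exact: measurable_sqr_EFin.
- by move=> x _; rewrite lee_fin sqr_ge0.
pose g n x := (gaussw n.+1%:R x * h x)%:E.
have mg n : measurable_fun setT (g n).
  by apply/measurable_EFinP; apply: measurable_funM => //; exact: measurable_gaussw.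
have g0 n x : setT x -> (0 <= g n x)%E by move=> _; rewrite lee_fin mulr_ge0// ltW// gaussw_gt0.
have gnd x : setT x -> {homo (fun n => g n x) : m n / (m <= n)%N >-> (m <= n)%E}.
  by move=> _ m n mn; rewrite lee_fin ler_wpM2r//; exact: gaussw_nd.
have cv := cvg_monotone_convergence (mu := mu) measurableT mg g0 gnd.
have lg x : limn (fun n => g n x) = ((F1 u v x ^+ 2)%:E + (F2 u v x ^+ 2)%:E)%E.
  apply/cvg_lim => //; rewrite -EFinD; apply: cvg_EFin; first exact: nearW.
  rewrite -[X in _ --> X](mul1r (h x)); apply: cvgMl; exact: cvg_gaussw.
rewrite (eq_integral _ _ (fun x _ => lg x)) in cv.
apply: (cvg_unique _ cv) => //.
rewrite -/(N2 u) -/(N2 v) (N2E L2u) (N2E L2v) -EFinD.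
have c2 : (\int[mu]_x (u x * conv n.+1%:R u x) + \int[mu]_x (v x * conv n.+1%:R v x)) @[n --> \oo] -->
   \int[mu]_x (u x ^+ 2) + \int[mu]_x (v x ^+ 2).
  exact: (cvgD (cvg_conv_energy iu L2u) (cvg_conv_energy iv L2v)).
have -> : (fun n => (\int[mu]_x g n x)%E) = EFin \o (fun n => \int[mu]_x (u x * conv n.+1%:R u x) + \int[mu]_x (v x * conv n.+1%:R v x)).
  apply/funext => n /=; rewrite -gaussw_energy ?ltr0n// EFin_Rintegral//.
  have n0 : 0 < n.+1%:R :> R by rewrite ltr0n.
  have bc := bounded_kernel_cos; have bs := bounded_kernel_sin.
  have [cu hcu] := kop_bounded bc iu; have [su hsu] := kop_bounded bs iu.
  have [cv' hcv] := kop_bounded bc iv; have [sv hsv] := kop_bounded bs iv.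
  have b1 x : `|F1 u v x| <= cu + sv by apply: le_trans (ler_normD _ _) _; exact: lerD.
  have b2 x : `|F2 u v x| <= cv' + su by apply: le_trans (ler_normB _ _) _; exact: lerD.
  have i1 := L1_bounded_mul mF1 b1 (L1_bounded_mul mF1 b1 (L1_gaussw n0)).
  have i2 := L1_bounded_mul mF2 b2 (L1_bounded_mul mF2 b2 (L1_gaussw n0)).
  by have := L1D i1 i2; congr L1; apply/funext => x; ring.
by apply: cvg_EFin; [exact: nearW|exact: c2].
Qed.
End plancherel.

(** * The Fourier transform on [L2] *)

Section riesz_fischer.
Context dX (X : measurableType dX) (R : realType) (mu : {sigma_finite_measure set X -> \bar R}).
Local Notation L1 := (L1 mu).
Local Notation L2 := (L2 mu).
Local Notation N2 := (N2 mu).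
Implicit Types u v w f g : X -> R.

Lemma N2B_le u v w : measurable_fun setT u -> measurable_fun setT v -> measurable_fun setT w ->
  (N2 (fun x => u x - v x)%R <= 2%:E * N2 (fun x => u x - w x)%R + 2%:E * N2 (fun x => w x - v x)%R)%E.
Proof.
move=> mu' mv mw.
have -> : (fun x => u x - v x) = (fun x => (u x - w x) + (w x - v x)) by apply/funext => x; ring.
by apply: N2D_le; exact: measurable_funB.
Qed.

Lemma N2BC u v : N2 (fun x => u x - v x) = N2 (fun x => v x - u x).
Proof. by rewrite -N2N; congr N2; apply/funext => x; rewrite opprB. Qed.

Definition cauchyN2 (u : nat -> X -> R) := forall e : R, 0 < e ->
  exists N, forall m n, (N <= m)%N -> (N <= n)%N -> (N2 (fun x => u m x - u n x)%R <= e%:E)%E.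

Lemma cvg_cauchyN2 (u : nat -> X -> R) f : (forall n, L2 (u n)) -> L2 f ->
  N2 (fun x => u n x - f x) @[n --> \oo] --> 0%E -> cauchyN2 u.
Proof.
move=> L2u L2f /ecvg0P uf e e0; have e4 : 0 < e / 4 by rewrite divr_gt0.
have [N _ hN] := uf (fun n => N2_ge0 _ _) _ e4.
exists N => m n Nm Nn; have [[mm _] [mn _] [mf _]] := And3 (L2u m) (L2u n) L2f.
apply: (le_trans (N2B_le mm mn mf)).
apply: (@le_trans _ _ (2%:E * (e / 4)%:E + 2%:E * (e / 4)%:E)%E).
  by apply: leeD; rewrite lee_pmul2l//; [exact: hN|rewrite N2BC; exact: hN].
by rewrite -!EFinM -EFinD lee_fin; lra.
Qed.

Lemma cvg_N2_Rintegral (u : nat -> X -> R) f : (forall n, L2 (u n)) -> L2 f ->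
  N2 (fun x => u n x - f x) @[n --> \oo] --> 0%E -> 
  \int[mu]_x (u n x ^+ 2) @[n --> \oo] --> \int[mu]_x (f x ^+ 2).
Proof.
move=> L2u L2f /ecvg0P uf.
have F0 : 0 <= \int[mu]_x (f x ^+ 2) by apply: Rintegral_ge0 => x _; exact: sqr_ge0.
set F := \int[mu]_x (f x ^+ 2) in F0 *.
apply/cvgrPdist_le => e e0.
(* Writing [u = f + (u - f)], Young's inequality bounds the error by [l * F + (1 + l^-1) * D]. The
   choice of [l] makes the first term at most [e / 4], and [D <= e / (2 * c)] the second at most
   [e / 2]. *)
pose l := e / (4 * (F + 1)).
have F1 : 0 < F + 1 by rewrite ltr_wpDl.
have l0 : 0 < l by rewrite divr_gt0// mulr_gt0.
pose c := 1 + l^-1.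
have c0 : 0 < c by rewrite addr_gt0// invr_gt0.
have ce0 : 0 < e / (2 * c) by rewrite divr_gt0// mulr_gt0.
have := uf (fun n => N2_ge0 _ _) _ ce0.
apply: filterS => n hn.
have L2d := L2B (L2u n) L2f.
have i1 := L2_mul_L1 L2f L2d.
have /L2_sqr_L1[_ i2] := L2f; have /L2_sqr_L1[_ i3] := L2u n; have /L2_sqr_L1[_ i4] := L2d.
rewrite N2E// lee_fin in hn.
rewrite distrC.
have -> : \int[mu]_x (u n x ^+ 2) - F = \int[mu]_x (u n x - f x) ^+ 2 + 2 * \int[mu]_x (f x * (u n x - f x)).
  rewrite -RintegralZl// -RintegralB// -RintegralD//; last exact: L1Z.
  by apply: eq_Rintegral => x _; ring.
set D := \int[mu]_x (u n x - f x) ^+ 2 in hn *.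
have D0 : 0 <= D by apply: Rintegral_ge0 => x _; exact: sqr_ge0.
have := norm_Rintegral_mul_le L2f L2d l0; rewrite -/D -/F => h.
apply: (le_trans (ler_normD _ _)); rewrite (ger0_norm D0) normrM ger0_norm//.
have : D + 2 * (l / 2 * F + (2 * l)^-1 * D) <= e.
  have -> : D + 2 * (l / 2 * F + (2 * l)^-1 * D) = l * F + c * D.
    by rewrite /c; field; rewrite gt_eqF.
  have : l * F <= e / 4.
    rewrite /l -mulrA (_ : (4 * (F + 1))^-1 * F = F / (F + 1) / 4); last by field; rewrite gt_eqF.
    by rewrite mulrA ler_wpM2r// ler_piMr ?(ltW e0)// ler_pdivrMr// mul1r lerDl.
  have : c * D <= e / 2.
    apply: (@le_trans _ _ (c * (e / (2 * c)))); first by rewrite ler_wpM2l// ltW.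
    by rewrite le_eqVlt; apply/orP; left; apply/eqP; field; rewrite gt_eqF.
  lra.
lra.
Qed.

Lemma fast_subsequence (u : nat -> X -> R) : cauchyN2 u ->
  exists k : nat -> nat, forall j i, (j <= i)%N -> (N2 (fun x => u (k i) x - u (k j) x)%R <= (8 ^- j)%:E)%E /\
    forall n, (k j <= n)%N -> (N2 (fun x => u n x - u (k j) x)%R <= (8 ^- j)%:E)%E.
Proof.
move=> cu.
have h j : exists N, forall m n, (N <= m)%N -> (N <= n)%N -> (N2 (fun x => u m x - u n x)%R <= (8 ^- j)%:E)%E.
  by apply: cu; rewrite invr_gt0 exprn_gt0.
have [K hK] := choice h.
exists (fun j => (\max_(i < j.+1) K i)%N) => j i ji.
have le a b : (a <= b)%N -> (K a <= \max_(i < b.+1) K i)%N.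
  move=> ab; have ab1 : (a < b.+1)%N by [].
  exact: (leq_bigmax (Ordinal ab1)).
split; first by apply: hK; apply: le.
by move=> n kn; apply: hK; [apply: leq_trans kn; exact: le|exact: le].
Qed.

Lemma limn_einf_le (a : nat -> \bar R) (c : \bar R) j : (forall i, (j <= i)%N -> (a i <= c)%E) -> (limn_einf a <= c)%E.
Proof.
move=> ac; rewrite limn_einf_lim; apply: lime_le; first exact: is_cvg_einfs.
apply: nearW => n; apply: (@le_trans _ _ (a (maxn n j))); last by apply: ac; exact: leq_maxr.
by apply: ereal_inf_lbound; exists (maxn n j) => //=; exact: leq_maxl.
Qed.

Lemma exprn8V_le (e : R) : 0 < e -> exists j : nat, 8 ^- j <= e.
Proof.
move=> e0; have [j hj] : exists j : nat, e^-1 < j%:R.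
  by exists (Num.truncn e^-1).+1; exact: truncnS_gt.
exists j; rewrite -[leRHS]invrK lef_pV2 ?posrE ?invr_gt0 ?exprn_gt0//.
by apply: le_trans (ltW hj) _; rewrite -natrX ler_nat ltnW// ltn_expl.
Qed.

(** Squared increments at most [8^-j] along a subsequence make [G], the series of [4^j] times
    squared increments, integrable. Where [G] is finite the increments are [O(2^-j)] and the
    subsequence converges pointwise; Fatou's lemma turns this into [L2] convergence. *)
Lemma Riesz_Fischer (u : nat -> X -> R) : (forall n, L2 (u n)) -> cauchyN2 u ->
  exists f, L2 f /\ N2 (fun x => u n x - f x) @[n --> \oo] --> 0%E.
Proof.
move=> L2u cu.
have mu' n : measurable_fun setT (u n) by have [] := L2u n.
have [k hk'] := fast_subsequence cu.
have hk j i ji := (hk' j i ji).1.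
pose D j x := u (k j.+1) x - u (k j) x.
have mD j : measurable_fun setT (D j) by exact: measurable_funB.
pose t j x := (4 ^+ j * D j x ^+ 2)%:E.
have t0 j x : (0 <= t j x)%E by rewrite lee_fin mulr_ge0 ?sqr_ge0// exprn_ge0.
have mt j : measurable_fun setT (t j).
  by apply/measurable_EFinP; apply: measurable_funM => //; exact: measurable_funX.
pose G x := (\sum_(j <oo) t j x)%E.
have mG : measurable_fun setT G by apply: ge0_emeasurable_sum.
have G0 x : (0 <= G x)%E by exact: nneseries_ge0.
have iG : (\int[mu]_x G x < +oo)%E.
  rewrite integral_nneseries//.
  apply: (@le_lt_trans _ _ (\sum_(j <oo) (2 / (2 ^ j.+1)%:R)%:E)%E); last first.
    by apply: le_lt_trans (epsilon_trick0 _ _) _ => //; rewrite ltry.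
  apply: lee_nneseries => [j _|j _].
    by move=> _; apply: integral_ge0.
  under eq_integral do rewrite /t EFinM.
  rewrite ge0_integralZl//; first last.
  - by move=> x _; rewrite lee_fin sqr_ge0.
  - exact: measurable_sqr_EFin.
  rewrite -/(N2 (D j)).
  apply: (@le_trans _ _ ((4 ^+ j)%:E * (8 ^- j)%:E)%E).
    by rewrite lee_pmul2l ?lte_fin ?exprn_gt0//; exact: hk.
  rewrite -EFinM lee_fin (_ : 8 = 4 * 2 :> R); last by rewrite -natrM.
  rewrite exprMn invfM mulrA mulfV ?expf_neq0// mul1r natrX exprS invfM mulrA mulfV// mul1r.
  exact: lexx.
have intG : mu.-integrable setT G.
  apply/integrableP; split => //; under eq_integral do rewrite gee0_abs//.
  exact: iG.
pose A := [set x | (G x < +oo)%E].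
have mA : measurable A.
  rewrite (_ : A = setT `&` [set x | (G x < +oo)%E]); last by rewrite setTI.
  exact: emeasurable_fun_infty_o.
have muA : mu (~` A) = 0%E.
  apply: measure_negligible; first exact: measurableC.
  have := integrable_ae measurableT intG; apply: negligibleS => x /= nA.
  move=> /(_ I) fx; apply: nA; rewrite /A /= ltey_eq fx//.
(* Killing the null set where [G] is infinite makes the limit exist everywhere, hence measurable. *)
pose v j x := \1_A x * u (k j) x.
have mv j : measurable_fun setT (v j) by apply: measurable_funM => //; exact: measurable_indic.
have cv x : cvgn (fun j => v j x).
  have [Ax|nAx] := pselect (A x); last first.
    by apply/cvg_ex; exists 0; rewrite /v indicE memNset//; under eq_fun do rewrite mul0r; exact: cvg_cst.
  have Gx : G x \is a fin_num by rewrite ge0_fin_numE//.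
  pose M := fine (G x).
  have M0 : 0 <= M by exact: fine_ge0.
  have Dj j : `|D j x| <= (1 + M) * 2^-1 ^+ j.
    have : 4 ^+ j * D j x ^+ 2 <= M.
      rewrite -lee_fin /M fineK//; apply: le_trans (nneseries_lim_ge j.+1 (fun i _ _ => t0 i x)).
      rewrite big_mkord big_ord_recr /=; apply: leeDr; apply: sume_ge0 => i _; exact: t0.
    have -> : 4 = 2 ^+ 2 :> R by rewrite -natrX.
    rewrite -exprM mulnC exprM -exprMn => h.
    have h1 : `|2 ^+ j * D j x| <= 1 + M.
      rewrite -(@real_normK _ (_ * _)) ?num_real// in h.
      have := normr_ge0 (2 ^+ j * D j x); nra.
    rewrite normrM ger0_norm ?exprn_ge0// in h1.
    by rewrite exprVn ler_pdivlMr ?exprn_gt0// mulrC.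
  have cD : cvgn (series (fun j => D j x)).
    apply: normed_cvg; apply: (@series_le_cvg _ _ (geometric (1 + M) 2^-1)) => //.
    - by move=> n; exact: normr_ge0.
    - by move=> n; rewrite /= mulr_ge0 ?addr_ge0 ?exprn_ge0 ?invr_ge0.
    - by apply: is_cvg_geometric_series; rewrite ger0_norm ?invr_ge0// invf_lt1// ltr1n.
  rewrite (_ : (fun j => v j x) = (fun j => u (k 0%N) x + series (fun j => D j x) j)).
    by apply: is_cvgD => //; exact: is_cvg_cst.
  apply/funext => j; rewrite /v indicE mem_set// mul1r.
  by rewrite (eq_sum_telescope (fun j => u (k j) x)).
pose f x := limn (fun j => v j x).
have vf x : v j x @[j --> \oo] --> f x by exact: cv.
have mf : measurable_fun setT f.
  by apply: (@measurable_fun_cvg _ _ _ _ v) => // x _; exact: vf.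
have vD j : (N2 (fun x => v j x - f x)%R <= (8 ^- j)%:E)%E.
  have mvij i : measurable_fun setT (fun x => ((v j x - v i x) ^+ 2)%:E).
    by apply: measurable_sqr_EFin; exact: measurable_funB.
  have := @fatou _ _ _ mu setT measurableT (fun i x => ((v j x - v i x) ^+ 2)%:E) mvij
    (fun i x _ => sqr_ge0 _).
  have lE x : limn_einf (fun i => ((v j x - v i x) ^+ 2)%:E) = ((v j x - f x) ^+ 2)%:E.
    have c2 : ((v j x - v i x) ^+ 2)%:E @[i --> \oo] --> ((v j x - f x) ^+ 2)%:E.
      apply: cvg_EFin; first exact: nearW.
      rewrite /comp /= expr2; under eq_fun do rewrite expr2.
      by apply: cvgM; apply: cvgB => //; exact: cvg_cst.
    by rewrite is_cvg_limn_einfE; [exact/cvg_lim|apply/cvg_ex; eexists; exact: c2].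
  under eq_integral do rewrite lE.
  move=> /le_trans; apply; apply: (@limn_einf_le _ _ j) => i ji.
  apply: le_trans (hk _ _ ji).
  rewrite -/(N2 (fun x => v j x - v i x)) N2BC; apply: le_N2.
  - exact: measurable_funB.
  - exact: measurable_funB.
  - move=> x; rewrite /v -mulrBr normrM ler_piMl//; exact: norm_indic_le1.
have uv n : N2 (fun x => u (k n) x - v n x) = 0%E.
  rewrite /Submission.N2 -[RHS](@integral0 _ _ _ mu setT); apply: ge0_ae_eq_integral => //.
  - by apply: measurable_sqr_EFin; exact: measurable_funB.
  - by move=> x _; rewrite lee_fin sqr_ge0.
  exists (~` A); split => //; first exact: measurableC.
  move=> x /= h Ax; apply: h => _.
  by rewrite /v indicE mem_set// mul1r subrr expr0n.
have L2v j : L2 (v j) by exact: L2_indic_mul.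
have L2f : L2 f.
  split => //; apply: (@le_lt_trans _ _ (2%:E * N2 (fun x => - (v 0%N x - f x))%R + 2%:E * N2 (v 0%N))%E).
    rewrite [X in (X <= _)%E](_ : _ = N2 (fun x => - (v 0%N x - f x) + v 0%N x)).
      by apply: N2D_le => //; apply: measurableT_comp => //; exact: measurable_funB.
    by congr N2; apply/funext => x; ring.
  rewrite N2N lte_add_pinfty// lte_mul_pinfty//; last by case: (L2v 0%N).
  by apply: le_lt_trans (vD _) _; rewrite ltry.
exists f; split => //; apply/ecvg0P; first by move=> n; exact: N2_ge0.
move=> e e0; have e8 : 0 < e / 8 by rewrite divr_gt0.
have [j hj] := exprn8V_le e8.
exists (k j) => // n /= kn.
have mkj : measurable_fun setT (fun x => u (k j) x) by [].
apply: (le_trans (N2B_le (mu' n) mf (mu' (k j)))).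
apply: (@le_trans _ _ (2%:E * (e / 8)%:E + 2%:E * (2%:E * 0%:E + 2%:E * (e / 8)%:E))%E); last first.
  by rewrite -!EFinM -!EFinD lee_fin; lra.
apply: leeD; rewrite lee_pmul2l//.
  by apply: le_trans ((hk' j j (leqnn _)).2 n kn) _; rewrite lee_fin.
apply: (le_trans (N2B_le (mu' (k j)) mf (mv j))).
apply: leeD; rewrite lee_pmul2l//; first by rewrite uv.
by apply: le_trans (vD j) _; rewrite lee_fin.
Qed.
End riesz_fischer.

(** * The graph of the Fourier transform *)

Section fourier_pairs.
Context dX (X : measurableType dX) (R : realType) (mu : {sigma_finite_measure set X -> \bar R}).
Context (d : nat) (coord : X -> 'I_d -> R) (E : euclidean coord mu).
Local Notation L1 := (L1 mu).
Local Notation L2 := (L2 mu).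
Local Notation N2 := (N2 mu).
Local Notation gaussw := (gaussw coord).
Local Notation conv s := (kop mu (gauss coord s)).
Local Notation Co := (kop mu (kcos coord)).
Local Notation Si := (kop mu (ksin coord)).
Local Notation F1 := (F1 mu coord).
Local Notation F2 := (F2 mu coord).
Implicit Types (f g u v : X -> R).

Definition L12 u := L1 u /\ L2 u.

(* [g1 + i g2] is the Fourier transform of [f1 + i f2]. *)
Definition fourier_pair f1 f2 g1 g2 := [/\ L2 f1 /\ L2 f2, L2 g1 /\ L2 g2 &
  exists u v : nat -> X -> R, [/\ forall n, L12 (u n) /\ L12 (v n),
    N2 (fun x => u n x - f1 x) @[n --> \oo] --> 0%E,
    N2 (fun x => v n x - f2 x) @[n --> \oo] --> 0%E,
    N2 (fun x => F1 (u n) (v n) x - g1 x) @[n --> \oo] --> 0%E &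
    N2 (fun x => F2 (u n) (v n) x - g2 x) @[n --> \oo] --> 0%E]].

Lemma F1_L2 u v : L12 u -> L12 v -> L2 (F1 u v).
Proof.
move=> [iu L2u] [iv L2v]; split.
  by apply: measurable_funD; [apply: measurable_Co (L1_measurable iu)|apply: measurable_Si (L1_measurable iv)].
apply: (@le_lt_trans _ _ (N2 (F1 u v) + N2 (F2 u v))%E).
  by rewrite leeDl// N2_ge0.
by rewrite (plancherel E)// lte_add_pinfty//; [case: L2u|case: L2v].
Qed.

Lemma F2_L2 u v : L12 u -> L12 v -> L2 (F2 u v).
Proof.
move=> [iu L2u] [iv L2v]; split.
  by apply: measurable_funB; [apply: measurable_Co (L1_measurable iv)|apply: measurable_Si (L1_measurable iu)].
apply: (@le_lt_trans _ _ (N2 (F1 u v) + N2 (F2 u v))%E).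
  by rewrite leeDr// N2_ge0.
by rewrite (plancherel E)// lte_add_pinfty//; [case: L2u|case: L2v].
Qed.

Lemma L12D u v : L12 u -> L12 v -> L12 (fun x => u x + v x).
Proof. by move=> [? ?] [? ?]; split; [exact: L1D|exact: L2D]. Qed.

Lemma L12Z c u : L12 u -> L12 (fun x => c * u x).
Proof. by move=> [? ?]; split; [exact: L1Z|exact: L2Z]. Qed.

Lemma L12B u v : L12 u -> L12 v -> L12 (fun x => u x - v x).
Proof. by move=> [? ?] [? ?]; split; [exact: L1B|exact: L2B]. Qed.

Lemma F1B u v u' v' : L12 u -> L12 v -> L12 u' -> L12 v' ->
  F1 (fun x => u x - u' x) (fun x => v x - v' x) = fun x => F1 u v x - F1 u' v' x.
Proof.
move=> [? _] [? _] [? _] [? _]; apply/funext => x; rewrite /Submission.F1.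
rewrite !kopB//; [ring|exact: (bounded_kernel_sin E)|exact: (bounded_kernel_cos E)].
Qed.

Lemma F2B u v u' v' : L12 u -> L12 v -> L12 u' -> L12 v' ->
  F2 (fun x => u x - u' x) (fun x => v x - v' x) = fun x => F2 u v x - F2 u' v' x.
Proof.
move=> [? _] [? _] [? _] [? _]; apply/funext => x; rewrite /Submission.F2.
rewrite !kopB//; [ring|exact: (bounded_kernel_sin E)|exact: (bounded_kernel_cos E)].
Qed.

(** Plancherel passes to the limit along the sequences that define the pair. *)
Lemma fourier_pair_isometry f1 f2 g1 g2 : fourier_pair f1 f2 g1 g2 -> (N2 g1 + N2 g2 = N2 f1 + N2 f2)%E.
Proof.
move=> [[Lf1 Lf2] [Lg1 Lg2] [u [v [Luv uf vf ug vg]]]].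
have Lu n : L2 (u n) by have [[]] := Luv n.
have Lv n : L2 (v n) by have [_ []] := Luv n.
have LF1 n : L2 (F1 (u n) (v n)) by have [? ?] := Luv n; exact: F1_L2.
have LF2 n : L2 (F2 (u n) (v n)) by have [? ?] := Luv n; exact: F2_L2.
have c1 := cvg_N2_Rintegral Lu Lf1 uf; have c2 := cvg_N2_Rintegral Lv Lf2 vf.
have c3 := cvg_N2_Rintegral LF1 Lg1 ug; have c4 := cvg_N2_Rintegral LF2 Lg2 vg.
rewrite !N2E// -!EFinD; congr EFin.
have c34 : (\int[mu]_x (F1 (u n) (v n) x ^+ 2) + \int[mu]_x (F2 (u n) (v n) x ^+ 2)) @[n --> \oo] -->
   \int[mu]_x (g1 x ^+ 2) + \int[mu]_x (g2 x ^+ 2) by exact: (cvgD c3 c4).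
have c12 : (\int[mu]_x (u n x ^+ 2) + \int[mu]_x (v n x ^+ 2)) @[n --> \oo] -->
   \int[mu]_x (f1 x ^+ 2) + \int[mu]_x (f2 x ^+ 2) by exact: (cvgD c1 c2).
apply: (cvg_unique _ c34) => //.
rewrite (_ : (fun n => _) = (fun n => \int[mu]_x (u n x ^+ 2) + \int[mu]_x (v n x ^+ 2)))//.
apply/funext => n; have [[iu _] [iv _]] := Luv n.
have := plancherel E iu (Lu n) iv (Lv n); rewrite !N2E// -!EFinD.
by move=> [].
Qed.

Lemma cvg_N2B (u v : nat -> X -> R) f g : (forall n, measurable_fun setT (u n)) -> (forall n, measurable_fun setT (v n)) ->
  measurable_fun setT f -> measurable_fun setT g ->
  N2 (fun x => u n x - f x) @[n --> \oo] --> 0%E -> N2 (fun x => v n x - g x) @[n --> \oo] --> 0%E ->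
  N2 (fun x => (u n x - v n x) - (f x - g x)) @[n --> \oo] --> 0%E.
Proof.
move=> mu' mv mf mg uf vg.
apply: ecvg0_le (ecvg0D (ecvg0Z 2 uf) (ecvg0Z 2 vg)) => n; rewrite N2_ge0 /= -(N2N mu (fun x => v n x - g x)).
rewrite (_ : (fun x => _) = (fun x => (u n x - f x) + - (v n x - g x))).
  by apply: N2D_le; [exact: measurable_funB|apply: measurableT_comp => //; exact: measurable_funB].
by apply/funext => x; ring.
Qed.

Lemma fourier_pairB f1 f2 g1 g2 f1' f2' g1' g2' : fourier_pair f1 f2 g1 g2 -> fourier_pair f1' f2' g1' g2' ->
  fourier_pair (fun x => f1 x - f1' x) (fun x => f2 x - f2' x) (fun x => g1 x - g1' x) (fun x => g2 x - g2' x).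
Proof.
move=> [[Lf1 Lf2] [Lg1 Lg2] [u [v [Luv uf vf ug vg]]]].
move=> [[Lf1' Lf2'] [Lg1' Lg2'] [u' [v' [Luv' uf' vf' ug' vg']]]].
split; [by split; exact: L2B|by split; exact: L2B|].
exists (fun n x => u n x - u' n x), (fun n x => v n x - v' n x).
have m (w : X -> R) : L2 w -> measurable_fun setT w by case.
have Lu n : L12 (u n) by have [] := Luv n.
have Lv n : L12 (v n) by have [] := Luv n.
have Lu' n : L12 (u' n) by have [] := Luv' n.
have Lv' n : L12 (v' n) by have [] := Luv' n.
have LF1 n := F1_L2 (Lu n) (Lv n); have LF2 n := F2_L2 (Lu n) (Lv n).
have LF1' n := F1_L2 (Lu' n) (Lv' n); have LF2' n := F2_L2 (Lu' n) (Lv' n).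
split.
- by move=> n; split; exact: L12B.
- by apply: cvg_N2B => // [n|n||]; apply: m => //; [have [_] := Lu n|have [_] := Lu' n].
- by apply: cvg_N2B => // [n|n||]; apply: m => //; [have [_] := Lv n|have [_] := Lv' n].
- under eq_cvg do rewrite F1B//.
  by apply: cvg_N2B => // [n|n||]; apply: m.
- under eq_cvg do rewrite F2B//.
  by apply: cvg_N2B => // [n|n||]; apply: m.
Qed.
End fourier_pairs.

Section fourier_pair_theory.
Context dX (X : measurableType dX) (R : realType) (mu : {sigma_finite_measure set X -> \bar R}).
Context (d : nat) (coord : X -> 'I_d -> R) (E : euclidean coord mu).
Local Notation L1 := (L1 mu).
Local Notation L2 := (L2 mu).
Local Notation N2 := (N2 mu).
Local Notation L12 := (L12 mu).
Local Notation gaussw := (gaussw coord).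
Local Notation conv s := (kop mu (gauss coord s)).
Local Notation Co := (kop mu (kcos coord)).
Local Notation Si := (kop mu (ksin coord)).
Local Notation F1 := (F1 mu coord).
Local Notation F2 := (F2 mu coord).
Local Notation fourier_pair := (fourier_pair mu coord).
Implicit Types (f g u v : X -> R).

Lemma N2_cvgZB (a b : R) (u v : nat -> X -> R) f g : (forall n, measurable_fun setT (u n)) -> (forall n, measurable_fun setT (v n)) ->
  measurable_fun setT f -> measurable_fun setT g ->
  N2 (fun x => u n x - f x) @[n --> \oo] --> 0%E -> N2 (fun x => v n x - g x) @[n --> \oo] --> 0%E ->
  N2 (fun x => (a * u n x + b * v n x) - (a * f x + b * g x)) @[n --> \oo] --> 0%E.
Proof.
move=> mu' mv mf mg uf vg.
apply: ecvg0_le (ecvg0D (ecvg0Z 2 (ecvg0Z (a ^+ 2) uf)) (ecvg0Z 2 (ecvg0Z (b ^+ 2) vg))) => n; rewrite N2_ge0 /=.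
rewrite -!N2Z; [|exact: measurable_funB|exact: measurable_funB].
rewrite (_ : (fun x => _) = (fun x => a * (u n x - f x) + b * (v n x - g x))).
  by apply: N2D_le; apply: measurable_funM => //; exact: measurable_funB.
by apply/funext => x; ring.
Qed.

(** Multiplication by the complex scalar [a + i b], in real and imaginary parts. *)
Lemma fourier_pairZ (a b : R) f1 f2 g1 g2 : fourier_pair f1 f2 g1 g2 ->
  fourier_pair (fun x => a * f1 x - b * f2 x) (fun x => a * f2 x + b * f1 x)
    (fun x => a * g1 x - b * g2 x) (fun x => a * g2 x + b * g1 x).
Proof.
move=> [[Lf1 Lf2] [Lg1 Lg2] [u [v [Luv uf vf ug vg]]]].
have m (w : X -> R) : L2 w -> measurable_fun setT w by case.
have Lu n : L12 (u n) by have [] := Luv n.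
have Lv n : L12 (v n) by have [] := Luv n.
have LF1 n := F1_L2 E (Lu n) (Lv n); have LF2 n := F2_L2 E (Lu n) (Lv n).
have L12L1 w : L12 w -> L1 w by case.
have bc := bounded_kernel_cos E; have bs := bounded_kernel_sin E.
split; [by split; [apply: L2B|apply: L2D]; exact: L2Z|by split; [apply: L2B|apply: L2D]; exact: L2Z|].
exists (fun n x => a * u n x + (- b) * v n x), (fun n x => a * v n x + b * u n x).
have mu' n : measurable_fun setT (u n) by apply: m; have [] := Lu n.
have mv n : measurable_fun setT (v n) by apply: m; have [] := Lv n.
have c1 n : F1 (fun x => a * u n x + - b * v n x) (fun x => a * v n x + b * u n x) =
    fun x => a * F1 (u n) (v n) x + (- b) * F2 (u n) (v n) x.
  apply/funext => x; rewrite /Submission.F1 /Submission.F2.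
  have [iu _] := Lu n; have [iv _] := Lv n.
  by rewrite !kopD ?kopZ//; [ring|exact: L1Z..].
have c2 n : F2 (fun x => a * u n x + - b * v n x) (fun x => a * v n x + b * u n x) =
    fun x => a * F2 (u n) (v n) x + b * F1 (u n) (v n) x.
  apply/funext => x; rewrite /Submission.F1 /Submission.F2.
  have [iu _] := Lu n; have [iv _] := Lv n.
  by rewrite !kopD ?kopZ//; [ring|exact: L1Z..].
split.
- by move=> n; split; apply: L12D; exact: L12Z.
- rewrite (_ : (fun n => N2 _) = (fun n => N2 (fun x => (a * u n x + - b * v n x) - (a * f1 x + - b * f2 x)))).
    by apply: N2_cvgZB => //; exact: m.
  by apply/funext => n; congr N2; apply/funext => x; ring.
- by apply: N2_cvgZB => //; exact: m.
- under eq_cvg do rewrite c1.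
  rewrite (_ : (fun n => N2 _) = (fun n => N2 (fun x => (a * F1 (u n) (v n) x + - b * F2 (u n) (v n) x) - (a * g1 x + - b * g2 x)))).
    by apply: N2_cvgZB => // [n|n||]; exact: m.
  by apply/funext => n; congr N2; apply/funext => x; ring.
- under eq_cvg do rewrite c2.
  by apply: N2_cvgZB => // [n|n||]; exact: m.
Qed.

Lemma fourier_pairD f1 f2 g1 g2 f1' f2' g1' g2' : fourier_pair f1 f2 g1 g2 -> fourier_pair f1' f2' g1' g2' ->
  fourier_pair (fun x => f1 x + f1' x) (fun x => f2 x + f2' x) (fun x => g1 x + g1' x) (fun x => g2 x + g2' x).
Proof.
move=> p p'; have := fourier_pairB E p (fourier_pairZ (-1) 0 p').
by congr fourier_pair; apply/funext => x; ring.
Qed.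

Lemma fourier_pair_L12 u v : L12 u -> L12 v -> fourier_pair u v (F1 u v) (F2 u v).
Proof.
move=> Lu Lv; have N0 (w : X -> R) : N2 (fun x => w x - w x) @[n --> \oo] --> 0%E.
  rewrite (_ : N2 _ = 0%E); first exact: cvg_cst.
  rewrite -[RHS](@integral0 _ _ _ mu setT); apply: eq_integral => x _.
  by rewrite subrr expr0n.
split; [by have [[_ ?] [_ ?]] := (Lu, Lv)|by split; [exact: F1_L2|exact: F2_L2]|].
by exists (fun=> u), (fun=> v); split.
Qed.

Lemma truncate_L12 u : L2 u -> exists w : nat -> X -> R, (forall n, L12 (w n)) /\
  N2 (fun x => w n x - u x) @[n --> \oo] --> 0%E.
Proof.
move=> Lu; have [org org0] := euclidean_origin E.
have mc n : measurable (cube coord org n%:R) by exact: (measurable_cube (euclidean_coord E)).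
exists (fun n x => \1_(cube coord org n%:R) x * u x); split.
  move=> n; split; last exact: L2_indic_mul.
  apply: L2_indic_L1 => //.
  apply: (@le_lt_trans _ _ (mu (cube coord org n.+1%:R))).
    apply: le_measure; rewrite ?inE// => x cx i; apply: lt_le_trans (cx i) _.
    by rewrite ler_nat.
  by rewrite (euclidean_cube E) ?ltr0n// ltry.
under eq_cvg do rewrite N2BC.
by apply: (cvg_N2_truncate mc) => // x; exact: cubes_cover.
Qed.

(** Truncations to cubes lie in [L1]. By Plancherel their transforms form Cauchy sequences, and [L2]
    is complete. *)
Lemma fourier_pair_exists f1 f2 : L2 f1 -> L2 f2 -> exists g1 g2, fourier_pair f1 f2 g1 g2.
Proof.
move=> Lf1 Lf2; have [u [Lu uf]] := truncate_L12 Lf1; have [v [Lv vf]] := truncate_L12 Lf2.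
have L12L2 w : L12 w -> L2 w by case.
have cu := cvg_cauchyN2 (fun n => L12L2 _ (Lu n)) Lf1 uf.
have cv := cvg_cauchyN2 (fun n => L12L2 _ (Lv n)) Lf2 vf.
have LF1 n := F1_L2 E (Lu n) (Lv n); have LF2 n := F2_L2 E (Lu n) (Lv n).
have iso m n : (N2 (fun x => F1 (u m) (v m) x - F1 (u n) (v n) x)%R + N2 (fun x => F2 (u m) (v m) x - F2 (u n) (v n) x)%R =
    N2 (fun x => u m x - u n x)%R + N2 (fun x => v m x - v n x)%R)%E.
  by have /(fourier_pair_isometry E) := fourier_pairB E (fourier_pair_L12 (Lu m) (Lv m)) (fourier_pair_L12 (Lu n) (Lv n)).
have c12 : cauchyN2 mu (fun n => F1 (u n) (v n)) /\ cauchyN2 mu (fun n => F2 (u n) (v n)).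
  have aux e : 0 < e -> exists N, forall m n, (N <= m)%N -> (N <= n)%N ->
    (N2 (fun x => F1 (u m) (v m) x - F1 (u n) (v n) x)%R + N2 (fun x => F2 (u m) (v m) x - F2 (u n) (v n) x)%R <= e%:E)%E.
    move=> e0; have e2 : 0 < e / 2 by rewrite divr_gt0.
    have [Nu hu] := cu _ e2; have [Nv hv] := cv _ e2.
    exists (maxn Nu Nv) => m n; rewrite !geq_max => /andP[a b] /andP[a' b'].
    rewrite iso [e in (_ <= e%:E)%E]splitr EFinD; apply: leeD; [exact: hu|exact: hv].
  split => e /aux[N hN]; exists N => m n Nm Nn; apply: le_trans (hN m n Nm Nn).
    by rewrite leeDl// N2_ge0.
  by rewrite leeDr// N2_ge0.
have [g1 [Lg1 ug1]] := Riesz_Fischer LF1 c12.1.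
have [g2 [Lg2 ug2]] := Riesz_Fischer LF2 c12.2.
by exists g1, g2; split => //; exists u, v; split.
Qed.

Lemma gaussw_mul_approx u (e : R) : L2 u -> 0 < e -> \forall m \near \oo, (N2 (fun x => gaussw m.+1%:R x * u x - u x)%R <= e%:E)%E.
Proof.
move=> Lu e0; have mu' : measurable_fun setT u by case: Lu.
have mg m : measurable_fun setT (gaussw m) by exact: (measurable_gaussw E).
have : N2 (fun x => gaussw m.+1%:R x * u x - u x)%R @[m --> \oo] --> 0%E.
  apply: (@cvg_N2_dominated _ _ _ mu _ u (fun x => 2 * u x)) => //.
  - by move=> m; exact: measurable_funM.
  - exact: L2Z.
  - by move=> x; rewrite -[X in _ --> X]mul1r; apply: cvgM; [exact: cvg_gaussw|exact: cvg_cst].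
  - move=> m x; rewrite [X in _ <= X]normrM (_ : `|2| = 1 + 1 :> R); last by rewrite ger0_norm.
    rewrite -{2}[u x]mul1r -mulrBl normrM ler_wpM2r//.
    by apply: le_trans (ler_normB _ _) _; rewrite normr1 lerD2r norm_gaussw_le1.
by move/ecvg0P => /(_ (fun m => N2_ge0 _ _) _ e0).
Qed.

Lemma conv_approx u (e : R) : L12 u -> 0 < e -> \forall m \near \oo, (N2 (fun x => conv m.+1%:R u x - u x)%R <= e%:E)%E.
Proof.
move=> [iu Lu] e0; have [_ _] := approx_all E iu Lu.
by move/ecvg0P => /(_ (fun m => N2_ge0 _ _) _ e0).
Qed.

Lemma gaussw_mul_L12 s u : 0 < s -> L2 u -> L12 (fun x => gaussw s x * u x).
Proof.
move=> s0 Lu; split.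
  apply: L2_mul_L1 => //; split; first exact: (measurable_gaussw E).
  have le : (N2 (gaussw s) <= \int[mu]_x (gaussw s x)%:E)%E.
    apply: ge0_le_integral => //.
    - by move=> x _; rewrite lee_fin sqr_ge0.
    - by apply: measurable_sqr_EFin; exact: (measurable_gaussw E).
    - by apply/measurable_EFinP; exact: (measurable_gaussw E).
    - by move=> x _; rewrite lee_fin expr2 ler_piMl ?gaussw_le1// ltW// gaussw_gt0.
  by apply: le_lt_trans le _; rewrite -(EFin_Rintegral (L1_gaussw E s0)) ltry.
apply: (@L2_bounded_mul _ _ _ mu 1) => //; first exact: (measurable_gaussw E).
by move=> x; exact: norm_gaussw_le1.
Qed.

(* [conj (F1 u v + i F2 u v)], damped by a Gaussian, is transformed back to a smoothing of [conj (u + i v)]. *)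
Lemma inverse_gaussw s u v : 0 < s -> L12 u -> L12 v ->
  let p := fun x => gaussw s x * F1 u v x in let q := fun x => - (gaussw s x * F2 u v x) in
  F1 p q = conv s u /\ F2 p q = fun x => - conv s v x.
Proof.
move=> s0 Lu Lv p q; have [iu _] := Lu; have [iv _] := Lv.
have bc := bounded_kernel_cos E; have bs := bounded_kernel_sin E.
have m2 w : L12 w -> measurable_fun setT w by move=> [/L1_measurable].
have iK k w : bounded_kernel k -> L1 w -> L1 (fun x => gaussw s x * kop mu k w x).
  move=> bk iw; have [c hc] := kop_bounded bk iw.
  rewrite (_ : (fun x => _) = (fun x => kop mu k w x * gaussw s x)); last by apply/funext => x; rewrite mulrC.
  apply: (L1_bounded_mul (c := c)) => //; last exact: (L1_gaussw E).
  exact: (measurable_kop _ bk (L1_measurable iw)).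
have pE : p = fun x => gaussw s x * Co u x + gaussw s x * Si v x.
  by apply/funext => x; rewrite /p /Submission.F1 mulrDr.
have qE : q = fun x => gaussw s x * Si u x + -1 * (gaussw s x * Co v x).
  by apply/funext => x; rewrite /q /Submission.F2 mulrBr opprB mulN1r.
have [c1 c2 c3 c4] := And4 (iK _ _ bc iu) (iK _ _ bs iu) (iK _ _ bc iv) (iK _ _ bs iv).
have c5 := L1Z (-1) c3.
split; apply/funext => x; rewrite /Submission.F1 /Submission.F2 pE qE !kopD ?kopZ//.
  move: (inversion_cos_sin E x s0 iu) (inversion_sin_cos E x s0 iv).
  by move: (Co _ _) (Co _ _) (Si _ _) (Si _ _) => A B C D; lra.
move: (inversion_cos_sin E x s0 iv) (inversion_sin_cos E x s0 iu).
by move: (Co _ _) (Co _ _) (Si _ _) (Si _ _) => A B C D; lra.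
Qed.

(* If [h] is the transform of [conj g], then [g] is the transform of [conj h]. *)
Lemma fourier_pair_surj g1 g2 : L2 g1 -> L2 g2 -> exists f1 f2, fourier_pair f1 f2 g1 g2.
Proof.
move=> Lg1 Lg2; have Lg2' := L2N Lg2.
have [h1 [h2 [[_ _] [Lh1 Lh2] [u [v [Luv ug vg uh vh]]]]]] := fourier_pair_exists Lg1 Lg2'.
have Lu n : L12 (u n) by have [] := Luv n.
have Lv n : L12 (v n) by have [] := Luv n.
have LF1 n := F1_L2 E (Lu n) (Lv n); have LF2 n := F2_L2 E (Lu n) (Lv n).
have m2 (w : X -> R) : L2 w -> measurable_fun setT w by case.
(* For each [n] the damping scale is chosen separately, large enough for all four approximations at
   once. *)
have hm n : exists m : nat, [/\ (N2 (fun x => gaussw m.+1%:R x * F1 (u n) (v n) x - F1 (u n) (v n) x)%R <= (n.+1%:R^-1)%:E)%E,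
   (N2 (fun x => gaussw m.+1%:R x * F2 (u n) (v n) x - F2 (u n) (v n) x)%R <= (n.+1%:R^-1)%:E)%E,
   (N2 (fun x => conv m.+1%:R (u n) x - u n x)%R <= (n.+1%:R^-1)%:E)%E &
   (N2 (fun x => conv m.+1%:R (v n) x - v n x)%R <= (n.+1%:R^-1)%:E)%E].
  have n0 : 0 < n.+1%:R^-1 :> R by rewrite invr_gt0.
  near \oo => m; exists m; split; near: m;
    [exact: gaussw_mul_approx|exact: gaussw_mul_approx|exact: conv_approx|exact: conv_approx].
have [m hm'] := choice hm.
clear hm.
have harm : ((n.+1%:R^-1 : R)%:E) @[n --> \oo] --> 0%E.
  by apply: cvg_EFin; [exact: nearW|exact: cvg_harmonic].
have close (a b : nat -> X -> R) (c : X -> R) : (forall n, measurable_fun setT (a n)) -> (forall n, measurable_fun setT (b n)) ->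
    measurable_fun setT c -> (forall n, (N2 (fun x => a n x - b n x)%R <= (n.+1%:R^-1)%:E)%E) ->
    N2 (fun x => b n x - c x) @[n --> \oo] --> 0%E -> N2 (fun x => a n x - c x) @[n --> \oo] --> 0%E.
  move=> ma mb mc ab bc; apply: ecvg0_le (ecvg0D (ecvg0Z 2 harm) (ecvg0Z 2 bc)) => n.
  rewrite N2_ge0 /=; apply: le_trans (N2B_le _ _ _ (mb n)) _ => //.
  by apply: leeD => //; rewrite lee_pmul2l.
have neg (a : nat -> X -> R) (c : X -> R) : N2 (fun x => a n x - c x) @[n --> \oo] --> 0%E ->
   N2 (fun x => - a n x - - c x) @[n --> \oo] --> 0%E.
  rewrite (_ : (fun n => N2 (fun x => a n x - c x)) = (fun n => N2 (fun x => - a n x - - c x)))//.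
  by apply/funext => n; rewrite -N2N; congr N2; apply/funext => x; ring.
have mS n : 0 < (m n).+1%:R :> R by [].
have W1 n := gaussw_mul_L12 (mS n) (LF1 n); have W2 n := gaussw_mul_L12 (mS n) (LF2 n).
exists h1, (fun x => - h2 x); split => //; first by split => //; exact: L2N.
exists (fun n x => gaussw (m n).+1%:R x * F1 (u n) (v n) x), (fun n x => - (gaussw (m n).+1%:R x * F2 (u n) (v n) x)).
have NN w : L12 w -> L12 (fun x => - w x) by move=> [? ?]; split; [exact: L1N|exact: L2N].
split.
- by move=> n; split => //; exact: NN.
- apply: (close _ (fun n => F1 (u n) (v n))) => // [n|n||n].
  + by apply: m2; have [] := W1 n.
  + exact: m2.
  + exact: m2.
  + by have [] := hm' n.
- apply: neg; apply: (close _ (fun n => F2 (u n) (v n))) => // [n|n||n].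
  + by apply: m2; have [] := W2 n.
  + exact: m2.
  + exact: m2.
  + by have [] := hm' n.
- under eq_cvg do rewrite (inverse_gaussw (mS _) (Lu _) (Lv _)).1.
  apply: (close _ u) => // [n|n||n].
  + by apply: (measurable_conv E) => //; apply: m2; have [] := Lu n.
  + by apply: m2; have [] := Lu n.
  + exact: m2.
  + by have [] := hm' n.
- under eq_cvg do rewrite (inverse_gaussw (mS _) (Lu _) (Lv _)).2.
  have := neg v (fun x => - g2 x) vg; rewrite (_ : (fun n => _) = fun n => N2 (fun x => - v n x - g2 x)); last first.
    by apply/funext => n; congr N2; apply/funext => x; rewrite opprK.
  apply: close => // [n|n||n].
  + by apply: measurableT_comp => //; apply: (measurable_conv E) => //; apply: m2; have [] := Lv n.
  + by apply: measurableT_comp => //; apply: m2; have [] := Lv n.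
  + exact: m2.
  + rewrite (_ : (fun x => _) = (fun x => - (conv (m n).+1%:R (v n) x - v n x))); last by apply/funext => x; ring.
    by rewrite N2N; have [] := hm' n.
Unshelve. all: by end_near.
Qed.

Lemma fourier_pair_ext f1 f2 g1 g2 f1' f2' g1' g2' : fourier_pair f1 f2 g1 g2 -> fourier_pair f1' f2' g1' g2' ->
  (N2 (fun x => g1 x - g1' x)%R + N2 (fun x => g2 x - g2' x)%R = N2 (fun x => f1 x - f1' x)%R + N2 (fun x => f2 x - f2' x)%R)%E.
Proof. by move=> p q; have /(fourier_pair_isometry E) := fourier_pairB E p q. Qed.
End fourier_pair_theory.

(** * Multiscale estimates for thin sets *)

Section min_sum.
Context (R : realType).

(** Induction on [n]: split off [k = 0] and replace [t] by [t / 4]. The correction [- (3 * t)^-1]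
    makes the second bound inductive, since [t^-1 + 8/3 - 4 * (3 * t)^-1] is exactly
    [8/3 - (3 * t)^-1]. *)
Lemma sum_min_ratio n (t : R) : 0 < t ->
  (t <= 1 -> \sum_(k < n) Num.min (t / 4 ^+ k) (4 ^+ k / t) <= 4 / 3 * t) /\
  (1 <= t -> \sum_(k < n) Num.min (t / 4 ^+ k) (4 ^+ k / t) <= 8 / 3 - (3 * t)^-1).
Proof.
elim: n t => [|n IH] t t0.
  rewrite big_ord0; split => t1; first by rewrite mulr_ge0// ltW.
  rewrite subr_ge0 (@le_trans _ _ 1) ?invf_le1//; lra.
have t4 : 0 < t / 4 by rewrite divr_gt0.
have E : \sum_(k < n.+1) Num.min (t / 4 ^+ k) (4 ^+ k / t) =
   Num.min t t^-1 + \sum_(k < n) Num.min ((t / 4) / 4 ^+ k) (4 ^+ k / (t / 4)).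
  rewrite big_ord_recl expr0 divr1 mul1r; congr (_ + _); apply: eq_bigr => i _.
  by rewrite /= /bump /= add1n exprS; congr Num.min; field; rewrite ?expf_neq0 ?gt_eqF.
have [I1 I2] := IH _ t4; split => t1; rewrite E.
  have m1 : Num.min t t^-1 <= t by rewrite ge_min lexx.
  have /I1 : t / 4 <= 1 by lra.
  lra.
have m1 : Num.min t t^-1 <= t^-1 by rewrite ge_min lexx orbT.
have [t44|/ltW t44] := leP 1 (t / 4).
  have := I2 t44; rewrite (_ : (3 * (t / 4))^-1 = 4 * (3 * t)^-1); last by field; rewrite gt_eqF.
  have : t^-1 = 3 * (3 * t)^-1 by field; rewrite gt_eqF.
  lra.
(* The crossing range [1 <= t <= 4], where the tail is already in the regime of the first bound. *)
have h : t^-1 + t / 3 <= 8 / 3 - (3 * t)^-1.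
  rewrite -subr_ge0 (_ : _ - _ = (8 * t - t ^+ 2 - 4) / (3 * t)); last by field; rewrite gt_eqF.
  apply: divr_ge0; last by rewrite mulr_ge0// ltW.
  nra.
have := I1 t44; lra.
Qed.

(** The two bounds cross where [4^k] is about [t], so the sum is geometric in both directions. It
    serves both to sum the profiles and to count near scales. *)
Lemma sum_ratio_le J n (c : nat -> R) (t : R) : 0 <= t ->
  (forall k, (J <= k)%N -> c k <= t / 4 ^+ k) -> (forall k, (J <= k)%N -> c k <= 4 ^+ k / t) -> \sum_(J <= k < n) c k <= 3.
Proof.
rewrite le_eqVlt => /predU1P[<- c1 _|t0 c1 c2].
  apply: (@le_trans _ _ 0) => //; rewrite big_nat; apply: sumr_le0 => k /andP[Jk _].
  by apply: le_trans (c1 k Jk) _; rewrite mul0r.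
pose m k := Num.min (t / 4 ^+ k) (4 ^+ k / t).
have m0 k : 0 <= m k by rewrite le_min !divr_ge0// ?exprn_ge0// ltW.
have [nJ|Jn] := leqP n J; first by rewrite big_geq.
apply: (@le_trans _ _ (\sum_(J <= k < n) m k)).
  by rewrite big_nat [leRHS]big_nat; apply: ler_sum => k /andP[Jk _]; rewrite le_min c1// c2.
apply: (@le_trans _ _ (\sum_(k < n) m k)).
  rewrite -(big_mkord xpredT m) [leRHS](big_cat_nat (leq0n J) (ltnW Jn)) /= lerDr.
  by apply: sumr_ge0.
have [h1 h2] := sum_min_ratio n t0.
have [t1|/ltW t1] := leP t 1; first by apply: (le_trans (h1 t1)); lra.
apply: (le_trans (h2 t1)); have : 0 <= (3 * t)^-1 by rewrite invr_ge0 mulr_ge0// ltW.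
lra.
Qed.
End min_sum.

(** * Gaussian mass of a thin set *)

Section gauss_mass.
Context dX (X : measurableType dX) (R : realType) (mu : {sigma_finite_measure set X -> \bar R}).
Context (d : nat) (coord : X -> 'I_d -> R) (E : euclidean coord mu).
Local Notation gauss := (gauss coord).
Local Notation sqdist := (sqdist coord).
Local Notation sqnorm := (sqnorm coord).
Local Notation cube := (cube coord).

Lemma sqdist_cube_le x y (r : R) : 0 <= r -> cube x r y -> sqdist x y <= d%:R * r ^+ 2.
Proof.
move=> r0 c; rewrite mulr_natl -[X in _ *+ X](card_ord d) -sumr_const; apply: ler_sum => i _.
have := ltW (c i); rewrite -(@ler_sqr _ _ r) ?nnegrE// real_normK ?num_real//.
by rewrite -sqrrN opprB.
Qed.

Lemma cubeC x y (r : R) : \1_(cube x r) y = \1_(cube y r) x :> R.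
Proof.
rewrite !indicE; congr (_%:R); congr nat_of_bool.
by apply/idP/idP; rewrite !inE => c i; rewrite distrC.
Qed.

Lemma sqdist_half x y z : sqdist x z <= 2 * sqdist x y + 2 * sqdist y z.
Proof.
rewrite /Submission.sqdist !mulr_sumr -big_split /=; apply: ler_sum => i _.
move: (coord x i) (coord y i) (coord z i) => a b c.
by rewrite -subr_ge0 (_ : _ - _ = (a - 2 * b + c) ^+ 2) ?sqr_ge0//; ring.
Qed.

(** Three quarters of the exponent are spent on the bound [b]. The last quarter absorbs the move
    from [x] to a point [z] of the cube, for which [s^2 * sqdist x z <= 1]. The scale [s / 4] costs
    [4^d] and the move at most [expR pi]. *)
Lemma gauss_cube_le (s r b : R) x y z : 0 < s -> 0 <= r -> d%:R * r ^+ 2 * s ^+ 2 <= 1 ->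
  expR (- (3 / 4 * (pi * s ^+ 2 * sqdist x y))) <= b -> cube x r z ->
  gauss s x y <= b * (4 ^+ d * expR pi) * gauss (s / 4) y z.
Proof.
move=> s0 r0 rs eb c.
have q1 := sqdist_cube_le r0 c.
have q2 := sqdist_half y x z; rewrite (sqdistC coord y x) in q2.
have p0 : 0 <= pi :> R by exact: pi_ge0.
have s2 : 0 <= s ^+ 2 by exact: sqr_ge0.
have -> : gauss s x y = s ^+ d * (expR (- (3 / 4 * (pi * s ^+ 2 * sqdist x y))) * expR (- (1 / 4 * (pi * s ^+ 2 * sqdist x y)))).
  by rewrite -expRD /Submission.gauss; congr (_ * expR _); field.
have -> : b * (4 ^+ d * expR pi) * gauss (s / 4) y z =
   s ^+ d * (b * expR (pi - pi * (s / 4) ^+ 2 * sqdist y z)).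
  rewrite /Submission.gauss expRD expr_div_n; field; by rewrite expf_neq0.
rewrite ler_wpM2l ?exprn_ge0 ?(ltW s0)//; apply: ler_pM => //; rewrite ?expR_ge0// ler_expR.
have h : s ^+ 2 * sqdist x z <= 1.
  apply: le_trans rs; by rewrite mulrC ler_wpM2r.
have g : 0 <= s ^+ 2 * sqdist y z by rewrite mulr_ge0// sqdist_ge0.
have h2 := ler_wpM2l s2 q2.
have -> : pi - pi * (s / 4) ^+ 2 * sqdist y z = pi * (1 - s ^+ 2 * sqdist y z / 16) by field.
have -> : - (1 / 4 * (pi * s ^+ 2 * sqdist x y)) = pi * (- (s ^+ 2 * sqdist x y / 4)) by field.
apply: ler_wpM2l => //; move: h g h2; rewrite !mulrDr !mulrA ![s ^+ 2 * 2]mulrC -!mulrA.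
lra.
Qed.

(* Up to a constant, [gauss s x y] is at most the average of [gauss (s / 4) y z] over
   [z] in [cube x r]; integrating in [x] first then brings in the measure of [A `&` cube z r]. *)
Lemma gauss_mass_le (s r b e : R) A y : 0 < s -> 0 < r -> 0 <= e -> 0 <= b -> d%:R * r ^+ 2 * s ^+ 2 <= 1 ->
  measurable A -> (forall z, mu (A `&` cube z r) <= (e * (2 * r) ^+ d)%:E)%E ->
  (forall x, A x -> expR (- (3 / 4 * (pi * s ^+ 2 * sqdist x y))) <= b) ->
  (\int[mu]_x (\1_A x * gauss s x y)%:E <= (b * (4 ^+ d * expR pi) * e)%:E)%E.
Proof.
move=> s0 r0 e0 b0 rs mA thin far.
have mcoord := euclidean_coord E.
have s40 : 0 < s / 4 by rewrite divr_gt0.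
pose c := b * (4 ^+ d * expR pi).
have c0 : 0 <= c by rewrite mulr_ge0// mulr_ge0 ?exprn_ge0 ?expR_ge0.
pose V := (2 * r) ^+ d.
have V0 : 0 < V by rewrite exprn_gt0// mulr_gt0.
pose f (z : X * X) := (\1_(cube z.1 r) z.2 * (\1_A z.1 * (c * gauss (s / 4) y z.2)))%:E.
have mi : measurable_fun setT (fun x : X => \1_A x : R) by exact: measurable_indic.
have mg t : 0 < t -> measurable_fun setT (gauss t y).
  by move=> t0; exact: (kernel_section_measurable y (bounded_kernel_gauss E t0)).
have mf : measurable_fun setT f.
  apply/measurable_EFinP; apply: measurable_funM; first exact: measurable_cubes.
  apply: measurable_funM; first exact: (measurableT_comp mi measurable_fst).
  apply: measurable_funM => //.
  exact: (measurableT_comp (mg _ s40) measurable_snd).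
have i0 B x : 0 <= \1_B x :> R by rewrite indicE.
have f0 z : (0 <= f z)%E by rewrite lee_fin mulr_ge0// mulr_ge0// mulr_ge0// gauss_ge0// ltW.
rewrite -(@lee_pmul2l _ V%:E)//.
apply: (@le_trans _ _ (\int[mu]_x \int[mu]_z f (x, z))%E).
  rewrite -ge0_integralZl//; first last.
  - by rewrite lee_fin ltW.
  - by move=> x _; rewrite lee_fin mulr_ge0// gauss_ge0// ltW.
  - apply/measurable_EFinP; apply: measurable_funM => //.
    by under eq_fun do rewrite gaussC; exact: mg.
  apply: ge0_le_integral => //.
  - by move=> x _; rewrite mule_ge0// lee_fin ?(ltW V0)// mulr_ge0// gauss_ge0// ltW.
  - apply: measurable_funeM; apply/measurable_EFinP; apply: measurable_funM => //.
    by under eq_fun do rewrite gaussC; exact: mg.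
  - exact: (measurable_fun_fubini_tonelli_F (m2 := mu) _ mf f0).
  - move=> x _; rewrite muleC /V -(euclidean_cube E x (ltW r0)) -N2_indic; last exact: measurable_cube.
    rewrite /Submission.N2 -ge0_integralZl//; first last.
    + by rewrite lee_fin mulr_ge0// gauss_ge0// ltW.
    + by apply: measurable_sqr_EFin; apply: measurable_indic; exact: measurable_cube.
    apply: ge0_le_integral => //.
    + by move=> z _; rewrite mule_ge0// lee_fin ?sqr_ge0// mulr_ge0// gauss_ge0// ltW.
    + apply: measurable_funeM; apply: measurable_sqr_EFin; apply: measurable_indic; exact: measurable_cube.
    + exact: (measurableT_comp mf (measurable_pair1 x)).
    + move=> z _; rewrite -EFinM lee_fin sqr_indic /= mulrC.
      have [cz|ncz] := pselect (cube x r z); last by rewrite [\1_(cube x r) z]indicE memNset// !mul0r.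
      rewrite [\1_(cube x r) z]indicE mem_set// !mul1r.
      have [Ax|nAx] := pselect (A x); last by rewrite indicE memNset// !mul0r.
      rewrite indicE mem_set// !mul1r; apply: (gauss_cube_le _ (ltW r0)) => //.
      exact: far.
rewrite (fubini_tonelli f mf f0) /=.
apply: (@le_trans _ _ (\int[mu]_z ((c * gauss (s / 4) y z)%:E * (e * V)%:E))%E).
  apply: ge0_le_integral => //.
  - by move=> z _; exact: integral_ge0.
  - exact: (measurable_fun_fubini_tonelli_G (m1 := mu) _ mf f0).
  - apply: emeasurable_funM => //; apply/measurable_EFinP; apply: measurable_funM => //; exact: mg.
  - move=> z _; rewrite /f /=.
    under eq_integral => x _ do rewrite cubeC mulrA mulrC EFinM.
    have mAc : measurable (A `&` cube z r) by apply: measurableI => //; exact: measurable_cube.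
    rewrite ge0_integralZl//; first last.
    + by rewrite lee_fin mulr_ge0// gauss_ge0// ltW.
    + apply/measurable_EFinP; apply: measurable_funM => //; apply: measurable_indic; exact: measurable_cube.
    apply: lee_wpmul2l; first by rewrite lee_fin mulr_ge0// gauss_ge0// ltW.
    apply: le_trans (thin z); rewrite -(N2_indic mu mAc) le_eqVlt; apply/orP; left; apply/eqP.
    apply: eq_integral => x _; rewrite sqr_indic; congr EFin.
    by rewrite indicI /= mulrC.
under eq_integral do rewrite muleC (EFinM c) muleA.
rewrite ge0_integralZl//; first last.
- by rewrite -EFinM lee_fin mulr_ge0// mulr_ge0// ltW.
- by move=> x _; rewrite lee_fin gauss_ge0// ltW.
- by apply/measurable_EFinP; exact: mg.
rewrite (euclidean_gauss E)// mule1 -!EFinM lee_fin -/c le_eqVlt; apply/orP; left; apply/eqP; ring.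
Qed.
End gauss_mass.

(** * Scalar bounds for the cutoff profile *)

Section scalar_bounds.
Context (R : realType).

(** Dictated by [profile_in]: [1 - exp (- pi z) <= pi z <= 4 z], and the square of [exp (pi z / 4)]
    is at most [exp (pi / 2)] for [z <= 1]. *)
Definition profile_bound : R := 4 * expR (pi / 2).

Lemma profile_bound_ge4 : 4 <= profile_bound.
Proof. by rewrite ler_peMr// -expR0 ler_expR divr_ge0// pi_ge0. Qed.

Lemma expRN_le_inv (x : R) : 0 < x -> expR (- x) <= x^-1.
Proof.
move=> x0; rewrite expRN lef_pV2 ?posrE ?expR_gt0//.
by apply: le_trans (expR_ge1Dx x); rewrite lerDr.
Qed.

(** Here [z] stands for [sqnorm x / 4 ^+ k.+1] at a point inside the cutoff; [profile_out] treats
    the points outside. The pair of bounds is the input of [sum_ratio_le]. *)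
Lemma profile_in (z : R) : 0 <= z -> z <= 1 ->
  ((1 - expR (- (pi * z))) * expR (pi * z / 4)) ^+ 2 <= profile_bound * z /\
  ((1 - expR (- (pi * z))) * expR (pi * z / 4)) ^+ 2 <= profile_bound * z^-1.
Proof.
move=> z0 z1; have p0 : 0 <= pi :> R by exact: pi_ge0.
set a := 1 - expR (- (pi * z)).
have a0 : 0 <= a by rewrite subr_ge0 -expR0 ler_expR oppr_le0 mulr_ge0.
have a1 : a <= 1 by rewrite lerBlDr lerDl expR_ge0.
have az : a <= 4 * z.
  apply: (@le_trans _ _ (pi * z)); last first.
    by rewrite ler_wpM2r//; have /andP[_] := pihalf_02 R; lra.
  by rewrite /a; have := expR_ge1Dx (- (pi * z)); lra.
rewrite exprMn; have -> : expR (pi * z / 4) ^+ 2 = expR (pi * z / 2).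
  by rewrite expr2 -expRD; congr expR; field.
have eM : expR (pi * z / 2) <= expR (pi / 2).
  by rewrite ler_expR ler_wpM2r// ler_piMr.
have M0 : 0 < expR (pi / 2) :> R by exact: expR_gt0.
have h : a ^+ 2 * expR (pi * z / 2) <= a * expR (pi / 2).
  by apply: ler_pM; rewrite ?sqr_ge0 ?expR_ge0// expr2 ler_piMl.
split; apply: (le_trans h).
  by rewrite mulrC /profile_bound -mulrA mulrCA ler_wpM2l// ltW.
(* At [z = 0] the right-hand side is [0] because [0^-1 = 0]; the left-hand side vanishes as well. *)
move: z0; rewrite le_eqVlt => /predU1P[z0|z0].
  by rewrite /a -z0 mulr0 oppr0 expR0 subrr mul0r invr0 mulr0.
apply: (@le_trans _ _ (expR (pi / 2))); first by rewrite ler_piMl// ltW.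
rewrite /profile_bound -[leLHS]mul1r; apply: (@le_trans _ _ (4 * expR (pi / 2))).
  by rewrite ler_wpM2r ?(ltW M0)// ler1n.
by rewrite ler_peMr ?mulr_ge0 ?(ltW M0)// invf_ge1.
Qed.

(** The threshold is [1 <= 4 * z] because the cutoff is only known to contain [qb k], whose squared
    radius is [4 ^+ k.+1 / 4]. *)
Lemma profile_out (z : R) : 1 <= 4 * z ->
  (expR (- (pi * z)) * expR (pi * z / 4)) ^+ 2 <= profile_bound * z /\
  (expR (- (pi * z)) * expR (pi * z / 4)) ^+ 2 <= profile_bound * z^-1.
Proof.
move=> z1; have z0 : 0 < z by lra.
have p2 : 2 <= pi :> R by exact: pi_ge2.
have -> : (expR (- (pi * z)) * expR (pi * z / 4)) ^+ 2 = expR (- (3 / 2 * (pi * z))).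
  by rewrite -expRD expr2 -expRD; congr expR; field.
have c4 := profile_bound_ge4.
have y1 : 3 * z <= 3 / 2 * (pi * z).
  by have := ler_wpM2r (ltW z0) p2; lra.
split.
  apply: (@le_trans _ _ 1); last by nra.
  by rewrite -[leRHS]expR0 ler_expR oppr_le0; lra.
apply: (le_trans (expRN_le_inv _)); first by lra.
apply: (@le_trans _ _ z^-1); last by rewrite ler_peMl ?invr_ge0 ?(ltW z0)//; lra.
by rewrite lef_pV2 ?posrE//; lra.
Qed.

Lemma sqr_exp2 k : (2 ^+ k) ^+ 2 = 4 ^+ k :> R.
Proof. by rewrite exprAC -natrX. Qed.

Lemma sum_half_le J n : \sum_(J <= k < n) (1 / 2 : R) ^+ k <= 2.
Proof.
have h m : \sum_(0 <= k < m) (1 / 2 : R) ^+ k = 2 - 2 * (1 / 2) ^+ m.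
  elim: m => [|m IH]; first by rewrite big_geq// expr0; lra.
  by rewrite big_nat_recr//= IH exprS; lra.
have p0 m : 0 <= (1 / 2 : R) ^+ m by rewrite exprn_ge0.
have [nJ|Jn] := leqP n J; first by rewrite big_geq.
have := h n; rewrite (big_cat_nat (leq0n J) (ltnW Jn)) /=.
have : 0 <= \sum_(0 <= k < J) (1 / 2 : R) ^+ k by apply: sumr_ge0.
have := p0 n; lra.
Qed.
End scalar_bounds.

(** * Dyadic shells and the Gaussian masses of thin shells *)

Section shells.
Context dX (X : measurableType dX) (R : realType) (mu : {sigma_finite_measure set X -> \bar R}).
Context (d : nat) (coord : X -> 'I_d -> R) (E : euclidean coord mu) (hd : (0 < d)%N).
Local Notation L1 := (L1 mu).
Local Notation L2 := (L2 mu).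
Local Notation N2 := (N2 mu).
Local Notation L12 := (L12 mu).
Local Notation gaussw := (gaussw coord).
Local Notation gauss := (gauss coord).
Local Notation sqdist := (sqdist coord).
Local Notation sqnorm := (sqnorm coord).
Local Notation cube := (cube coord).
Local Notation conv s := (kop mu (gauss s)).

Definition qb k := [set x | sqnorm x < 4 ^+ k].
Definition shell k := qb k.+1 `\` qb k.
(* Small enough that [sqrt d * mesh k <= 2^-(k+2)]. *)
Definition mesh k : R := (2 ^+ k.+1 * (2 * d%:R))^-1.

(** The discrete form of thinness at the scale [1 / |x|]: on [shell k] the norm is about [2^k], and
    [mesh k] is of order [2^-k]. *)
Definition thin_shells (F : set X) (e : R) J := forall k, (J <= k)%N -> forall z,
  (mu (F `&` shell k `&` cube z (mesh k)) <= (e * (2 * mesh k) ^+ d)%:E)%E.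

Lemma measurable_qb k : measurable (qb k).
Proof. exact: (measurable_qnorm (euclidean_coord E)). Qed.

Lemma measurable_shell k : measurable (shell k).
Proof. by apply: measurableD; exact: measurable_qb. Qed.

Lemma subset_qb j k : (j <= k)%N -> qb j `<=` qb k.
Proof. by move=> jk x /lt_le_trans; apply; rewrite ler_weXn2l// ler1n. Qed.

Lemma shell_disjoint i j x : (i < j)%N -> ~ (shell i x /\ shell j x).
Proof. by move=> ij [[xi _] [_ xj]]; apply: xj; exact: (subset_qb ij). Qed.

Lemma qb_finite k : (mu (qb k) < +oo)%E.
Proof.
have [org org0] := euclidean_origin E.
apply: (@le_lt_trans _ _ (mu (cube org (2 ^+ k)))); last first.
  by rewrite (euclidean_cube E) ?exprn_ge0// ltry.
apply: le_measure; rewrite ?inE; [exact: measurable_qb|exact: (measurable_cube (euclidean_coord E))|].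
move=> x xk i; rewrite org0 subr0.
rewrite -(@ltr_sqr _ _ (2 ^+ k)) ?nnegrE ?exprn_ge0// real_normK ?num_real//.
rewrite sqr_exp2; apply: le_lt_trans xk.
by rewrite /Submission.sqnorm (bigD1 i)//= lerDl; apply: sumr_ge0 => j _; exact: sqr_ge0.
Qed.

Lemma dim_gt0 : 0 < d%:R :> R. Proof. by rewrite ltr0n. Qed.

Lemma mesh_gt0 k : 0 < mesh k.
Proof. by rewrite invr_gt0 mulr_gt0 ?exprn_gt0// mulr_gt0// dim_gt0. Qed.

(** [2 * 2 ^+ k.+1] is the larger of the two convolution scales in [kop_split]; [gauss_mass_le]
    requires this smallness of the mesh. *)
Lemma mesh_scale k : d%:R * mesh k ^+ 2 * (2 * 2 ^+ k.+1) ^+ 2 <= 1.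
Proof.
have -> : d%:R * mesh k ^+ 2 * (2 * 2 ^+ k.+1) ^+ 2 = d%:R^-1.
  rewrite /mesh; have : 0 < 2 ^+ k.+1 :> R by rewrite exprn_gt0.
  move: (2 ^+ k.+1) => p p0.
  by have := dim_gt0; move: (d%:R) => D D0; field; rewrite !gt_eqF.
by rewrite invf_le1 ?dim_gt0// ler1n.
Qed.

Lemma sqnorm_le x y : sqnorm x <= 2 * sqdist x y + 2 * sqnorm y.
Proof.
rewrite /Submission.sqdist /Submission.sqnorm !mulr_sumr -big_split /=; apply: ler_sum => i _.
move: (coord x i) (coord y i) => a b.
by rewrite -subr_ge0 (_ : _ - _ = (a - 2 * b) ^+ 2) ?sqr_ge0//; ring.
Qed.

Definition mass_bound : R := 4 ^+ d * expR pi.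

Lemma mass_bound_gt0 : 0 < mass_bound.
Proof. by rewrite mulr_gt0 ?exprn_gt0// expR_gt0. Qed.

(* [near_scale k y] is the only range of scales in which [y] is not much closer to
   or farther from the origin than [shell k]. *)
Definition near_scale k y := (4 ^+ k.+1 <= 16 * sqnorm y) && (sqnorm y < 4 * 4 ^+ k.+1).

Definition decay k y : R := if near_scale k y then 1 else 8 * (1 / 2) ^+ k.+1.

Lemma decay_ge0 k y : 0 <= decay k y.
Proof. by rewrite /decay; case: ifP => // _; rewrite mulr_ge0// exprn_ge0. Qed.

(** When [y] is not near [shell k], its distance to [x] is at least [2^(k+1) / 4], while the
    Gaussian has width of order [2^-(k+1)]. The true decay is so strong that [exp (- t) <= 1 / t]
    suffices. *)
Lemma gauss_decay k x y : shell k x -> expR (- (3 / 4 * (pi * (2 ^+ k.+1) ^+ 2 * sqdist x y))) <= decay k y.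
Proof.
move=> [/= xk1 /negP xk0]; rewrite -leNgt in xk0; rewrite /qb /= in xk1.
have p2 : 2 <= pi :> R by exact: pi_ge2.
rewrite sqr_exp2.
rewrite /decay; case: ifPn => [_|].
  rewrite -expR0 ler_expR oppr_le0 mulr_ge0// mulr_ge0 ?sqdist_ge0// mulr_ge0 ?pi_ge0//.
rewrite negb_and -!ltNge -leNgt => nk.
have q : 4 ^+ k.+1 / 16 <= sqdist x y.
  have h1 := sqnorm_le x y; have h2 := sqnorm_le y x; rewrite (sqdistC coord y x) in h2.
  rewrite exprS in xk1 nk *.
  have : 0 < 4 ^+ k :> R by rewrite exprn_gt0.
  by case/orP: nk => nk; lra.
have h2 : 2 <= 2 ^+ k.+1 :> R.
  by rewrite exprS ler_peMr// exprn_ege1// ler1n.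
have -> : (1 / 2 : R) ^+ k.+1 = (2 ^+ k.+1)^-1 by rewrite expr_div_n expr1n mul1r.
rewrite -sqr_exp2 in q *; move: h2 q; move: (2 ^+ k.+1) (sqdist x y) => p q p1 pq.
have p0 : 0 < p by lra.
have r1 : p / 8 <= 3 / 4 * (pi * p ^+ 2 * q).
  have : 2 * p ^+ 2 * (p ^+ 2 / 16) <= pi * p ^+ 2 * q.
    apply: ler_pM => //; rewrite ?mulr_ge0 ?sqr_ge0 ?ler_wpM2r ?sqr_ge0 ?(ltW p0)//.
  have : p * 8 <= p ^+ 2 * p ^+ 2.
    have -> : p ^+ 2 * p ^+ 2 = p * p ^+ 3 by ring.
    rewrite ler_wpM2l ?(ltW p0)//.
    have -> : 8 = 2 ^+ 3 :> R by ring.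
    by rewrite lerXn2r// nnegrE ltW.
  lra.
have r0 : 0 < 3 / 4 * (pi * p ^+ 2 * q) by apply: lt_le_trans r1; rewrite divr_gt0.
apply: (le_trans (expRN_le_inv r0)).
rewrite -[8 / p]invrK invf_div lef_pV2 ?posrE// divr_gt0//.
Qed.

(** The near scales are counted by [sum_ratio_le] with weight [1 / 16] on each: they contribute at
    most 48, and the geometric rest at most 8. *)
Lemma sum_decay_le J n y : \sum_(J <= k < n) decay k y <= 64.
Proof.
pose c k : R := if near_scale k y then 1 / 16 else 0.
have h k : decay k y <= 16 * c k + 4 * (1 / 2) ^+ k.
  have : 0 <= (1 / 2 : R) ^+ k by rewrite exprn_ge0.
  by rewrite /decay /c exprS; case: ifP => _; lra.
have t0 := sqnorm_ge0 coord y.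
have c3 : \sum_(J <= k < n) c k <= 3.
  apply: (@sum_ratio_le _ J n c (sqnorm y / 4)) => [|k _|k _]; first by rewrite divr_ge0.
    rewrite /c; case: ifPn => [/andP[h1 h2]|_]; last by rewrite !divr_ge0// exprn_ge0.
    by rewrite ler_pdivlMr ?exprn_gt0//; rewrite exprS in h1; lra.
  rewrite /c; case: ifPn => [/andP[h1 h2]|_]; last by rewrite !divr_ge0// exprn_ge0.
  have p0 : 0 < 4 ^+ k :> R by rewrite exprn_gt0.
  rewrite exprS in h1 h2.
  by rewrite ler_pdivlMr; lra.
apply: (@le_trans _ _ (\sum_(J <= k < n) (16 * c k + 4 * (1 / 2) ^+ k))).
  by apply: ler_sum.
rewrite big_split /= -!mulr_sumr.
have := sum_half_le R J n; lra.
Qed.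

(** The square on the indicator matches the weight [h x ^+ 2] of [conv_N2_le]. *)
Definition gmass (A : set X) s y : \bar R := (\int[mu]_x (\1_A x ^+ 2 * gauss s x y)%:E)%E.

Lemma gmass_ge0 A s y : 0 < s -> (0 <= gmass A s y)%E.
Proof. by move=> s0; apply: integral_ge0 => x _; rewrite lee_fin mulr_ge0 ?sqr_ge0// gauss_ge0// ltW. Qed.

Lemma measurable_gmass A s : 0 < s -> measurable A -> measurable_fun setT (gmass A s).
Proof.
move=> s0 mA; apply: (measurable_fun_fubini_tonelli_G (m1 := mu) (fun z => (\1_A z.1 ^+ 2 * gauss s z.1 z.2)%:E)).
  apply/measurable_EFinP; apply: measurable_funM; last exact: (measurable_gauss (euclidean_coord E)).
  apply: measurable_funX; apply: (measurableT_comp (f := (\1_A : X -> R))) => //; exact: measurable_indic.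
by move=> z; rewrite lee_fin mulr_ge0 ?sqr_ge0// gauss_ge0// ltW.
Qed.

(** Used with [b = decay k y] at the scale [2 ^+ k.+1], and with [b = 1] at twice that scale. *)
Lemma gmass_le (s b e : R) F k y : measurable F -> 0 <= e -> 0 <= b -> 0 < s -> s <= 2 * 2 ^+ k.+1 ->
  (forall z, mu (F `&` shell k `&` cube z (mesh k)) <= (e * (2 * mesh k) ^+ d)%:E)%E ->
  (forall x, shell k x -> expR (- (3 / 4 * (pi * s ^+ 2 * sqdist x y))) <= b) ->
  (gmass (F `&` shell k) s y <= (b * mass_bound * e)%:E)%E.
Proof.
move=> mF e0 b0 s0 s2 thin far; rewrite /gmass; under eq_integral do rewrite sqr_indic.
apply: (gauss_mass_le E s0 (mesh_gt0 k)) => //.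
- apply: le_trans (mesh_scale k); rewrite ler_wpM2l ?mulr_ge0 ?sqr_ge0 ?(ltW dim_gt0) ?(ltW (mesh_gt0 k))//.
  rewrite lerXn2r ?nnegrE ?(ltW s0)//; exact: (le_trans (ltW s0)).
- by apply: measurableI => //; exact: measurable_shell.
- by move=> x [_ /far].
Qed.

Lemma sum_gmass_le (e : R) F J n y : measurable F -> 0 <= e -> thin_shells F e J ->
  (\sum_(J <= k < n) gmass (F `&` shell k) (2 ^+ k.+1) y <= (64 * mass_bound * e)%:E)%E.
Proof.
move=> mF e0 th; apply: (@le_trans _ _ (\sum_(J <= k < n) (decay k y * mass_bound * e)%:E)%E).
  rewrite big_nat_cond [leRHS]big_nat_cond; apply: lee_sum => k /andP[/andP[Jk _] _].
  apply: gmass_le => //; [exact: decay_ge0|by rewrite ler_peMl ?exprn_ge0// ler1n|exact: th|].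
  by move=> x; exact: gauss_decay.
rewrite sumEFin lee_fin; under eq_bigr do rewrite -mulrA.
rewrite -mulr_suml -mulrA ler_wpM2r ?sum_decay_le// mulr_ge0// (ltW mass_bound_gt0)//.
Qed.
End shells.

(** * The multiscale inequality *)

Section multiscale.
Context dX (X : measurableType dX) (R : realType) (mu : {sigma_finite_measure set X -> \bar R}).
Context (d : nat) (coord : X -> 'I_d -> R) (E : euclidean coord mu) (hd : (0 < d)%N).
Local Notation L1 := (L1 mu).
Local Notation L2 := (L2 mu).
Local Notation N2 := (N2 mu).
Local Notation L12 := (L12 mu).
Local Notation gaussw := (gaussw coord).
Local Notation gauss := (gauss coord).
Local Notation sqnorm := (sqnorm coord).
Local Notation conv s := (kop mu (gauss s)).
Local Notation qb := (qb coord).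
Local Notation shell := (shell coord).
Local Notation gmass := (gmass mu coord).
Local Notation thin_shells := (thin_shells mu coord).

(* Shared by [kcos] and [ksin]; [spectral_conv] says that [K] turns multiplication
   by a Gaussian into convolution with one. *)
Record spectral (K : X -> X -> R) : Prop := Spectral {
  spectral_bounded : bounded_kernel K ;
  spectral_swap : forall u v, L1 u -> L1 v -> \int[mu]_x (v x * kop mu K u x) = \int[mu]_x (u x * kop mu K v x) ;
  spectral_N2 : forall u, L1 u -> L2 u -> (N2 (kop mu K u) <= N2 u)%E ;
  spectral_conv : forall s u x, 0 < s -> L1 u -> conv s (kop mu K u) x = kop mu K (fun y => gaussw s y * u y) x }.

Lemma N2_cos_sin u : L12 u -> (N2 (kop mu (kcos coord) u) + N2 (kop mu (ksin coord) u) = N2 u)%E.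
Proof.
move=> [iu Lu]; have [i0 L0] : L12 (fun=> 0 : R).
  have := L12Z 0 (conj iu Lu); congr L12; apply/funext => x; exact: mul0r.
have K0 k : kop mu k (fun=> 0 : R) = fun=> 0.
  by apply/funext => x; apply: Rintegral_eq0 => y; rewrite mulr0.
have z0 : N2 (fun=> 0) = 0%E.
  rewrite -[RHS](@integral0 _ _ _ mu setT); apply: eq_integral => x _.
  by rewrite expr0n.
have := plancherel E iu Lu i0 L0; rewrite /F1 /F2 !K0 z0 adde0 => <-.
rewrite -[in LHS](N2N mu (kop mu (ksin coord) u)).
by congr (N2 _ + N2 _)%E; apply/funext => x; rewrite ?addr0 ?sub0r.
Qed.

Lemma spectral_kcos : spectral (kcos coord).
Proof.
split; [exact: (bounded_kernel_cos E)|by move=> *; exact: (kcos_swap E)| |by move=> *; exact: (conv_kcos E)].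
by move=> u iu Lu; rewrite -(N2_cos_sin (conj iu Lu)) leeDl// N2_ge0.
Qed.

Lemma spectral_ksin : spectral (ksin coord).
Proof.
split; [exact: (bounded_kernel_sin E)|by move=> *; exact: (ksin_swap E)| |by move=> *; exact: (conv_ksin E)].
by move=> u iu Lu; rewrite -(N2_cos_sin (conj iu Lu)) leeDr// N2_ge0.
Qed.

(* [(1_D - a) / b] for the Gaussians [a = gaussw 2^(k+1)] and [b = gaussw 2^(k+2)], where [b^4 = a].
   It is small both far inside and far outside the ball of radius [2^(k+1)]. *)
Definition profile k (D : set X) x : R := (\1_D x - gaussw (2 ^+ k.+1) x) * expR (pi * (sqnorm x / 4 ^+ k.+1) / 4).

Lemma measurable_profile k D : measurable D -> measurable_fun setT (profile k D).
Proof.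
move=> mD; apply: measurable_funM.
  by apply: measurable_funB; [exact: measurable_indic|exact: (measurable_gaussw E)].
apply: measurableT_comp => //; apply: measurable_funM => //; apply: measurable_funM => //.
by apply: measurable_funM => //; exact: (measurable_sqnorm (euclidean_coord E)).
Qed.

Lemma profile_le k D x : qb k `<=` D -> D `<=` qb k.+1 ->
  profile k D x ^+ 2 <= profile_bound R * (sqnorm x / 4 ^+ k.+1) /\
  profile k D x ^+ 2 <= profile_bound R * (4 ^+ k.+1 / sqnorm x).
Proof.
move=> kD Dk; have p0 : 0 < 4 ^+ k.+1 :> R by rewrite exprn_gt0.
have gE : gaussw (2 ^+ k.+1) x = expR (- (pi * (sqnorm x / 4 ^+ k.+1))).
  by rewrite /Submission.gaussw sqr_exp2 mulrA.
have t0 := sqnorm_ge0 coord x.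
have z0 : 0 <= sqnorm x / 4 ^+ k.+1 by rewrite divr_ge0// ltW.
rewrite -[4 ^+ k.+1 / _]invf_div /profile gE.
have [Dx|nDx] := pselect (D x).
  rewrite indicE mem_set//; apply: profile_in => //.
  by rewrite ler_pdivrMr// mul1r ltW//; exact: Dk.
rewrite indicE memNset//= sub0r mulNr sqrrN; apply: profile_out.
have /negP : ~ qb k x by move/kD.
by rewrite /Submission.qb /= -leNgt mulrA ler_pdivlMr// mul1r exprS ler_pM2l.
Qed.

Lemma norm_profile_le k D x : qb k `<=` D -> D `<=` qb k.+1 -> `|profile k D x| <= profile_bound R.
Proof.
move=> kD Dk; have [h1 h2] := profile_le x kD Dk.
have c4 := profile_bound_ge4 R.
have h : profile k D x ^+ 2 <= profile_bound R.
  have p0 : 0 < 4 ^+ k.+1 :> R by rewrite exprn_gt0.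
  have [xk|/ltW xk] := leP (sqnorm x) (4 ^+ k.+1).
    apply: (le_trans h1); rewrite ler_piMr//; first lra.
    by rewrite ler_pdivrMr// mul1r.
  apply: (le_trans h2); rewrite ler_piMr//; first lra.
  by rewrite ler_pdivrMr ?mul1r//; apply: lt_le_trans xk.
rewrite -(@ler_sqr _ _ (profile_bound R)) ?nnegrE//; last lra.
rewrite real_normK ?num_real//; apply: (le_trans h).
rewrite expr2 ler_peMr//; lra.
Qed.

Lemma profile_split k D x : \1_D x = gaussw (2 ^+ k.+1) x + gaussw (2 * 2 ^+ k.+1) x * profile k D x.
Proof.
suff h : gaussw (2 * 2 ^+ k.+1) x * expR (pi * (sqnorm x / 4 ^+ k.+1) / 4) = 1.
  by rewrite /profile mulrCA h mulr1; ring.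
rewrite /Submission.gaussw -expRD -[RHS]expR0; congr expR.
have p0 : 0 < 2 ^+ k.+1 :> R by rewrite exprn_gt0.
rewrite -sqr_exp2; move: (2 ^+ k.+1) p0 => p p0.
by move: (sqnorm x) => q; set P := (pi : R); field; rewrite gt_eqF.
Qed.

Lemma sum_profile_le (D : nat -> set X) J n x : (forall k, qb k `<=` D k /\ D k `<=` qb k.+1) ->
  \sum_(J <= k < n) profile k (D k) x ^+ 2 <= 3 * profile_bound R.
Proof.
move=> hD; have c4 := profile_bound_ge4 R; have c0 : 0 < profile_bound R by lra.
rewrite -ler_pdivrMr// mulr_suml.
(* Dividing by 4 compensates for the exponent [k.+1] in [profile_le]. *)
apply: (@sum_ratio_le _ J n _ (sqnorm x / 4)) => [|k _|k _].
- by rewrite divr_ge0// sqnorm_ge0.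
- have [h _] := profile_le x (hD k).1 (hD k).2.
  rewrite ler_pdivrMr//; apply: (le_trans h); rewrite mulrC ler_wpM2r ?(ltW c0)//.
  by rewrite exprS invfM mulrA.
- have [_ h] := profile_le x (hD k).1 (hD k).2.
  rewrite ler_pdivrMr//; apply: (le_trans h); rewrite mulrC ler_wpM2r ?(ltW c0)//.
  by rewrite exprS invf_div mulrA [_ * 4]mulrC.
Qed.

(** [128] is [2 * 64], from [sum_gmass_le]; [6] is [2 * 3], from [sum_profile_le]; the factors 2
    come from [N2D_le]. *)
Definition multiscale_const : R := mass_bound R d * (128 + 6 * profile_bound R).

Lemma multiscale_const_gt0 : 0 < multiscale_const.
Proof.
by rewrite mulr_gt0 ?mass_bound_gt0//; have := profile_bound_ge4 R; lra.
Qed.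

Lemma L2_spectral K u : spectral K -> L12 u -> L2 (kop mu K u).
Proof.
move=> sK [iu Lu]; split; first exact: (measurable_kop _ (spectral_bounded sK) (L1_measurable iu)).
by apply: le_lt_trans (spectral_N2 sK iu Lu) _; case: Lu.
Qed.

(** [spectral_conv] turns each Gaussian factor of [profile_split] into a convolution, so both terms
    are smooth at the scale on which [F] is thin. *)
Lemma kop_split K u k D x : spectral K -> measurable D -> qb k `<=` D -> D `<=` qb k.+1 -> L12 u ->
  kop mu K (fun y => \1_D y * u y) x = conv (2 ^+ k.+1) (kop mu K u) x +
    conv (2 * 2 ^+ k.+1) (kop mu K (fun y => profile k D y * u y)) x.
Proof.
move=> sK mD kD Dk [iu _].
have s0 : 0 < 2 ^+ k.+1 :> R by rewrite exprn_gt0.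
have s1 : 0 < 2 * 2 ^+ k.+1 :> R by rewrite mulr_gt0.
have iv : L1 (fun y => profile k D y * u y).
  apply: (L1_bounded_mul (c := profile_bound R)) => //; first exact: measurable_profile.
  by move=> y; exact: norm_profile_le.
have ig s w : L1 w -> L1 (fun y => gaussw s y * w y).
  move=> iw; apply: (L1_bounded_mul (c := 1)) => //; first exact: (measurable_gaussw E).
  by move=> y; exact: norm_gaussw_le1.
rewrite !(spectral_conv sK)// -kopD; [|exact: (spectral_bounded sK)|exact: ig|exact: ig].
congr kop; apply/funext => y; rewrite (profile_split k D y); ring.
Qed.

(* By [kop_split] the [k]-th term is the average of [(K u)^2] and [(K (profile * u))^2] against
   Gaussians of width [2^-k]; over the shells, the former have total mass [O(e)] and the
   latter have summable [L2] norms. *)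
Lemma multiscale_le K (F : set X) (D : nat -> set X) (e : R) J n u : spectral K -> measurable F -> 0 <= e ->
  thin_shells F e J -> (forall k, measurable (D k)) -> (forall k, qb k `<=` D k /\ D k `<=` qb k.+1) -> L12 u ->
  (\sum_(J <= k < n) N2 (fun x => \1_(F `&` shell k) x * kop mu K (fun y => \1_(D k) y * u y) x)%R <=
    (multiscale_const * e)%:E * N2 u)%E.
Proof.
move=> sK mF e0 th mD hD Lu; have [iu L2u] := Lu.
have mF' k : measurable (F `&` shell k) by apply: measurableI => //; exact: (measurable_shell E).
have s0 k : 0 < 2 ^+ k.+1 :> R by rewrite exprn_gt0.
have s1 k : 0 < 2 * 2 ^+ k.+1 :> R by rewrite mulr_gt0.
pose v k y := profile k (D k) y * u y.
have nv k y := norm_profile_le y (hD k).1 (hD k).2.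
have mp k := measurable_profile k (mD k).
have Lv k : L12 (v k).
  split; first by apply: (L1_bounded_mul (c := profile_bound R)).
  by apply: (L2_bounded_mul (c := profile_bound R)).
have mi k : measurable_fun setT (fun x : X => \1_(F `&` shell k) x : R) by exact: measurable_indic.
have LK := L2_spectral sK Lu; have LKv k := L2_spectral sK (Lv k).
have gm k y := gmass_ge0 mu coord (F `&` shell k) y (s0 k).
have mgm k := measurable_gmass E (s0 k) (mF' k).
have sq0 (w : X -> R) y : (0 <= (w y ^+ 2)%:E)%E by rewrite lee_fin sqr_ge0.
have MB := mass_bound_gt0 R d.
have step k : (J <= k)%N -> (N2 (fun x => \1_(F `&` shell k) x * kop mu K (fun y => \1_(D k) y * u y) x)%R <=
    2%:E * (\int[mu]_y ((kop mu K u y ^+ 2)%:E * gmass (F `&` shell k) (2 ^+ k.+1) y)) +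
    (2 * (mass_bound R d * e))%:E * N2 (v k))%E.
  move=> Jk.
  have -> : (fun x => \1_(F `&` shell k) x * kop mu K (fun y => \1_(D k) y * u y) x)%R =
     fun x => \1_(F `&` shell k) x * conv (2 ^+ k.+1) (kop mu K u) x +
      \1_(F `&` shell k) x * conv (2 * 2 ^+ k.+1) (kop mu K (v k)) x.
    by apply/funext => x; rewrite -mulrDr (kop_split x sK (mD k) (hD k).1 (hD k).2 Lu).
  apply: (le_trans (N2D_le mu _ _)).
  - by apply: measurable_funM => //; apply: (measurable_conv E) => //; case: LK.
  - by apply: measurable_funM => //; apply: (measurable_conv E) => //; case: (LKv k).
  apply: leeD; first by rewrite lee_pmul2l//; exact: (conv_N2_le E).
  rewrite EFinM -muleA lee_pmul2l//; apply: (le_trans (conv_N2_le E (s1 k) (mi k) (LKv k))).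
  apply: (@le_trans _ _ (\int[mu]_y ((kop mu K (v k) y ^+ 2)%:E * (1 * mass_bound R d * e)%:E))%E).
    apply: ge0_le_integral => //.
    - by move=> y _; rewrite mule_ge0//; exact: gmass_ge0.
    - apply: emeasurable_funM; first by apply: measurable_sqr_EFin; case: (LKv k).
      exact: (measurable_gmass E).
    - by apply: emeasurable_funM => //; apply: measurable_sqr_EFin; case: (LKv k).
    - move=> y _; apply: lee_wpmul2l => //; apply: (gmass_le E hd mF e0 _ _ _ (th k Jk)) => //.
      move=> x _; rewrite -[leRHS]expR0 ler_expR oppr_le0 mulr_ge0// mulr_ge0 ?sqdist_ge0//.
      by rewrite mulr_ge0 ?pi_ge0// sqr_ge0.
  rewrite ge0_integralZr//.
  - by rewrite mul1r muleC lee_pmul ?lee_fin ?mulr_ge0 ?(ltW MB)// ?N2_ge0//; have [? ?] := Lv k; exact: (spectral_N2 sK).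
  - by apply: measurable_sqr_EFin; case: (LKv k).
  - by rewrite lee_fin mulr_ge0// mul1r ltW.
apply: (@le_trans _ _ (\sum_(J <= k < n) (2%:E * (\int[mu]_y ((kop mu K u y ^+ 2)%:E * gmass (F `&` shell k) (2 ^+ k.+1) y)) +
    (2 * (mass_bound R d * e))%:E * N2 (v k)))%E).
  by rewrite big_nat_cond [leRHS]big_nat_cond; apply: lee_sum => k /andP[/andP[Jk _] _]; exact: step.
rewrite big_split /= -!ge0_sume_distrr//; first last.
- by move=> k _; apply: integral_ge0 => y _; rewrite mule_ge0.
- by move=> k _; exact: N2_ge0.
(* The masses are summed over [k] at fixed [y] before integrating: their sum is bounded
   independently of [n]. *)
have h1 : (\sum_(J <= k < n) \int[mu]_y ((kop mu K u y ^+ 2)%:E * gmass (F `&` shell k) (2 ^+ k.+1) y) <=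
    (64 * mass_bound R d * e)%:E * N2 u)%E.
  rewrite -ge0_integral_sum//; first last.
  - by move=> k y _; rewrite mule_ge0.
  - by move=> k; apply: emeasurable_funM => //; apply: measurable_sqr_EFin; case: LK.
  apply: (@le_trans _ _ (\int[mu]_y ((kop mu K u y ^+ 2)%:E * (64 * mass_bound R d * e)%:E))%E).
    apply: ge0_le_integral => //.
    - by move=> y _; apply: sume_ge0 => k _; rewrite mule_ge0.
    - by apply: emeasurable_sum => k; apply: emeasurable_funM => //; apply: measurable_sqr_EFin; case: LK.
    - by apply: emeasurable_funM => //; apply: measurable_sqr_EFin; case: LK.
    - move=> y _; rewrite -ge0_sume_distrr//; apply: lee_wpmul2l => //.
      exact: (sum_gmass_le E hd).
  rewrite ge0_integralZr//.
  - rewrite muleC lee_pmul ?lee_fin ?mulr_ge0 ?(ltW MB)// ?N2_ge0//; exact: (spectral_N2 sK).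
  - by apply: measurable_sqr_EFin; case: LK.
  - by rewrite lee_fin mulr_ge0// mulr_ge0// ltW.
have h2 : (\sum_(J <= k < n) N2 (v k) <= (3 * profile_bound R)%:E * N2 u)%E.
  have mu' : measurable_fun setT u by exact: L1_measurable iu.
  rewrite -ge0_integral_sum//; last by move=> k; apply: measurable_sqr_EFin; exact: measurable_funM.
  apply: (@le_trans _ _ (\int[mu]_y ((3 * profile_bound R)%:E * (u y ^+ 2)%:E))%E).
    apply: ge0_le_integral => //.
    - by move=> y _; apply: sume_ge0.
    - by apply: emeasurable_sum => k; apply: measurable_sqr_EFin; exact: measurable_funM.
    - by apply: measurable_funeM; exact: measurable_sqr_EFin.
    - move=> y _; rewrite sumEFin -EFinM lee_fin; under eq_bigr do rewrite exprMn.
      by rewrite -mulr_suml ler_wpM2r ?sqr_ge0//; exact: sum_profile_le.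
  rewrite ge0_integralZl//; first exact: measurable_sqr_EFin.
  by rewrite lee_fin mulr_ge0//; have := profile_bound_ge4 R; lra.
apply: (@le_trans _ _ (2%:E * ((64 * mass_bound R d * e)%:E * N2 u) +
    (2 * (mass_bound R d * e))%:E * ((3 * profile_bound R)%:E * N2 u))%E).
  apply: leeD; first by rewrite lee_pmul2l.
  by apply: lee_wpmul2l => //; rewrite lee_fin mulr_ge0// mulr_ge0// ltW.
have [_ Nu] := L2u; have : N2 u \is a fin_num by rewrite ge0_fin_numE// N2_ge0.
move=> /fineK <-; rewrite -!EFinM -EFinD lee_fin /multiscale_const.
rewrite le_eqVlt; apply/orP; left; apply/eqP; ring.
Qed.
End multiscale.

(** * Summation by parts and duality *)

Section key_estimate.
Context dX (X : measurableType dX) (R : realType) (mu : {sigma_finite_measure set X -> \bar R}).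
Context (d : nat) (coord : X -> 'I_d -> R) (E : euclidean coord mu) (hd : (0 < d)%N).
Local Notation L1 := (L1 mu).
Local Notation L2 := (L2 mu).
Local Notation N2 := (N2 mu).
Local Notation L12 := (L12 mu).
Local Notation qb := (qb coord).
Local Notation shell := (shell coord).
Local Notation thin_shells := (thin_shells mu coord).

Lemma sqr_sum_disjoint (A : nat -> set X) (c : nat -> R) J n x : (forall i j, (i < j)%N -> ~ (A i x /\ A j x)) ->
  (\sum_(J <= k < n) \1_(A k) x * c k) ^+ 2 = \sum_(J <= k < n) (\1_(A k) x * c k) ^+ 2.
Proof.
move=> dA; elim: n => [|n IH]; first by rewrite !big_geq// expr0n.
have [nJ|Jn] := ltnP n J; first by rewrite !big_geq// expr0n.
rewrite !big_nat_recr//= sqrrD IH; congr (_ + _); rewrite -[RHS]addr0; congr (_ + _).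
have [An|nAn] := pselect (A n x); last by rewrite indicE memNset// mul0r mulr0 mul0rn.
rewrite big_nat big1 ?mul0r ?mul0rn// => k /andP[_ kn].
rewrite [\1_(A k) x]indicE memNset ?mul0r// => Ak; exact: (dA k n kn).
Qed.

Lemma N2_sum_disjoint (A : nat -> set X) (f : nat -> X -> R) J n :
  (forall i j x, (i < j)%N -> ~ (A i x /\ A j x)) -> (forall k, measurable (A k)) -> (forall k, measurable_fun setT (f k)) ->
  N2 (fun x => \sum_(J <= k < n) \1_(A k) x * f k x) = (\sum_(J <= k < n) N2 (fun x => \1_(A k) x * f k x)%R)%E.
Proof.
move=> dA mA mf; rewrite /Submission.N2 -ge0_integral_sum//; first last.
- by move=> k x _; rewrite lee_fin sqr_ge0.
- by move=> k; apply: measurable_sqr_EFin; apply: measurable_funM => //; exact: measurable_indic.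
by apply: eq_integral => x _; rewrite sumEFin sqr_sum_disjoint// => i j ij; exact: dA.
Qed.

Lemma L12_sum (I : Type) (s : seq I) (f : I -> X -> R) : (forall i, L12 (f i)) -> L12 (fun x => \sum_(i <- s) f i x).
Proof.
move=> Lf; elim: s => [|i s IH].
  under eq_fun do rewrite big_nil.
  split; first exact: integrable0.
  split => //; rewrite (_ : N2 _ = 0%E) ?ltry//.
  by rewrite -[RHS](@integral0 _ _ _ mu setT); apply: eq_integral => x _; rewrite expr0n.
under eq_fun do rewrite big_cons.
exact: L12D.
Qed.

Lemma Rintegral_sum (I : Type) (s : seq I) (f : I -> X -> R) : (forall i, L1 (f i)) ->
  \int[mu]_x (\sum_(i <- s) f i x) = \sum_(i <- s) \int[mu]_x f i x.
Proof.
move=> Lf; elim: s => [|i s IH].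
  by rewrite big_nil; apply: Rintegral_eq0 => x; rewrite big_nil.
under eq_Rintegral do rewrite big_cons.
have iS : L1 (fun x => \sum_(j <- s) f j x) by apply: L1_sum.
by rewrite big_cons RintegralD ?IH//; exact: Lf.
Qed.

Lemma indicB (A B : set X) x : A `<=` B -> \1_(B `\` A) x = \1_B x - \1_A x :> R.
Proof.
move=> AB; have [Bx|nBx] := pselect (B x); have [Ax|nAx] := pselect (A x); rewrite !indicE.
- by rewrite memNset ?mem_set// ?subrr// => -[].
- by rewrite mem_set// mem_set// memNset// subr0.
- by have := AB _ Ax.
- by rewrite !memNset ?subr0// => -[].
Qed.

Lemma indicI_mul (A B : set X) x : \1_(A `&` B) x = \1_A x * \1_B x :> R.
Proof. by rewrite indicI. Qed.

Lemma L12_qb K A k u : spectral mu coord K -> measurable A -> L12 u -> L12 (fun x => \1_(A `&` qb k) x * kop mu K u x).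
Proof.
move=> sK mA Lu; have LK := L2_spectral sK Lu.
have mAk : measurable (A `&` qb k) by apply: measurableI => //; exact: (measurable_qb E).
split; last exact: L2_indic_mul.
apply: L2_indic_L1 => //; apply: le_lt_trans (qb_finite E k).
apply: le_measure; rewrite ?inE//; exact: (measurable_qb E).
Qed.

Lemma L12_indic A u : measurable A -> L12 u -> L12 (fun x => \1_A x * u x).
Proof. by move=> mA [? ?]; split; [exact: L1_indic_mul|exact: L2_indic_mul]. Qed.

Section lower_part.
Context (K : X -> X -> R) (F G : set X) (e : R) (J n : nat) (u : X -> R).
Context (sK : spectral mu coord K).
Context (mF : measurable F) (mG : measurable G) (e0 : 0 < e) (tG : thin_shells G e J).
Context (Lu : L12 u) (Gu : forall x, ~ G x -> u x = 0).
Let mqb := measurable_qb E.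
Let mshell := measurable_shell E.

(** The part of the Abel sum whose input lies on [shell k] and whose output lies inside [qb k]; the
    thinness that fits the scale of the input is that of [G]. *)
Definition lower x := \sum_(J <= k < n) \1_(F `&` qb k) x * kop mu K (fun y => \1_(shell k) y * u y) x.

Let Lsu k : L12 (fun y => \1_(shell k) y * u y). Proof. exact: L12_indic. Qed.

Lemma lower_L12 : L12 lower.
Proof. by apply: L12_sum => k; exact: L12_qb. Qed.

Let lowerF x : \1_F x * lower x = lower x.
Proof.
rewrite /lower mulr_sumr; apply: eq_bigr => k _; rewrite mulrA indicI_mul mulrA -expr2.
by rewrite sqr_indic.
Qed.

(** The transpose of the operator [u -> lower], applied to [lower] itself and cut to [G]. *)
Let w x := \sum_(J <= k < n) \1_(G `&` shell k) x * kop mu K (fun y => \1_(qb k) y * lower y) x.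

Let Lql k : L12 (fun y => \1_(qb k) y * lower y).
Proof. by apply: L12_indic => //; exact: lower_L12. Qed.

Let LKl k := L2_spectral sK (Lql k).

Let mGs k : measurable (G `&` shell k). Proof. exact: measurableI. Qed.

Let N2w : (N2 w <= (multiscale_const R d * e)%:E * N2 lower)%E.
Proof.
rewrite N2_sum_disjoint//; first last.
- by move=> k; case: (LKl k).
- by move=> i j x ij [[_ a] [_ b]]; exact: (shell_disjoint ij (conj a b)).
apply: (multiscale_le E hd (D := qb)) => //; first exact: ltW.
- by move=> k; split => //; exact: subset_qb.
- exact: lower_L12.
Qed.

Let w_L2 : L2 w.
Proof.
split; last first.
  apply: le_lt_trans N2w _; have [_ [_ l]] := lower_L12.
  by rewrite lte_mul_pinfty// lee_fin mulr_ge0 ?ltW// (multiscale_const_gt0 R d).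
apply: measurable_sum => k; apply: measurable_funM; first exact: measurable_indic.
by case: (LKl k).
Qed.

(** Transpose [K] term by term. The support of [lower] in [F] removes the indicator of [F], and the
    vanishing of [u] off [G] allows that of [G] to be inserted. *)
Let lower_dual : \int[mu]_x (lower x ^+ 2) = \int[mu]_x (u x * w x).
Proof.
have ll := lower_L12; have bK := spectral_bounded sK; have L12L2 f : L12 f -> L2 f by case.
have L2lower := L12L2 _ ll.
under eq_Rintegral do rewrite expr2 {2}/lower mulr_sumr.
under [RHS]eq_Rintegral do rewrite mulr_sumr.
rewrite !Rintegral_sum; first last.
- by move=> k; apply: L2_mul_L1 => //; apply: L12L2; exact: L12_qb.
- move=> k; apply: L2_mul_L1; first exact: L12L2.
  by apply: L2_indic_mul.
apply: eq_bigr => k _.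
transitivity (\int[mu]_x ((\1_(qb k) x * lower x) * kop mu K (fun y => \1_(shell k) y * u y) x)).
  by apply: eq_Rintegral => x _; rewrite indicI_mul -[in RHS](lowerF x); ring.
rewrite (spectral_swap sK) ?(Lsu k).1 ?(Lql k).1//.
apply: eq_Rintegral => x _; rewrite indicI_mul.
have [Gx|/Gu ->] := pselect (G x); last by rewrite mulr0 !mul0r.
by rewrite [\1_G x]indicE mem_set// mul1r mulrA [u x * _]mulrC.
Qed.

(** [N2 lower] is the pairing of [u] with [w], and [w] is in turn controlled by [N2 lower]. With [l]
    the constant of [N2w], Young's inequality leaves [N2 lower / 2] on the right, to be absorbed on
    the left; this uses that [N2 lower] is finite, by [lower_L12]. *)
Lemma N2_lower_le : (N2 lower <= (multiscale_const R d * e)%:E * N2 u)%E.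
Proof.
have [_ Ll] := lower_L12; have [_ L2u] := Lu.
have l0 : 0 < multiscale_const R d * e by rewrite mulr_gt0// multiscale_const_gt0.
have := norm_Rintegral_mul_le L2u w_L2 l0; rewrite -lower_dual.
have := N2w; rewrite (N2E w_L2) (N2E Ll) (N2E L2u).
move: (multiscale_const R d * e) l0 => l l0; rewrite -!EFinM !lee_fin.
have i0 : 0 <= \int[mu]_x (lower x ^+ 2) by apply: Rintegral_ge0 => x _; exact: sqr_ge0.
rewrite (ger0_norm i0); move: (\int[mu]_x (lower x ^+ 2)) (\int[mu]_x (u x ^+ 2)) (\int[mu]_x (w x ^+ 2)) => a b c h1 h2.
have : (2 * l)^-1 * c <= a / 2.
  rewrite mulrC ler_pdivrMr ?mulr_gt0//; apply: (le_trans h1).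
  by rewrite le_eqVlt; apply/orP; left; apply/eqP; field.
lra.
Qed.
End lower_part.

(* Abel summation of [\1_(F `&` qb k) * K (\1_(qb k) u)] over the shells. *)
Lemma key_estimate K F G e J n u : spectral mu coord K -> measurable F -> measurable G -> 0 < e ->
  thin_shells F e J -> thin_shells G e J -> (J <= n)%N -> L12 u ->
  (forall x, ~ G x -> u x = 0) -> (forall x, ~ qb n x -> u x = 0) ->
  (N2 (fun x => \1_(F `&` qb n) x * kop mu K u x)%R <=
    (8 * multiscale_const R d * e)%:E * N2 u +
    2%:E * N2 (fun x => \1_(F `&` qb J) x * kop mu K (fun y => \1_(qb J) y * u y) x)%R)%E.
Proof.
move=> sK mF mG e0 tF tG Jn Lu Gu nu.
have mqb := measurable_qb E; have mshell := measurable_shell E.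
pose U k x := kop mu K (fun y => \1_(qb k) y * u y) x.
pose P x := \sum_(J <= k < n) \1_(F `&` shell k) x * U k.+1 x.
pose L := lower K F J n u.
pose r x := \1_(F `&` qb J) x * U J x.
have Lq k : L12 (fun y => \1_(qb k) y * u y) by exact: L12_indic.
have LU k := L2_spectral sK (Lq k).
have mFs k : measurable (F `&` shell k) by exact: measurableI.
have decomp : (fun x => \1_(F `&` qb n) x * kop mu K u x) = fun x => (P x + L x) + r x.
  apply/funext => x.
  have -> : kop mu K u x = U n x.
    congr kop; apply/funext => y; have [ny|/nu ->] := pselect (qb n y); last by rewrite mulr0.
    by rewrite indicE mem_set// mul1r.
  apply/eqP; rewrite -subr_eq; apply/eqP.
  (* Each increment is [1_(shell k) * U (k+1)] plus [1_(qb k) * (U (k+1) - U k)], both cut to [F]: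
     the terms of [P] and of [lower]. *)
  rewrite -(telescope_sumr (fun k => \1_(F `&` qb k) x * U k x) Jn) -big_split /=.
  apply: eq_bigr => k _.
  have sub : qb k `<=` qb k.+1 by exact: subset_qb.
  have -> : kop mu K (fun y => \1_(shell k) y * u y) x = U k.+1 x - U k x.
    rewrite /U -kopB; [|exact: (spectral_bounded sK)|by have [] := Lq k.+1|by have [] := Lq k].
    by congr kop; apply/funext => y; rewrite (indicB _ sub) mulrBl.
  have sh : \1_(shell k) x = \1_(qb k.+1) x - \1_(qb k) x :> R by exact: indicB.
  by rewrite (indicI_mul F (shell k)) sh (indicI_mul F (qb k.+1)) (indicI_mul F (qb k)); ring.
rewrite decomp.
have m2 (f : X -> R) : L2 f -> measurable_fun setT f by case.
have mL : measurable_fun setT L by apply: m2; have [] := lower_L12 J n sK mF Lu.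
have mr : measurable_fun setT r.
  by apply: measurable_funM; [apply: measurable_indic; exact: measurableI|exact: (m2 _ (LU J))].
have mP : measurable_fun setT P.
  by apply: measurable_sum => k; apply: measurable_funM; [exact: measurable_indic|exact: (m2 _ (LU k.+1))].
apply: (le_trans (N2D_le mu (measurable_funD mP mL) mr)); apply: leeD => //.
have NP : (N2 P <= (multiscale_const R d * e)%:E * N2 u)%E.
  rewrite N2_sum_disjoint//; first last.
  - by move=> k; exact: (m2 _ (LU k.+1)).
  - by move=> i j x ij [[_ a] [_ b]]; exact: (shell_disjoint ij (conj a b)).
  (* This cutoff and [D = qb] in [N2w] are the two extreme choices that [multiscale_le] allows. *)
  apply: (multiscale_le E hd (D := fun k => qb k.+1)) => //; first exact: ltW.
  by move=> k; split => //; exact: subset_qb.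
have NL := N2_lower_le n sK mF mG e0 tG Lu Gu.
rewrite -/L in NL; move: (multiscale_const R d) NP NL => c NP NL.
apply: (@le_trans _ _ (2%:E * (2%:E * ((c * e)%:E * N2 u) + 2%:E * ((c * e)%:E * N2 u)))%E).
  apply: lee_wpmul2l => //; apply: (le_trans (N2D_le mu mP mL)).
  have twice (a b t : \bar R) : (a <= t -> b <= t -> 2%:E * a + 2%:E * b <= 2%:E * t + 2%:E * t)%E.
    by move=> ? ?; apply: leeD; apply: lee_wpmul2l.
  exact: (twice _ _ _ NP NL).
have /fineK <- : N2 u \is a fin_num by rewrite ge0_fin_numE ?N2_ge0//; have [_ []] := Lu.
by move: (fine _) => t; rewrite -!EFinM lee_fin; lra.
Qed.
End key_estimate.

(** * Extraction of subsequences *)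

Section diagonal.
Context (R : realType).

Definition cauchy_num (a : nat -> R) := forall e : R, 0 < e ->
  exists N, forall m n, (N <= m)%N -> (N <= n)%N -> `|a m - a n| <= e.

Lemma cvg_cauchy_num (a : nat -> R) : cvgn a -> cauchy_num a.
Proof.
move=> ca e e0; have e2 : 0 < e / 2 by rewrite divr_gt0.
have /cvgrPdist_le /(_ _ e2)[N _ hN] := ca; exists N => m n Nm Nn.
have := hN _ Nm; have := hN _ Nn; rewrite /= => hn hm.
have -> : a m - a n = (limn a - a n) - (limn a - a m) by ring.
by rewrite [e]splitr; apply: le_trans (ler_normB _ _) _; apply: lerD.
Qed.

Lemma cauchy_num_cvg (a : nat -> R) : cauchy_num a -> cvgn a.
Proof.
move=> ca; apply/cauchy_cvgP/cauchy_exP => e e0.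
have e2 : 0 < e / 2 by rewrite divr_gt0.
have [N hN] := ca _ e2; exists (a N); exists N => // n /= Nn.
rewrite /ball /=; apply: le_lt_trans (hN N n (leqnn _) Nn) _; rewrite gtr_pMr//; lra.
Qed.

Lemma homo_ltn_ge (f : nat -> nat) : {homo f : m n / (m < n)%N} -> forall n, (n <= f n)%N.
Proof. by move=> hf; elim=> // n IH; apply: leq_ltn_trans IH (hf _ _ (ltnSn n)). Qed.

Lemma cauchy_subsequence (a : nat -> R) (c : R) : (forall n, `|a n| <= c) ->
  exists f, {homo f : m n / (m < n)%N} /\ cauchy_num (fun n => a (f n)).
Proof.
move=> ac; have [|f fi cf] := @bolzano_weierstrass R a.
  exists c; split; first exact: num_real.
  by move=> x cx n _; apply: le_trans (ac n) (ltW cx).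
exists f; split; last exact: cvg_cauchy_num.
by move=> m n; rewrite !ltnNge -!leEnat fi.
Qed.

(** [K i.+1] refines [K i] so that row [i] becomes Cauchy. For [n > i] the diagonal index [K n n]
    is, by [tail], a value of [K i.+1] at an argument at least [n], so the diagonal inherits the
    Cauchy property of each row. *)
Lemma diagonal_subsequence (a : nat -> nat -> R) (c : nat -> R) : (forall i n, `|a i n| <= c i) ->
  exists f, {homo f : m n / (m < n)%N} /\ forall i, cauchy_num (fun n => a i (f n)).
Proof.
move=> ac.
have step (p : (nat -> nat) * nat) : exists f, {homo f : m n / (m < n)%N} /\ cauchy_num (fun n => a p.2 (p.1 (f n))).
  by apply: (@cauchy_subsequence (fun n => a p.2 (p.1 n)) (c p.2)) => n.
have [s hs] := choice step.
pose K := fix K i := if i is j.+1 then K j \o s (K j, j) else id.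
have hK i : {homo K i : m n / (m < n)%N}.
  by elim: i => // i IH m n mn /=; apply: IH; apply: (hs (K i, i)).1.
have tail i j : (i <= j)%N -> exists t, (forall n, (n <= t n)%N) /\ forall n, K j n = K i (t n).
  move=> ij; rewrite -(subnKC ij); elim: (j - i)%N => [|m [t [t1 t2]]].
    by exists id; split => // n; rewrite addn0.
  rewrite addnS /=; exists (t \o s (K (i + m)%N, (i + m)%N)); split => n /=; last exact: t2.
  by apply: leq_trans (t1 _); apply: homo_ltn_ge; exact: (hs _).1.
exists (fun n => K n n); split.
  move=> m n; elim: n => // n IH; rewrite ltnS leq_eqVlt => mn.
  have lt : (K n n < K n.+1 n.+1)%N.
    by rewrite /=; apply: hK; apply: leq_trans (homo_ltn_ge (hs (K n, n)).1 n.+1).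
  by case/predU1P: mn => [->//|/IH h]; exact: ltn_trans lt.
move=> i e e0; have [N hN] := (hs (K i, i)).2 e e0.
exists (maxn N i.+1) => m n; rewrite !geq_max => /andP[Nm im] /andP[Nn jn].
have [t [t1 t2]] := tail i.+1 m im; have [r [r1 r2]] := tail i.+1 n jn.
by rewrite t2 r2 /=; apply: hN; [exact: leq_trans (t1 _)|exact: leq_trans (r1 _)].
Qed.

Lemma diagonal_subsequence_count (I : countType) (a : I -> nat -> R) (c : I -> R) : (forall i n, `|a i n| <= c i) ->
  exists f, {homo f : m n / (m < n)%N} /\ forall i, cauchy_num (fun n => a i (f n)).
Proof.
move=> ac; pose b j n := if unpickle j is Some i then a i n else 0.
pose cb j := if unpickle j is Some i then c i else 0.
have [|f [f1 f2]] := @diagonal_subsequence b cb.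
  by move=> j n; rewrite /b /cb; case: unpickle => [i|]; rewrite ?normr0.
by exists f; split => // i; have := f2 (pickle i); rewrite /b pickleK.
Qed.
End diagonal.

(** * Lipschitz bounds for cosine and sine *)

Section lipschitz.
Context (R : realType).

Lemma norm_lipschitz1 (f df : R -> R) (a b : R) : (forall x : R, is_derive x (1 : R) f (df x)) ->
  (forall x, `|df x| <= 1) -> `|f a - f b| <= `|a - b|.
Proof.
move=> fd d1; wlog ab : a b / b <= a => [h|].
  by have [/h//|/ltW/h] := leP b a; rewrite distrC [X in _ <= X]distrC.
have der x : x \in `]b, a[%R -> is_derive x (1 : R) f (df x) by move=> _; exact: fd.
have cont : {within `[b, a], continuous f}.
  apply: continuous_subspaceT => x.
  by apply/differentiable_continuous/derivable1_diffP; exact: (@ex_derive _ _ _ _ _ _ _ (fd x)).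
have [c _ ->] := MVT_segment ab der cont.
by rewrite normrM ler_piMl.
Qed.

Lemma cos_lipschitz (a b : R) : `|cos a - cos b| <= `|a - b|.
Proof.
by apply: (@norm_lipschitz1 cos (fun x => - sin x)) => x; rewrite normrN; exact: sin_max.
Qed.

Lemma sin_lipschitz (a b : R) : `|sin a - sin b| <= `|a - b|.
Proof. by apply: (@norm_lipschitz1 sin cos) => x; exact: cos_max. Qed.
End lipschitz.

(** * Equicontinuity and compactness of the localized transform *)

Section equicontinuity.
Context dX (X : measurableType dX) (R : realType) (mu : {sigma_finite_measure set X -> \bar R}).
Context (d : nat) (coord : X -> 'I_d -> R) (E : euclidean coord mu).
Local Notation L1 := (L1 mu).
Local Notation L2 := (L2 mu).
Local Notation N2 := (N2 mu).
Local Notation L12 := (L12 mu).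
Local Notation qb := (qb coord).
Local Notation dot := (dot coord).

Record oscillatory (K : X -> X -> R) : Prop := Oscillatory {
  oscillatory_spectral : spectral mu coord K ;
  oscillatory_le1 : forall x y, `|K x y| <= 1 ;
  oscillatory_lipschitz : forall x p y, `|K x y - K p y| <= 2 * pi * `|dot x y - dot p y| }.

Lemma oscillatory_kcos : oscillatory (kcos coord).
Proof.
split; [exact: (spectral_kcos E)|exact: norm_kcos_le1|move=> x p y].
apply: (le_trans (cos_lipschitz _ _)).
by rewrite -mulrBr normrM ger0_norm// mulr_ge0// pi_ge0.
Qed.

Lemma oscillatory_ksin : oscillatory (ksin coord).
Proof.
split; [exact: (spectral_ksin E)|exact: norm_ksin_le1|move=> x p y].
apply: (le_trans (sin_lipschitz _ _)).
by rewrite -mulrBr normrM ger0_norm// mulr_ge0// pi_ge0.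
Qed.

Lemma norm_coord_qb J y i : qb J y -> `|coord y i| <= 2 ^+ J.
Proof.
move=> yJ; rewrite -(@ler_sqr _ _ (2 ^+ J)) ?nnegrE ?exprn_ge0// real_normK ?num_real//.
rewrite sqr_exp2; apply: le_trans (ltW yJ).
by rewrite /Submission.sqnorm (bigD1 i)//= lerDl; apply: sumr_ge0 => j _; exact: sqr_ge0.
Qed.

Lemma norm_dotB_le J x p y (e : R) : qb J y -> 0 <= e -> (forall i, `|coord x i - coord p i| <= e) ->
  `|dot x y - dot p y| <= d%:R * (e * 2 ^+ J).
Proof.
move=> yJ e0 xp; rewrite -sumrB; apply: (le_trans (ler_norm_sum _ _ _)).
rewrite mulr_natl -[X in _ *+ X](card_ord d) -sumr_const; apply: ler_sum => i _.
by rewrite -mulrBl normrM ler_pM//; exact: norm_coord_qb.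
Qed.

Lemma L12_localized J u : L2 u -> L12 (fun y => \1_(qb J) y * u y).
Proof.
move=> Lu; have mq := measurable_qb E J.
by split; [apply: L2_indic_L1 => //; exact: (qb_finite E)|exact: L2_indic_mul].
Qed.

(** From [|1_q u| <= 1_q + u^2]: an [L1] bound that is uniform over [N2 u <= M]. *)
Definition local_bound J (M : R) : R := fine (mu (qb J)) + M.

Lemma localized_L1_le J (M : R) u : L2 u -> (N2 u <= M%:E)%E ->
  \int[mu]_y `|\1_(qb J) y * u y| <= local_bound J M.
Proof.
move=> Lu uM; have mq := measurable_qb E J; have [iu _] := L12_localized J Lu.
have iq : L1 \1_(qb J) by apply: L1_indic => //; exact: (qb_finite E).
have /L2_sqr_L1[_ iu2] := Lu.
apply: (@le_trans _ _ (\int[mu]_y (\1_(qb J) y + u y ^+ 2))).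
  apply: le_Rintegral => //; first exact: integrable_norm.
    exact: L1D.
  move=> y _; rewrite normrM; have [qy|nqy] := pselect (qb J y); last first.
    by rewrite indicE memNset// normr0 mul0r add0r sqr_ge0.
  rewrite indicE mem_set//= mulr1n normr1 mul1r -[u y ^+ 2]real_normK ?num_real//.
  by have := normr_ge0 (u y); nra.
rewrite RintegralD//; apply: lerD; last by rewrite -lee_fin -N2E.
by rewrite /Rintegral -(N2_indic mu mq); under [X in _ <= fine X]eq_integral do rewrite sqr_indic.
Qed.

(** The Lipschitz constant of the phase in its first variable grows with [|y|]. Inserting the
    indicator of [qb J] into the difference kernel [k] bounds it, and [kop_bound] applies. *)
Lemma kop_equicontinuous K J u x p (e : R) : oscillatory K -> L2 u -> 0 <= e ->
  (forall i, `|coord x i - coord p i| <= e) ->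
  `|kop mu K (fun y => \1_(qb J) y * u y) x - kop mu K (fun y => \1_(qb J) y * u y) p| <=
   2 * pi * (d%:R * (e * 2 ^+ J)) * \int[mu]_y `|\1_(qb J) y * u y|.
Proof.
move=> [sK K1 KL] Lu e0 xp; have bK := spectral_bounded sK.
have [iu _] := L12_localized J Lu; have mq := measurable_qb E J.
pose k (z y : X) := \1_(qb J) y * (K x y - K p y).
have mk : measurable_fun setT (fun y => \1_(qb J) y * (K x y - K p y)).
  apply: measurable_funM; first exact: measurable_indic.
  by apply: measurable_funB; exact: (kernel_section_measurable _ bK).
have kle z y : `|k z y| <= 2 * pi * (d%:R * (e * 2 ^+ J)).
  have c0 : 0 <= 2 * pi * (d%:R * (e * 2 ^+ J)) :> R.
    by rewrite !mulr_ge0 ?pi_ge0 ?exprn_ge0.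
  rewrite /k; have [qy|nqy] := pselect (qb J y); last by rewrite indicE memNset// mul0r normr0.
  rewrite indicE mem_set// mul1r; apply: (le_trans (KL x p y)).
  by rewrite ler_wpM2l ?mulr_ge0 ?pi_ge0//; exact: norm_dotB_le.
have bk : bounded_kernel k.
  by split; [exact: (measurableT_comp mk measurable_snd)|exists (2 * pi * (d%:R * (e * 2 ^+ J)))].
suff -> : kop mu K (fun y => \1_(qb J) y * u y) x - kop mu K (fun y => \1_(qb J) y * u y) p =
   kop mu k (fun y => \1_(qb J) y * u y) x by exact: kop_bound.
rewrite /Submission.kop -RintegralB//; [|exact: (kernel_L1 _ bK)|exact: (kernel_L1 _ bK)].
apply: eq_Rintegral => y _; rewrite /k; have [qy|nqy] := pselect (qb J y).
  by rewrite indicE mem_set//= mulr1n; ring.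
by rewrite indicE memNset//= mulr0n; ring.
Qed.

(** Some point of the cell of side [1 / (m+1)] with integer label [z]; [org] is the default for an
    empty cell. Integer labels keep the family countable. *)
Definition grid_point (org : X) m (z : {ffun 'I_d -> int}) : X :=
  xget org [set x | forall i, Num.floor (m.+1%:R * coord x i) = z i].

Lemma grid_pointP org m x : exists z, forall i, `|coord x i - coord (grid_point org m z) i| <= m.+1%:R^-1.
Proof.
exists [ffun i => Num.floor (m.+1%:R * coord x i)] => i.
rewrite /grid_point; case: xgetP => [p _ /= hp|/(_ x) []]; last by move=> j /=; rewrite ffunE.
have m0 : 0 < m.+1%:R :> R by rewrite ltr0n.
rewrite -(ler_pM2l m0) mulfV ?gt_eqF// -(ger0_norm (ltW m0)) -normrM mulrBr.
have := hp i; rewrite ffunE; set a := m.+1%:R * coord x i; set b := m.+1%:R * coord p i => hab.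
have := floor_itv a; have := floor_itv b; rewrite hab intrD => /andP[b1 b2] /andP[a1 a2].
by rewrite ler_norml; apply/andP; split; lra.
Qed.

(** An Arzela-Ascoli argument: a diagonal subsequence makes the bounded values at the countably many
    grid points Cauchy, and equicontinuity extends this to every [x]. One subsequence serves both
    kernels, both components and all [J], because [J] is chosen later in terms of [e]. *)
Lemma localized_subsequence (h : bool -> nat -> X -> R) (M : R) : (forall b n, L2 (h b n)) ->
  (forall b n, (N2 (h b n) <= M%:E)%E) ->
  exists f, {homo f : m n / (m < n)%N} /\ forall K, K = kcos coord \/ K = ksin coord ->
    forall b J x, cauchy_num (fun n => kop mu K (fun y => \1_(qb J) y * h b (f n) y) x).
Proof.
move=> Lh hM; have [org _] := euclidean_origin E.
pose ker (s : bool) := if s then kcos coord else ksin coord.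
have osc s : oscillatory (ker s) by case: s; [exact: oscillatory_kcos|exact: oscillatory_ksin].
pose T : countType := (bool * bool * nat * nat * {ffun 'I_d -> int})%type.
pose a (i : T) n := let: (s, b, J, m, z) := i in
  kop mu (ker s) (fun y => \1_(qb J) y * h b n y) (grid_point org m z).
pose c (i : T) := let: (s, b, J, m, z) := i in local_bound J M.
have [|f [f1 f2]] := @diagonal_subsequence_count R T a c.
  move=> [[[[s b] J] m] z] n /=; apply: le_trans (localized_L1_le J (Lh b n) (hM b n)).
  have [sK K1 _] := osc s; rewrite -[leRHS]mul1r; apply: kop_bound => //; first exact: spectral_bounded sK.
  by have [] := L12_localized J (Lh b n).
exists f; split => // K hK b J x e e0.
have [s ->] : exists s, K = ker s by case: hK => ->; [exists true|exists false].
pose B := 2 * pi * (d%:R * 2 ^+ J) * local_bound J M.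
have B0 : 0 <= B.
  rewrite !mulr_ge0 ?pi_ge0 ?exprn_ge0//.
  by apply: le_trans (localized_L1_le J (Lh true 0%N) (hM true 0%N)); apply: Rintegral_ge0.
(* [B / m.+1] bounds the variation between [x] and the grid point of its cell, uniformly in [n]. *)
have [m hm] : exists m : nat, B / m.+1%:R <= e / 4.
  exists (Num.truncn (4 * B / e)); rewrite ler_pdivrMr ?ltr0n//.
  have := truncnS_gt (4 * B / e); rewrite ltr_pdivrMr//.
  by clear B0; move: B ((Num.truncn _).+1%:R) => b' t; lra.
have [z hz] := grid_pointP org m x.
have e2 : 0 < e / 2 by rewrite divr_gt0.
have [N hN] := f2 ((s, b, J, m, z) : T) _ e2.
have close n : `|kop mu (ker s) (fun y => \1_(qb J) y * h b n y) x - a (s, b, J, m, z) n| <= e / 4.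
  apply: le_trans hm; have m0 : 0 <= m.+1%:R^-1 :> R by rewrite invr_ge0.
  apply: (le_trans (kop_equicontinuous J (osc s) (Lh b n) m0 hz)).
  apply: (@le_trans _ _ (2 * pi * (d%:R * (m.+1%:R^-1 * 2 ^+ J)) * local_bound J M)).
    by rewrite ler_wpM2l ?localized_L1_le// !mulr_ge0 ?pi_ge0 ?exprn_ge0.
  by rewrite le_eqVlt /B; apply/orP; left; apply/eqP; ring.
exists N => p q Np Nq; have := hN p q Np Nq; have := close (f p); have := close (f q).
move: (kop _ _ _ _) (kop _ _ _ _) (a _ _) (a _ _) => A1 A2 A3 A4.
by rewrite !ler_norml => /andP[? ?] /andP[? ?] /andP[? ?]; apply/andP; split; lra.
Qed.

(** The functions are bounded by [local_bound] on a set of finite measure, so pointwise convergence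
    is dominated and holds in [L2]. *)
Lemma localized_cauchy (A : set X) K J (h : nat -> X -> R) (M : R) : oscillatory K -> measurable A -> (forall n, L2 (h n)) ->
  (forall n, (N2 (h n) <= M%:E)%E) ->
  (forall x, cauchy_num (fun n => kop mu K (fun y => \1_(qb J) y * h n y) x)) ->
  cauchyN2 mu (fun n x => \1_(A `&` qb J) x * kop mu K (fun y => \1_(qb J) y * h n y) x).
Proof.
move=> osc mA Lh hM ck; have [sK K1 _] := osc.
have mAq : measurable (A `&` qb J) by apply: measurableI => //; exact: (measurable_qb E).
pose g n x := kop mu K (fun y => \1_(qb J) y * h n y) x.
pose l x := limn (fun n => g n x).
have gl x : g n x @[n --> \oo] --> l x by apply: cauchy_num_cvg; exact: ck.
have gb n x : `|g n x| <= local_bound J M.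
  apply: le_trans (localized_L1_le J (Lh n) (hM n)).
  rewrite -[leRHS]mul1r; apply: kop_bound => //; first exact: spectral_bounded sK.
  by have [] := L12_localized J (Lh n).
have lb x : `|l x| <= local_bound J M.
  have c : `|g n x| @[n --> \oo] --> `|l x| by exact: cvg_norm (gl x).
  rewrite -(cvg_lim _ c)//; apply: limr_le; first by apply/cvg_ex; eexists; exact: c.
  by apply: nearW => n.
have mg n : measurable_fun setT (g n).
  by have [] := L2_spectral sK (L12_localized J (Lh n)).
have ml : measurable_fun setT l by apply: (@measurable_fun_cvg _ _ _ _ g) => // x _.
have mi : measurable_fun setT (fun x : X => \1_(A `&` qb J) x : R) by exact: measurable_indic.
have Li : L2 (\1_(A `&` qb J)).
  apply: L2_indic => //; apply: le_lt_trans (qb_finite E J).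
  by apply: le_measure; rewrite ?inE//; exact: (measurable_qb E).
have Ll : L2 (fun x => \1_(A `&` qb J) x * l x).
  rewrite (_ : (fun x => _) = (fun x => l x * \1_(A `&` qb J) x)); last by apply/funext => x; rewrite mulrC.
  exact: (L2_bounded_mul (c := local_bound J M)).
have Lg n : L2 (fun x => \1_(A `&` qb J) x * g n x).
  by apply: L2_indic_mul => //; exact: (L2_spectral sK (L12_localized J (Lh n))).
apply: (cvg_cauchyN2 Lg Ll).
apply: (cvg_N2_dominated (g := fun x => 2 * local_bound J M * \1_(A `&` qb J) x)).
- by move=> n; exact: measurable_funM.
- exact: measurable_funM.
- exact: L2Z.
- by move=> x; apply: cvgM; [exact: cvg_cst|exact: gl].
- move=> n x; rewrite -mulrBr !normrM [leRHS]mulrC ler_wpM2l//.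
  apply: (le_trans (ler_normB _ _)); have := gb n x; have := lb x; have := ler_norm (local_bound J M).
  by rewrite (ger0_norm (ler0n _ 2)); lra.
Qed.
End equicontinuity.

(** * Compactness of the transform restricted to thin sets *)

Section restricted_compactness.
Context dX (X : measurableType dX) (R : realType) (mu : {sigma_finite_measure set X -> \bar R}).
Context (d : nat) (coord : X -> 'I_d -> R) (E : euclidean coord mu) (hd : (0 < d)%N).
Local Notation L1 := (L1 mu).
Local Notation L2 := (L2 mu).
Local Notation N2 := (N2 mu).
Local Notation L12 := (L12 mu).
Local Notation qb := (qb coord).
Local Notation Co := (kop mu (kcos coord)).
Local Notation Si := (kop mu (ksin coord)).
Local Notation thin_shells := (thin_shells mu coord).
Local Notation fourier_pair := (fourier_pair mu coord).

Lemma qb_cover x : \forall n \near \oo, qb n x.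
Proof.
exists (Num.truncn (sqnorm coord x)).+1 => // n /= hn; rewrite /Submission.qb /=.
apply: (lt_le_trans (truncnS_gt _)); apply: (@le_trans _ _ n%:R); first by rewrite ler_nat.
by rewrite -natrX ler_nat ltnW// ltn_expl.
Qed.

Lemma N2D4_le (a b c e : X -> R) (ra rb rc re : R) : measurable_fun setT a -> measurable_fun setT b ->
  measurable_fun setT c -> measurable_fun setT e ->
  (N2 a <= ra%:E)%E -> (N2 b <= rb%:E)%E -> (N2 c <= rc%:E)%E -> (N2 e <= re%:E)%E ->
  (N2 (fun x => a x + (b x + (c x + e x)))%R <= (2 * ra + (4 * rb + (8 * rc + 8 * re)))%:E)%E.
Proof.
move=> ma mb mc me na nb nc ne.
have step (f g : X -> R) (p q : R) : measurable_fun setT f -> measurable_fun setT g -> (N2 f <= p%:E)%E -> (N2 g <= q%:E)%E ->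
    (N2 (fun x => f x + g x)%R <= (2 * p + 2 * q)%:E)%E.
  move=> mf mg fp gq; apply: (le_trans (N2D_le mu mf mg)); rewrite (EFinD (2 * p)) (EFinM 2 p) (EFinM 2 q).
  by apply: leeD; apply: lee_wpmul2l.
have mce := measurable_funD mc me; have mbce := measurable_funD mb mce.
apply: (le_trans (step _ _ _ _ ma mbce na (step _ _ _ _ mb mce nb (step _ _ _ _ mc me nc ne)))).
by rewrite lee_fin; lra.
Qed.

Definition local_energy (F : set X) K J u : \bar R :=
  N2 (fun x => \1_(F `&` qb J) x * kop mu K (fun y => \1_(qb J) y * u y) x).

Lemma local_energy_L2 F K J u : spectral mu coord K -> measurable F -> L2 u ->
  L2 (fun x => \1_(F `&` qb J) x * kop mu K (fun y => \1_(qb J) y * u y) x).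
Proof.
move=> sK mF Lu; apply: L2_indic_mul; first by apply: measurableI => //; exact: (measurable_qb E).
exact: (L2_spectral sK (L12_localized E J Lu)).
Qed.

(** Truncation to [qb n] provides the integrability and the support that [key_estimate] requires,
    while neither its constant nor the local term depends on [n]. *)
Lemma truncated_estimate K F G (e : R) J n u : spectral mu coord K -> measurable F -> measurable G -> 0 < e ->
  thin_shells F e J -> thin_shells G e J -> (J <= n)%N -> L2 u -> (forall x, ~ G x -> u x = 0) ->
  (N2 (fun x => \1_(F `&` qb n) x * kop mu K (fun y => \1_(qb n) y * u y) x)%R <=
    (8 * multiscale_const R d * e)%:E * N2 u + 2%:E * local_energy F K J u)%E.
Proof.
move=> sK mF mG e0 tF tG Jn Lu Gu; have Ln := L12_localized E n Lu.
apply: (le_trans (key_estimate E hd sK mF mG e0 tF tG Jn Ln _ _)).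
- by move=> x /Gu ->; rewrite mulr0.
- by move=> x nx; rewrite indicE memNset// mul0r.
apply: leeD.
  have C0 := ltW (multiscale_const_gt0 R d).
  apply: lee_wpmul2l; first by rewrite lee_fin; apply: mulr_ge0 (ltW e0); exact: mulr_ge0.
  apply: le_N2; [by have [_ []] := Ln|by case: Lu|move=> x].
  by rewrite normrM ler_piMl//; exact: norm_indic_le1.
rewrite /local_energy (_ : (fun y => \1_(qb J) y * (\1_(qb n) y * u y)) = (fun y => \1_(qb J) y * u y))//.
apply/funext => y; have [qy|nqy] := pselect (qb J y); last by rewrite indicE memNset// !mul0r.
by rewrite [\1_(qb n) y]indicE mem_set ?mul1r//; exact: subset_qb qy.
Qed.

(** On truncated inputs the transform is given by the integrals [Co] and [Si], to which
    [truncated_estimate] applies. The isometry controls the error made by truncating. *)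
Lemma restricted_transform_le F G (e : R) J u v g1 g2 : measurable F -> measurable G -> 0 < e ->
  thin_shells F e J -> thin_shells G e J -> fourier_pair u v g1 g2 ->
  (forall x, ~ G x -> u x = 0) -> (forall x, ~ G x -> v x = 0) ->
  (N2 (fun x => \1_F x * g1 x)%R <= (64 * multiscale_const R d * e)%:E * (N2 u + N2 v) +
     16%:E * (local_energy F (kcos coord) J u + local_energy F (ksin coord) J v))%E.
Proof.
move=> mF mG e0 tF tG uvg Gu Gv; have [[Lu Lv] [Lg1 _] _] := uvg.
have sc := spectral_kcos E; have ss := spectral_ksin E.
have mq := measurable_qb E.
have fN (f : X -> R) : L2 f -> N2 f \is a fin_num by move=> [_ ?]; rewrite ge0_fin_numE// N2_ge0.
(* With the weights of [N2D4_le] the two truncation errors add up to [2 * (t / 12) + 4 * (t / 6)],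
   which is below [t]. *)
apply/lee_addgt0Pr => t t0; have t12 : 0 < t / 12 by rewrite divr_gt0.
have cut (f : X -> R) : L2 f -> \forall n \near \oo, (N2 (fun x => f x - \1_(qb n) x * f x)%R <= (t / 12)%:E)%E.
  move=> Lf; have /ecvg0P h := cvg_N2_truncate mq qb_cover Lf.
  by apply: h => // n; exact: N2_ge0.
have [n [Jn un vn gn]] : exists n, [/\ (J <= n)%N, (N2 (fun x => u x - \1_(qb n) x * u x)%R <= (t / 12)%:E)%E,
    (N2 (fun x => v x - \1_(qb n) x * v x)%R <= (t / 12)%:E)%E &
    (N2 (fun x => g1 x - \1_(qb n) x * g1 x)%R <= (t / 12)%:E)%E].
  by near \oo => n; exists n; split; near: n; [exact: nbhs_infty_ge|exact: cut..].
have Lun := L12_localized E n Lu; have Lvn := L12_localized E n Lv.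
pose un' y := \1_(qb n) y * u y; pose vn' y := \1_(qb n) y * v y.
have := fourier_pair_ext E uvg (fourier_pair_L12 E Lun Lvn).
rewrite -/un' -/vn'; set P := F1 mu coord un' vn' => iso.
have hb : (N2 (fun x => g1 x - P x)%R <= (t / 6)%:E)%E.
  apply: (@le_trans _ _ ((t / 12)%:E + (t / 12)%:E)%E); last by rewrite -EFinD lee_fin; lra.
  by apply: le_trans (leeD un vn); rewrite -iso leeDl// N2_ge0.
have mi A : measurable A -> measurable_fun setT (fun x : X => \1_A x : R) by move=> mA; exact: measurable_indic.
have mFn : measurable (F `&` qb n) by exact: measurableI.
have mg1 : measurable_fun setT g1 by case: Lg1.
have LCo := L2_spectral sc Lun; have LSi := L2_spectral ss Lvn.
have mP : measurable_fun setT P by have [] := F1_L2 E Lun Lvn.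
have -> : (fun x => \1_F x * g1 x) = fun x => \1_F x * (g1 x - \1_(qb n) x * g1 x) +
   (\1_(F `&` qb n) x * (g1 x - P x) + (\1_(F `&` qb n) x * Co un' x + \1_(F `&` qb n) x * Si vn' x)).
  by apply/funext => x; rewrite /P /F1 (indicI_mul _ F (qb n)); ring.
have ha : (N2 (fun x => \1_F x * (g1 x - \1_(qb n) x * g1 x))%R <= (t / 12)%:E)%E.
  apply: le_trans gn; have m : measurable_fun setT (fun x => g1 x - \1_(qb n) x * g1 x).
    by apply: measurable_funB => //; apply: measurable_funM => //; exact: mi.
  apply: le_N2 => //; first by apply: measurable_funM => //; exact: mi.
  by move=> x; rewrite normrM ler_piMl//; exact: norm_indic_le1.
have hb' : (N2 (fun x => \1_(F `&` qb n) x * (g1 x - P x))%R <= (t / 6)%:E)%E.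
  apply: le_trans hb; have m : measurable_fun setT (fun x => g1 x - P x) by exact: measurable_funB.
  apply: le_N2 => //; first by apply: measurable_funM => //; exact: mi.
  by move=> x; rewrite normrM ler_piMl//; exact: norm_indic_le1.
have hc := truncated_estimate sc mF mG e0 tF tG Jn Lu Gu; rewrite -/un' in hc.
have hs := truncated_estimate ss mF mG e0 tF tG Jn Lv Gv; rewrite -/vn' in hs.
have mCo : measurable_fun setT (Co un') by case: LCo.
have mSi : measurable_fun setT (Si vn') by case: LSi.
have : local_energy F (kcos coord) J u \is a fin_num by apply: fN; exact: local_energy_L2.
have : local_energy F (ksin coord) J v \is a fin_num by apply: fN; exact: local_energy_L2.
have := fN _ Lu; have := fN _ Lv.
move: hc hs; move: (local_energy _ _ _ _) (local_energy _ _ _ _) (multiscale_const R d) => lc ls C.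
case: (N2 u) => [nu||//] //; case: (N2 v) => [nv||//] //; case: lc => [lc||//] //; case: ls => [ls||//] //.
rewrite -!EFinM -!EFinD => hc hs _ _ _ _.
apply: (le_trans (N2D4_le _ _ _ _ ha hb' hc hs)).
- apply: measurable_funM; first exact: mi.
  by apply: measurable_funB => //; apply: measurable_funM => //; exact: mi.
- by apply: measurable_funM; [exact: mi|exact: measurable_funB].
- by apply: measurable_funM => //; exact: mi.
- by apply: measurable_funM => //; exact: mi.
- by rewrite lee_fin; lra.
Unshelve. all: by end_near.
Qed.

(** Multiplying by [- i] makes the imaginary part [g2] a real part. *)
Lemma restricted_transform_le2 F G (e : R) J u v g1 g2 : measurable F -> measurable G -> 0 < e ->
  thin_shells F e J -> thin_shells G e J -> fourier_pair u v g1 g2 ->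
  (forall x, ~ G x -> u x = 0) -> (forall x, ~ G x -> v x = 0) ->
  (N2 (fun x => \1_F x * g2 x)%R <= (64 * multiscale_const R d * e)%:E * (N2 u + N2 v) +
     16%:E * (local_energy F (kcos coord) J v + local_energy F (ksin coord) J u))%E.
Proof.
move=> mF mG e0 tF tG uvg Gu Gv; have := fourier_pairZ E 0 (-1) uvg.
have e1 (f g : X -> R) : (fun x => 0 * f x - -1 * g x) = g by apply/funext => x; ring.
have e2 (f g : X -> R) : (fun x => 0 * f x + -1 * g x) = fun x => - g x by apply/funext => x; ring.
rewrite !e1 !e2 => uvg'.
have := restricted_transform_le mF mG e0 tF tG uvg' Gv.
rewrite N2N; have -> : local_energy F (ksin coord) J (fun x => - u x) = local_energy F (ksin coord) J u.
  rewrite /local_energy -N2N; congr N2; apply/funext => x; have [[Lu _] _ _] := uvg.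
  have [iu _] := L12_localized E J Lu.
  rewrite (_ : (fun y => _ * - u y) = (fun y => -1 * (\1_(qb J) y * u y))); last by apply/funext => y; ring.
  by rewrite kopZ//; [ring|exact: (bounded_kernel_sin E)].
move=> h; rewrite [(N2 u + N2 v)%E]addeC; apply: h.
by move=> x /Gu ->; rewrite oppr0.
Qed.

(** The subsequence is fixed first. Then each [e] determines [J] through thinness, and the estimate
    is applied to differences along the subsequence, whose local energies at [J] tend to zero. *)
Lemma restricted_compact F G (h g : bool -> nat -> X -> R) (M : R) : measurable F -> measurable G ->
  (forall e : R, 0 < e -> exists J, thin_shells F e J /\ thin_shells G e J) ->
  (forall b n, L2 (h b n)) -> (forall b n, (N2 (h b n) <= M%:E)%E) -> (forall b n x, ~ G x -> h b n x = 0) ->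
  (forall n, fourier_pair (h true n) (h false n) (g true n) (g false n)) ->
  exists f, {homo f : m n / (m < n)%N} /\ forall b, cauchyN2 mu (fun n x => \1_F x * g b (f n) x).
Proof.
move=> mF mG thin Lh hM Gh hg.
have M0 : 0 <= M by rewrite -lee_fin; apply: le_trans (hM true 0%N); exact: N2_ge0.
have [f [f1 f2]] := localized_subsequence E Lh hM.
exists f; split => //.
have [C CE C0] : exists2 C, C = multiscale_const R d & 0 < C by exists (multiscale_const R d) => //; exact: multiscale_const_gt0.
have main (e : R) : 0 < e -> exists N, forall m n, (N <= m)%N -> (N <= n)%N -> forall b,
    (N2 (fun x => \1_F x * (g b (f m) x - g b (f n) x))%R <= e%:E)%E.
  (* Differences have [N2] at most [4 * M], so the thin part contributes
     [64 * C * e' * (8 * M) <= e / 2], and the local part [16 * (e / 64 + e / 64) = e / 2]. Writing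
     [M + 1] allows [M = 0]. *)
  move=> e0; pose e' := e / (32 * 32 * C * (M + 1)).
  have e'0 : 0 < e' by rewrite divr_gt0 ?mulr_gt0// ltr_wpDl.
  have [J [tF tG]] := thin _ e'0.
  have e64 : 0 < e / 64 by rewrite divr_gt0.
  have cl K b : oscillatory mu coord K -> K = kcos coord \/ K = ksin coord -> exists N, forall m n, (N <= m)%N -> (N <= n)%N ->
      (local_energy F K J (fun x => h b (f m) x - h b (f n) x)%R <= (e / 64)%:E)%E.
    move=> osc hK; have bK := spectral_bounded (oscillatory_spectral osc).
    have [N hN] := localized_cauchy E osc mF (fun n => Lh b (f n)) (fun n => hM b (f n)) (f2 K hK b J) e64.
    exists N => m n Nm Nn; apply: le_trans (hN m n Nm Nn).
    rewrite le_eqVlt; apply/orP; left; apply/eqP; congr N2; apply/funext => x.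
    have [i1 _] := L12_localized E J (Lh b (f m)); have [i2 _] := L12_localized E J (Lh b (f n)).
    by rewrite -mulrBr -kopB//; congr (_ * kop _ _ _ _); apply/funext => y; ring.
  have oc := oscillatory_kcos E; have os := oscillatory_ksin E.
  have [N1 h1] := cl _ true oc (or_introl erefl); have [N2' h2] := cl _ false oc (or_introl erefl).
  have [N3 h3] := cl _ true os (or_intror erefl); have [N4 h4] := cl _ false os (or_intror erefl).
  exists (maxn (maxn N1 N2') (maxn N3 N4)) => m n.
  rewrite !geq_max => /andP[/andP[m1 m2] /andP[m3 m4]] /andP[/andP[n1 n2] /andP[n3 n4]].
  have := fourier_pairB E (hg (f m)) (hg (f n)).
  have Gd b x : ~ G x -> h b (f m) x - h b (f n) x = 0 by move=> Gx; rewrite !Gh// subrr.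
  have nd b : (N2 (fun x => h b (f m) x - h b (f n) x)%R <= (4 * M)%:E)%E.
    have mh k : measurable_fun setT (h b k) by case: (Lh b k).
    have [mN _] := L2N (Lh b (f n)); have := N2D_le mu (mh (f m)) mN.
    rewrite N2N => /le_trans; apply; apply: (@le_trans _ _ (2%:E * M%:E + 2%:E * M%:E)%E).
      by apply: leeD; apply: lee_wpmul2l.
    by rewrite -!EFinM -EFinD lee_fin; lra.
  have fin : (64 * C * e') * (8 * M) <= e / 2.
    have M1 : 0 < M + 1 by rewrite ltr_wpDl.
    have -> : 64 * C * e' * (8 * M) = e / 2 * (M / (M + 1)).
      by rewrite /e'; field; rewrite !gt_eqF.
    by rewrite ler_piMr ?divr_ge0 ?(ltW e0)// ler_pdivrMr// mul1r lerDl.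
  have total (a b c s : \bar R) : (a <= (4 * M)%:E -> b <= (4 * M)%:E -> c <= (e / 64)%:E -> s <= (e / 64)%:E ->
      (64 * C * e')%:E * (a + b) + 16%:E * (c + s) <= e%:E)%E.
    move=> ha hb' hc hs; have k0 : 0 <= 64 * C * e'.
      by apply: mulr_ge0 (ltW e'0); apply: mulr_ge0 (ltW C0).
    apply: (@le_trans _ _ ((64 * C * e')%:E * ((4 * M)%:E + (4 * M)%:E) + 16%:E * ((e / 64)%:E + (e / 64)%:E))%E).
      by apply: leeD; apply: lee_wpmul2l; rewrite ?lee_fin//; exact: leeD.
    rewrite -!EFinD lee_fin; clear e'0 tF tG k0; move: e' fin => e' fin; lra.
  move=> p; case.
    have := restricted_transform_le mF mG e'0 tF tG p (Gd true) (Gd false); rewrite -CE => /le_trans; apply.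
    exact: (total _ _ _ _ (nd true) (nd false) (h1 _ _ m1 n1) (h4 _ _ m4 n4)).
  have := restricted_transform_le2 mF mG e'0 tF tG p (Gd true) (Gd false); rewrite -CE => /le_trans; apply.
  exact: (total _ _ _ _ (nd true) (nd false) (h2 _ _ m2 n2) (h3 _ _ m3 n3)).
move=> b e e0; have [N hN] := main e e0; exists N => m n Nm Nn.
apply: le_trans (hN m n Nm Nn b); rewrite le_eqVlt; apply/orP; left; apply/eqP.
by congr N2; apply/funext => x; ring.
Qed.
End restricted_compactness.

(** * The concentration operator as a relation *)

Section concentration.
Context dX (X : measurableType dX) (R : realType) (mu : {sigma_finite_measure set X -> \bar R}).
Context (d : nat) (coord : X -> 'I_d -> R) (E : euclidean coord mu).
Local Notation L2 := (L2 mu).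
Local Notation N2 := (N2 mu).
Local Notation fourier_pair := (fourier_pair mu coord).
Context (F G : set X) (mF : measurable F) (mG : measurable G).
Implicit Types f t : X -> R.

(* [t1 + i t2] represents [Q_F P_G (f1 + i f2)]. *)
Definition concentration f1 f2 t1 t2 := exists g1 g2,
  fourier_pair (fun x => \1_G x * f1 x) (fun x => \1_G x * f2 x) g1 g2 /\
  fourier_pair t1 t2 (fun x => \1_F x * g1 x) (fun x => \1_F x * g2 x).

Lemma N2_indic_mul_le A f : measurable A -> L2 f -> (N2 (fun x => \1_A x * f x)%R <= N2 f)%E.
Proof.
move=> mA Lf; have [m _] := L2_indic_mul mA Lf; apply: le_N2 => //; first by case: Lf.
by move=> x; rewrite normrM ler_piMl//; exact: norm_indic_le1.
Qed.

Lemma concentration_le f1 f2 t1 t2 : L2 f1 -> L2 f2 -> concentration f1 f2 t1 t2 ->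
  (N2 t1 + N2 t2 <= N2 f1 + N2 f2)%E.
Proof.
move=> Lf1 Lf2 [g1 [g2 [p q]]]; have [_ [Lg1 Lg2] _] := p.
rewrite -(fourier_pair_isometry E q); apply: (@le_trans _ _ (N2 g1 + N2 g2)%E).
  by apply: leeD; exact: N2_indic_mul_le.
by rewrite (fourier_pair_isometry E p); apply: leeD; exact: N2_indic_mul_le.
Qed.

Lemma concentrationZ a b f1 f2 t1 t2 : concentration f1 f2 t1 t2 ->
  concentration (fun x => a * f1 x - b * f2 x) (fun x => a * f2 x + b * f1 x)
    (fun x => a * t1 x - b * t2 x) (fun x => a * t2 x + b * t1 x).
Proof.
move=> [g1 [g2 [p q]]]; have p' := fourier_pairZ E a b p; have q' := fourier_pairZ E a b q.
exists (fun x => a * g1 x - b * g2 x), (fun x => a * g2 x + b * g1 x); split.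
  by move: p'; congr fourier_pair; apply/funext => x; ring.
by move: q'; congr fourier_pair; apply/funext => x; ring.
Qed.

Lemma concentrationD f1 f2 t1 t2 f1' f2' t1' t2' : concentration f1 f2 t1 t2 -> concentration f1' f2' t1' t2' ->
  concentration (fun x => f1 x + f1' x) (fun x => f2 x + f2' x) (fun x => t1 x + t1' x) (fun x => t2 x + t2' x).
Proof.
move=> [g1 [g2 [p q]]] [g1' [g2' [p' q']]].
have p2 := fourier_pairD E p p'; have q2 := fourier_pairD E q q'.
exists (fun x => g1 x + g1' x), (fun x => g2 x + g2' x); split.
  by move: p2; congr fourier_pair; apply/funext => x; ring.
by move: q2; congr fourier_pair; apply/funext => x; ring.
Qed.

Lemma concentrationB f1 f2 t1 t2 f1' f2' t1' t2' : concentration f1 f2 t1 t2 -> concentration f1' f2' t1' t2' ->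
  concentration (fun x => f1 x - f1' x) (fun x => f2 x - f2' x) (fun x => t1 x - t1' x) (fun x => t2 x - t2' x).
Proof.
move=> p p'; have := concentrationD p (concentrationZ (-1) 0 p').
by congr concentration; apply/funext => x; ring.
Qed.

(** This makes the choice of representatives harmless: by linearity and [concentration_le], the
    difference of two results is bounded by that of the inputs. *)
Lemma concentration_eq f1 f2 t1 t2 f1' f2' t1' t2' : L2 f1 -> L2 f2 -> L2 f1' -> L2 f2' ->
  concentration f1 f2 t1 t2 -> concentration f1' f2' t1' t2' ->
  N2 (fun x => f1 x - f1' x) = 0%E -> N2 (fun x => f2 x - f2' x) = 0%E ->
  N2 (fun x => t1 x - t1' x) = 0%E /\ N2 (fun x => t2 x - t2' x) = 0%E.
Proof.
move=> Lf1 Lf2 Lf1' Lf2' p p' e1 e2.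
have := concentration_le (L2B Lf1 Lf1') (L2B Lf2 Lf2') (concentrationB p p').
rewrite e1 e2 adde0 => h.
by split; apply/eqP; rewrite eq_le N2_ge0 andbT; apply: le_trans h; rewrite ?leeDl ?leeDr ?N2_ge0.
Qed.

(** The inverse transform is an isometry, so [t1] and [t2] are Cauchy along the subsequence that
    makes the restricted transforms Cauchy; completeness provides the limits. *)
Lemma concentration_compact (hd : (0 < d)%N) (M : R) (f1 f2 t1 t2 : nat -> X -> R) :
  (forall e : R, 0 < e -> exists J, thin_shells mu coord F e J /\ thin_shells mu coord G e J) ->
  (forall n, L2 (f1 n)) -> (forall n, L2 (f2 n)) ->
  (forall n, (N2 (f1 n) <= M%:E)%E) -> (forall n, (N2 (f2 n) <= M%:E)%E) ->
  (forall n, concentration (f1 n) (f2 n) (t1 n) (t2 n)) ->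
  exists k : nat -> nat, {homo k : m n / (m < n)%N} /\ exists s1 s2, [/\ L2 s1, L2 s2,
    N2 (fun x => t1 (k n) x - s1 x) @[n --> \oo] --> 0%E &
    N2 (fun x => t2 (k n) x - s2 x) @[n --> \oo] --> 0%E].
Proof.
move=> thin Lf1 Lf2 M1 M2 hc.
have [g1 hg1] := choice hc; have [g2 hg] := choice hg1.
pose h (b : bool) n x := \1_G x * (if b then f1 else f2) n x.
pose g (b : bool) := if b then g1 else g2.
have [|||n|k [k1 k2]] := @restricted_compact _ _ _ mu d coord E hd F G h g M mF mG thin.
- by move=> b n; apply: L2_indic_mul => //; case: b.
- by move=> b n; apply: (@le_trans _ _ (N2 ((if b then f1 else f2) n))); [apply: N2_indic_mul_le => //; case: b|case: b].
- by move=> b n x Gx; rewrite /h indicE memNset// mul0r.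
- exact: (hg n).1.
have iso m n : (N2 (fun x => t1 (k m) x - t1 (k n) x)%R + N2 (fun x => t2 (k m) x - t2 (k n) x)%R =
    N2 (fun x => \1_F x * g1 (k m) x - \1_F x * g1 (k n) x)%R + N2 (fun x => \1_F x * g2 (k m) x - \1_F x * g2 (k n) x)%R)%E.
  by rewrite -(fourier_pair_ext E (hg (k m)).2 (hg (k n)).2).
have cau e : 0 < e -> exists N, forall m n, (N <= m)%N -> (N <= n)%N ->
    (N2 (fun x => t1 (k m) x - t1 (k n) x)%R + N2 (fun x => t2 (k m) x - t2 (k n) x)%R <= e%:E)%E.
  move=> e0; have e2 : 0 < e / 2 by rewrite divr_gt0.
  have [N1 h1] := k2 true _ e2; have [N2' h2] := k2 false _ e2.
  exists (maxn N1 N2') => m n; rewrite !geq_max => /andP[a b] /andP[a' b'].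
  by rewrite iso [e in (_ <= e%:E)%E]splitr EFinD; apply: leeD; [exact: h1|exact: h2].
have Lt1 n : L2 (t1 (k n)) by have [_ [[]]] := hg (k n).
have Lt2 n : L2 (t2 (k n)) by have [_ [[]]] := hg (k n).
have [|s1 [Ls1 c1]] := Riesz_Fischer Lt1.
  move=> e /cau[N hN]; exists N => m n Nm Nn; apply: le_trans (hN m n Nm Nn).
  by rewrite leeDl// N2_ge0.
have [|s2 [Ls2 c2]] := Riesz_Fischer Lt2.
  move=> e /cau[N hN]; exists N => m n Nm Nn; apply: le_trans (hN m n Nm Nn).
  by rewrite leeDr// N2_ge0.
by exists k; split => //; exists s1, s2.
Qed.
End concentration.

Local Open Scope complex_scope.

(** * Back to complex functions on [R^d] *)

Section complex_norm.
Context dX (X : measurableType dX) (R : realType) (mu : {sigma_finite_measure set X -> \bar R}).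
Local Notation L1 := (L1 mu).
Local Notation L2 := (L2 mu).
Local Notation N2 := (N2 mu).
Local Notation C := R[i].
Implicit Types f g : X -> C.

Definition re f x : R := complex.Re (f x).
Definition im f x : R := complex.Im (f x).
Definition cn (p : \bar R) f : \bar R := Lnorm mu p (fun x => (ComplexField.Normc.normc (f x))%:E).
Definition cmeas f := measurable_fun setT (re f) /\ measurable_fun setT (im f).

Lemma normcE f x : ComplexField.Normc.normc (f x) = Num.sqrt (re f x ^+ 2 + im f x ^+ 2).
Proof. by rewrite /re /im; case: (f x). Qed.

Lemma measurable_normc f : cmeas f -> measurable_fun setT (fun x => ComplexField.Normc.normc (f x) : R).
Proof.
move=> [mr mi]; under eq_fun do rewrite normcE.
apply: (measurableT_comp (f := (Num.sqrt : R -> R))); first by apply: continuous_measurable_fun; exact: sqrt_continuous.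
by apply: measurable_funD; exact: measurable_funX.
Qed.

Lemma poweR2 (x : \bar R) : (0 <= x)%E -> (x `^ 2 = x * x)%E.
Proof.
case: x => [r| |]//= r0; last by rewrite (pnatr_eq0 _ 2) mulyy.
by rewrite -EFinM -expr2 -powR_mulrn.
Qed.

(** Links the complex norm with the real quantities [N2]; squares avoid extended-real roots. *)
Lemma sqr_cn f : cmeas f -> (cn 2%:E f * cn 2%:E f = N2 (re f) + N2 (im f))%E.
Proof.
move=> [mr mi]; rewrite -poweR2 ?Lnorm_ge0// /cn powR_Lnorm//.
rewrite /Submission.N2 -ge0_integralD//.
- apply: eq_integral => x _.
  rewrite poweR2 ?abse_ge0//= -EFinM normcE ger0_norm ?sqrtr_ge0// -expr2 sqr_sqrtr ?EFinD//.
  by rewrite addr_ge0// sqr_ge0.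
- by move=> x _; rewrite lee_fin sqr_ge0.
- exact: measurable_sqr_EFin.
- by move=> x _; rewrite lee_fin sqr_ge0.
- exact: measurable_sqr_EFin.
Qed.

Lemma cn_fin f : cmeas f -> (cn 2%:E f < +oo)%E <-> L2 (re f) /\ L2 (im f).
Proof.
move=> mf; have [mr mi] := mf; have h := sqr_cn mf; have c0 : (0 <= cn 2%:E f)%E by exact: Lnorm_ge0.
have r0 := N2_ge0 mu (re f); have i0 := N2_ge0 mu (im f).
split => [cf|[[_ hr] [_ hi]]].
  have fin : (N2 (re f) + N2 (im f) < +oo)%E by rewrite -h lte_mul_pinfty// ge0_fin_numE.
  by split; split => //; apply: le_lt_trans fin; rewrite ?leeDl ?leeDr.
rewrite ltey; apply/eqP => cE; move: h; rewrite cE mulyy => /esym/eqP.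
by apply/negP; rewrite -ltey lte_add_pinfty.
Qed.

Lemma cn_le f (M : R) : cmeas f -> (cn 2%:E f <= M%:E)%E -> (N2 (re f) <= (M ^+ 2)%:E)%E /\ (N2 (im f) <= (M ^+ 2)%:E)%E.
Proof.
move=> mf fM; have c0 : (0 <= cn 2%:E f)%E by exact: Lnorm_ge0.
have : (N2 (re f) + N2 (im f) <= (M ^+ 2)%:E)%E.
  by rewrite -(sqr_cn mf) expr2 EFinM; exact: lee_pmul.
by move=> h; split; apply: le_trans h; rewrite ?leeDl ?leeDr ?N2_ge0.
Qed.

Lemma cn_eq0 f : cmeas f -> cn 2%:E f = 0%E <-> N2 (re f) = 0%E /\ N2 (im f) = 0%E.
Proof.
move=> mf; have h := sqr_cn mf; have c0 : (0 <= cn 2%:E f)%E by exact: Lnorm_ge0.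
have r0 := N2_ge0 mu (re f); have i0 := N2_ge0 mu (im f).
split => [c|[hr hi]].
  move: h; rewrite c mule0 => /esym/eqP; rewrite padde_eq0// => /andP[/eqP-> /eqP->] //.
by move: h; rewrite hr hi adde0 => /eqP; rewrite mule_eq0 orbb => /eqP.
Qed.

Lemma cvg_cn (f : nat -> X -> C) : (forall n, cmeas (f n)) ->
  cn 2%:E (f n) @[n --> \oo] --> 0%E <->
  (N2 (re (f n)) @[n --> \oo] --> 0%E /\ N2 (im (f n)) @[n --> \oo] --> 0%E).
Proof.
move=> mf; have h n := sqr_cn (mf n); have c0 n : (0 <= cn 2%:E (f n))%E by exact: Lnorm_ge0.
have r0 n := N2_ge0 mu (re (f n)); have i0 n := N2_ge0 mu (im (f n)).
split => [/ecvg0P hc|[hr hi]].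
  have : (N2 (re (f n)) + N2 (im (f n)))%E @[n --> \oo] --> 0%E.
    apply/ecvg0P => [n|e e0]; first exact: adde_ge0.
    (* Capping at 1 gives [e' * e' <= e]. *)
    pose e' := Num.min 1 e; have e'0 : 0 < e' by rewrite lt_min ltr01.
    apply: filterS (hc c0 _ e'0) => n hn; rewrite -h.
    apply: (@le_trans _ _ (e'%:E * e'%:E)%E); first exact: lee_pmul.
    rewrite -EFinM lee_fin; apply: (@le_trans _ _ (1 * e)); last by rewrite mul1r.
    by apply: ler_pM; rewrite ?(ltW e'0)// ge_min lexx ?orbT.
  move=> hs; split; apply: ecvg0_le hs => n; rewrite ?r0 ?i0 /=.
    by rewrite leeDl.
  by rewrite leeDr.
apply/ecvg0P => // e e0.
have := ecvg0D hr hi; move/ecvg0P => /(_ _ (e ^+ 2) (exprn_gt0 _ e0)).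
move=> /(_ (fun n => adde_ge0 (r0 n) (i0 n))); apply: filterS => n; rewrite -h.
have := c0 n; case: (cn _ _) => [r| |]//.
by rewrite -EFinM !lee_fin -expr2 => r0' hr'; rewrite -(@ler_sqr _ _ e) ?nnegrE// ltW.
Qed.

Lemma cn1_fin f : cmeas f -> (cn 1 f < +oo)%E <-> L1 (re f) /\ L1 (im f).
Proof.
move=> mf; have [mr mi] := mf.
have nE x : ComplexField.Normc.normc (f x) = Num.sqrt (re f x ^+ 2 + im f x ^+ 2) := normcE f x.
have re_le x : `|re f x| <= Num.sqrt (re f x ^+ 2 + im f x ^+ 2).
  by rewrite -sqrtr_sqr ler_wsqrtr// lerDl sqr_ge0.
have im_le x : `|im f x| <= Num.sqrt (re f x ^+ 2 + im f x ^+ 2).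
  by rewrite -sqrtr_sqr ler_wsqrtr// lerDr sqr_ge0.
have le_sum x : Num.sqrt (re f x ^+ 2 + im f x ^+ 2) <= `|re f x| + `|im f x|.
  rewrite -[leRHS]ger0_norm ?addr_ge0// -sqrtr_sqr ler_wsqrtr//.
  rewrite sqrrD !real_normK ?num_real// addrAC lerDl.
  by rewrite mulrn_wge0// mulr_ge0.
pose n x : R := ComplexField.Normc.normc (f x).
have mn : measurable_fun setT n by exact: measurable_normc.
have n0 x : 0 <= n x by rewrite /n nE sqrtr_ge0.
have cE : cn 1 f = (\int[mu]_x `|(n x)%:E|)%E by rewrite /cn Lnorm1.
split => [cf|[ir ii]].
  have i : L1 n by apply/integrableP; split; [exact/measurable_EFinP|rewrite -cE].
  by split; apply: (L1_le _ i) => // x; rewrite (ger0_norm (n0 x)) /n nE.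
have i : L1 n.
  apply: (L1_le mn (L1D (integrable_norm ir) (integrable_norm ii))) => x /=.
  by rewrite (ger0_norm (n0 x)) /n nE ger0_norm ?addr_ge0.
by rewrite cE; have /integrableP[] := i.
Qed.
End complex_norm.

(** * The complex transform as a pair of real functions *)

Section bridge.
Context (R : realType) (d : nat).
Local Notation X := (Rn R d).
Local Notation mu := (@lebesgue R d).
Local Notation coord := (@Defs.coord R d).
Local Notation E := (@lebesgue_euclidean R d).
Local Notation C := R[i].
Local Notation L1 := (L1 mu).
Local Notation L2 := (L2 mu).
Local Notation N2 := (N2 mu).
Implicit Types f g : X -> C.

Lemma reB f g : re (fun x => f x - g x) = fun x => re f x - re g x.
Proof. by apply/funext => x; rewrite /re; case: (f x) (g x) => a b []. Qed.

Lemma imB f g : im (fun x => f x - g x) = fun x => im f x - im g x.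
Proof. by apply/funext => x; rewrite /im; case: (f x) (g x) => a b []. Qed.

Lemma cLp2E f : cLp 2%:E f <-> L2 (re f) /\ L2 (im f).
Proof.
split => [[mf cf]|[Lr Li]]; first exact: ((cn_fin mu mf).1 cf).
have mf : cmeas f by split; [case: Lr|case: Li].
by split => //; apply: (cn_fin mu mf).2.
Qed.

Lemma cLp1E f : cLp 1 f <-> L1 (re f) /\ L1 (im f).
Proof.
split => [[mf cf]|[Lr Li]]; first exact: ((cn1_fin mu mf).1 cf).
have mf : cmeas f by split; [exact: L1_measurable Lr|exact: L1_measurable Li].
by split => //; apply: (cn1_fin mu mf).2.
Qed.

Lemma cmeasB f g : cmeas f -> cmeas g -> cmeas (fun x => f x - g x).
Proof. by move=> [? ?] [? ?]; split; rewrite ?reB ?imB; exact: measurable_funB. Qed.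

Lemma cLp2_meas f : cLp 2%:E f -> cmeas f. Proof. by case. Qed.

Lemma L2dist_eq0 f g : cLp 2%:E f -> cLp 2%:E g -> L2dist f g = 0%E <->
  N2 (fun x => re f x - re g x) = 0%E /\ N2 (fun x => im f x - im g x) = 0%E.
Proof.
move=> [mf _] [mg _]; have := cn_eq0 mu (cmeasB mf mg); rewrite reB imB; exact.
Qed.

Lemma cvg_L2dist (f : nat -> X -> C) g : (forall n, cmeas (f n)) -> cmeas g ->
  L2dist (f n) g @[n --> \oo] --> 0%E <->
  (N2 (fun x => re (f n) x - re g x) @[n --> \oo] --> 0%E /\ N2 (fun x => im (f n) x - im g x) @[n --> \oo] --> 0%E).
Proof.
move=> mf mg; have := cvg_cn mu (fun n => cmeasB (mf n) mg).
by under [X in _ <-> (X /\ _)]eq_cvg do rewrite reB; under [X in _ <-> (_ /\ X)]eq_cvg do rewrite imB.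
Qed.

Lemma re_fourier_integral f : L1 (re f) -> L1 (im f) -> re (fourier_integral f) = F1 mu coord (re f) (im f).
Proof.
move=> ir ii; apply/funext => xi; rewrite /F1 /kop -RintegralD//.
- apply: eq_Rintegral => x _; rewrite /re /im /cexpi.
  rewrite cosN sinN /kcos /ksin; case: (f x) => a b /=; ring.
- exact: (kernel_L1 xi (bounded_kernel_cos E) ir).
- exact: (kernel_L1 xi (bounded_kernel_sin E) ii).
Qed.

Lemma im_fourier_integral f : L1 (re f) -> L1 (im f) -> im (fourier_integral f) = F2 mu coord (re f) (im f).
Proof.
move=> ir ii; apply/funext => xi; rewrite /F2 /kop -RintegralB//.
- apply: eq_Rintegral => x _; rewrite /re /im /cexpi.
  rewrite cosN sinN /kcos /ksin; case: (f x) => a b /=; ring.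
- exact: (kernel_L1 xi (bounded_kernel_cos E) ii).
- exact: (kernel_L1 xi (bounded_kernel_sin E) ir).
Qed.

(** Approximating sequences correspond through real and imaginary parts; [key] collects what both
    directions need. *)
Lemma is_fourierE f g : is_fourier f g <-> fourier_pair mu coord (re f) (im f) (re g) (im g).
Proof.
have key (u : nat -> X -> C) : (forall n, cLp 1 (u n) /\ cLp 2%:E (u n)) ->
    [/\ forall n, L12 mu (re (u n)) /\ L12 mu (im (u n)), forall n, cmeas (u n), forall n, cmeas (fourier_integral (u n)),
      forall n, re (fourier_integral (u n)) = F1 mu coord (re (u n)) (im (u n)) &
      forall n, im (fourier_integral (u n)) = F2 mu coord (re (u n)) (im (u n))].
  move=> hu; have h1 n : L1 (re (u n)) /\ L1 (im (u n)) by apply: (cLp1E _).1; have [] := hu n.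
  have h2 n : L2 (re (u n)) /\ L2 (im (u n)) by apply: (cLp2E _).1; have [] := hu n.
  have h n : L12 mu (re (u n)) /\ L12 mu (im (u n)).
    by have [? ?] := h1 n; have [? ?] := h2 n.
  have re' n : re (fourier_integral (u n)) = F1 mu coord (re (u n)) (im (u n)).
    by have [? ?] := h1 n; exact: re_fourier_integral.
  have im' n : im (fourier_integral (u n)) = F2 mu coord (re (u n)) (im (u n)).
    by have [? ?] := h1 n; exact: im_fourier_integral.
  split; [exact: h|by move=> n; have [_ []] := hu n| |exact: re'|exact: im'].
  move=> n; have [k1 k2] := h n; split.
    by rewrite re'; have [] := F1_L2 E k1 k2.
  by rewrite im'; have [] := F2_L2 E k1 k2.
split.
  move=> [Lf Lg [u [hu uf ug]]]; have [h mu' mF re' im'] := key u hu.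
  have mf := cLp2_meas Lf; have mg := cLp2_meas Lg.
  have [a1 a2] := (cvg_L2dist mu' mf).1 uf; have [b1 b2] := (cvg_L2dist mF mg).1 ug.
  split; [exact: (cLp2E f).1|exact: (cLp2E g).1|].
  exists (fun n => re (u n)), (fun n => im (u n)); split => //.
    by move: b1; under eq_cvg do rewrite re'.
  by move: b2; under eq_cvg do rewrite im'.
move=> [Lf Lg [u [v [huv uf vf ug vg]]]].
have Cf : cLp 2%:E f by apply: (cLp2E f).2.
have Cg : cLp 2%:E g by apply: (cLp2E g).2.
pose w n x : C := u n x +i* v n x.
have hw n : cLp 1 (w n) /\ cLp 2%:E (w n).
  by have [[? ?] [? ?]] := huv n; split; [apply: (cLp1E (w n)).2|apply: (cLp2E (w n)).2].
have [h mw mF re' im'] := key w hw.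
have mf := cLp2_meas Cf; have mg := cLp2_meas Cg.
split => //; exists w; split => //.
  by apply: (cvg_L2dist mw mf).2.
apply: (cvg_L2dist mF mg).2; split.
  by under eq_cvg do rewrite re'.
by under eq_cvg do rewrite im'.
Qed.

Lemma re_restrict A f : re (restrict_to A f) = fun x => \1_A x * re f x.
Proof.
by apply/funext => x; rewrite /re /restrict_to; case: (f x) => a b /=; rewrite mul0r subr0.
Qed.

Lemma im_restrict A f : im (restrict_to A f) = fun x => \1_A x * im f x.
Proof.
by apply/funext => x; rewrite /im /restrict_to; case: (f x) => a b /=; rewrite mul0r addr0.
Qed.

(** Existence of a transform rules out the default value of [xget]. *)
Lemma fourier_spec f : cLp 2%:E f -> is_fourier f (fourier f).
Proof.
move=> /(cLp2E f)[Lr Li]; have [g1 [g2 p]] := fourier_pair_exists E Lr Li.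
rewrite /fourier; case: xgetP => [g _ //|/(_ (fun x => g1 x +i* g2 x)) []].
exact: (is_fourierE _ _).2.
Qed.

(** Here surjectivity of the transform rules out the default value. *)
Lemma inv_fourier_spec g : cLp 2%:E g -> is_fourier (inv_fourier g) g.
Proof.
move=> /(cLp2E g)[Lr Li]; have [f1 [f2 p]] := fourier_pair_surj E Lr Li.
rewrite /inv_fourier; case: xgetP => [f _ //|/(_ (fun x => f1 x +i* f2 x)) []].
exact: (is_fourierE _ _).2.
Qed.

Lemma cLp2_restrict A f : measurable A -> cLp 2%:E f -> cLp 2%:E (restrict_to A f).
Proof.
move=> mA /(cLp2E f)[Lr Li]; apply: (cLp2E _).2; rewrite re_restrict im_restrict.
by split; exact: L2_indic_mul.
Qed.

Lemma Q_P_concentration F G f : measurable F -> measurable G -> cLp 2%:E f ->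
  concentration mu coord F G (re f) (im f) (re (Q_ F (P_ G f))) (im (Q_ F (P_ G f))).
Proof.
move=> mF mG Lf; have LP := cLp2_restrict mG Lf.
have p := fourier_spec LP; have [_ Lg _] := p.
have q := inv_fourier_spec (cLp2_restrict mF Lg).
move/is_fourierE : p; move/is_fourierE : q.
rewrite !re_restrict !im_restrict => q p.
by exists (re (fourier (P_ G f))), (im (fourier (P_ G f))).
Qed.
End bridge.

(** * From thinness at infinity to thin shells *)

Section thinness.
Context dX (X : measurableType dX) (R : realType) (mu : {sigma_finite_measure set X -> \bar R}).
Context (d : nat) (coord : X -> 'I_d -> R) (E : euclidean coord mu) (hd : (0 < d)%N).
Local Notation sqdist := (sqdist coord).
Local Notation sqnorm := (sqnorm coord).
Local Notation cube := (cube coord).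

Lemma qball_cube x (r : R) : 0 < r -> [set y | sqdist x y < r ^+ 2] `<=` cube x r.
Proof.
move=> r0 y /= h i; rewrite distrC -(@ltr_sqr _ _ r) ?nnegrE ?(ltW r0)// real_normK ?num_real//.
by apply: le_lt_trans h; rewrite /Submission.sqdist (bigD1 i)//= lerDl; apply: sumr_ge0 => j _; exact: sqr_ge0.
Qed.

(* Around a point [xi] of the shell, the mesh cube lies in the ball of radius [1/|xi|],
   whose volume is at most [(4d)^d] times that of the cube. *)
Lemma thin_shells_qball (F : set X) (e : R) J : measurable F -> 0 <= e ->
  (forall x, 4 ^+ J <= sqnorm x ->
    (mu (F `&` [set y | (sqdist x y < (sqnorm x)^-1)%R]) <= e%:E * mu [set y | (sqdist x y < (sqnorm x)^-1)%R])%E) ->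
  thin_shells mu coord F (e * (4 * d%:R) ^+ d) J.
Proof.
move=> mF e0 th k Jk z; have mcoord := euclidean_coord E.
have r0 := mesh_gt0 R hd k; set r := mesh R d k in r0 *.
have [A0|/set0P[xi [[Fxi xik] zxi]]] := eqVneq (F `&` shell coord k `&` cube z r) set0.
  by rewrite A0 measure0 lee_fin mulr_ge0 ?mulr_ge0 ?exprn_ge0// ltW// mulr_gt0.
have [xik1 /negP] := xik; rewrite /qb /= -leNgt => xik0; rewrite /qb /= in xik1.
have q0 : 0 < sqnorm xi by apply: lt_le_trans xik0; rewrite exprn_gt0.
pose t : R := Num.sqrt (sqnorm xi)^-1.
have t2 : t ^+ 2 = (sqnorm xi)^-1 by rewrite sqr_sqrtr// invr_ge0 ltW.
have t0 : 0 < t by rewrite sqrtr_gt0 invr_gt0.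
have p0 : 0 < 2 ^+ k.+1 :> R by rewrite exprn_gt0.
have d0' := dim_gt0 R hd.
have rE : 2 * d%:R * r = (2 ^+ k.+1)^-1 by rewrite /r /mesh; field; rewrite !gt_eqF.
have sub : F `&` shell coord k `&` cube z r `<=` F `&` [set y | sqdist xi y < (sqnorm xi)^-1].
  move=> y [[Fy _] zy]; split => //=.
  apply: (@le_lt_trans _ _ (d%:R * (2 * r) ^+ 2)).
    apply: sqdist_cube_le; first by rewrite mulr_ge0// ltW.
    move=> i; have := zxi i; have := zy i; rewrite !ltr_norml => /andP[? ?] /andP[? ?].
    by apply/andP; split; lra.
  apply: (@le_lt_trans _ _ ((2 * d%:R * r) ^+ 2)).
    have -> : (2 * d%:R * r) ^+ 2 = d%:R * (d%:R * (2 * r) ^+ 2) :> R by ring.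
    rewrite ler_wpM2l ?(ltW d0')// ler_peMl ?sqr_ge0//.
    by rewrite ler1n.
  by rewrite rE exprVn sqr_exp2 ltf_pV2 ?posrE ?exprn_gt0.
have mball : measurable [set y | sqdist xi y < (sqnorm xi)^-1] by exact: (measurable_qball mcoord).
apply: (@le_trans _ _ (mu (F `&` [set y | sqdist xi y < (sqnorm xi)^-1]))).
  apply: le_measure sub; rewrite inE; last exact: measurableI.
  by apply: measurableI; [apply: measurableI => //; exact: (measurable_shell E)|exact: (measurable_cube mcoord)].
have Jxi : 4 ^+ J <= sqnorm xi by apply: le_trans xik0; rewrite ler_weXn2l// ler1n.
apply: (le_trans (th xi Jxi)); rewrite -mulrA EFinM; apply: lee_wpmul2l; first by rewrite lee_fin.
apply: (@le_trans _ _ (mu (cube xi t))).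
  apply: le_measure; rewrite ?inE//; first exact: (measurable_cube mcoord).
  by move=> y /=; rewrite -t2 => h; exact: (qball_cube t0).
rewrite (euclidean_cube E) ?(ltW t0)// lee_fin -exprMn.
have -> : 4 * d%:R * (2 * r) = 2 * (2 * (2 * d%:R * r)) :> R by ring.
rewrite lerXn2r ?nnegrE ?mulr_ge0 ?(ltW t0) ?rE ?invr_ge0 ?(ltW p0)//.
rewrite ler_wpM2l// exprS invfM mulrA mulfV// mul1r.
have p1 : 0 < 2 ^+ k :> R by rewrite exprn_gt0.
rewrite -(@ler_sqr _ _ (_^-1)) ?nnegrE ?invr_ge0 ?(ltW t0) ?(ltW p1)// t2 exprVn sqr_exp2.
by rewrite lef_pV2 ?posrE// exprn_gt0.
Qed.
End thinness.

Section very_thin.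
Context (R : realType) (d : nat) (hd : (0 < d)%N).
Local Notation X := (Rn R d).
Local Notation mu := (@lebesgue R d).
Local Notation coord := (@Defs.coord R d).
Local Notation E := (@lebesgue_euclidean R d).
Local Notation sqnorm := (sqnorm coord).
Local Notation sqdist := (sqdist coord).

Lemma eball_rhoE (x : X) : 1 <= sqnorm x -> eball x (rho x) = [set y | sqdist x y < (sqnorm x)^-1].
Proof.
move=> x1; have x0 : 0 < sqnorm x by exact: lt_le_trans x1.
have s1 : 1 <= Num.sqrt (sqnorm x) by rewrite -[leLHS]sqrtr1 ler_wsqrtr.
have -> : rho x = Num.sqrt (sqnorm x)^-1.
  rewrite /rho /enorm -/(sqnorm x) gt_eqF; last exact: lt_le_trans s1.
  by rewrite sqrtrV ?(ltW x0)// min_r// invf_le1// (lt_le_trans _ s1).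
by apply/seteqP; split => y; rewrite /eball /edist /= -/(sqdist x y) ltr_sqrt// invr_gt0.
Qed.

Lemma very_thin_qball (F : set X) (e : R) : measurable F -> very_thin_at_infinity F -> 0 < e ->
  exists J, forall J', (J <= J')%N -> forall x, 4 ^+ J' <= sqnorm x ->
    (mu (F `&` [set y | (sqdist x y < (sqnorm x)^-1)%R]) <= e%:E * mu [set y | (sqdist x y < (sqnorm x)^-1)%R])%E.
Proof.
move=> mF tF e0.
have [M hM] : at_infinity (fun x : X => `|0 - fine (mu (F `&` eball x (rho x))) / fine (mu (eball x (rho x)))| < e).
  by apply: (tF [set z | `|0 - z| < e]); exact: nbhsx_ballx.
(* For such [J'] one has [M < J' <= 2 ^+ J' <= |x|]. *)
exists (Num.truncn M).+1 => J' MJ x xJ.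
have x1 : 1 <= sqnorm x by apply: le_trans xJ; rewrite exprn_ege1// ler1n.
have Mx : M < enorm x.
  apply: (lt_le_trans (truncnS_gt M)); apply: (@le_trans _ _ J'%:R); first by rewrite ler_nat.
  apply: (@le_trans _ _ (2 ^+ J')); first by rewrite -natrX ler_nat ltnW// ltn_expl.
  have -> : 2 ^+ J' = Num.sqrt (4 ^+ J') :> R by rewrite -sqr_exp2 sqrtr_sqr ger0_norm// exprn_ge0.
  by rewrite ler_wsqrtr.
have := hM x Mx; rewrite (eball_rhoE x1).
set B := [set y | sqdist x y < (sqnorm x)^-1].
have x0 : 0 < sqnorm x by exact: lt_le_trans x1.
have mB : measurable B by exact: (measurable_qball (euclidean_coord E)).
have mFB : measurable (F `&` B) by exact: measurableI.
have FB : (mu (F `&` B) <= mu B)%E by apply: le_measure; rewrite ?inE//; exact: subIsetr.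
have Bfin : (mu B < +oo)%E.
  apply: (@le_lt_trans _ _ (mu (cube coord x (Num.sqrt (sqnorm x)^-1)))).
    apply: le_measure; rewrite ?inE//; first exact: (measurable_cube (euclidean_coord E)).
    move=> y By; apply: qball_cube; first by rewrite sqrtr_gt0 invr_gt0.
    by rewrite /= sqr_sqrtr// invr_ge0 ltW.
  by rewrite (euclidean_cube E) ?sqrtr_ge0// ltry.
have fB : mu B \is a fin_num by rewrite ge0_fin_numE// measure_ge0.
have fFB : mu (F `&` B) \is a fin_num.
  by rewrite ge0_fin_numE ?measure_ge0//; exact: le_lt_trans FB Bfin.
rewrite -(fineK fB) -(fineK fFB) -EFinM lee_fin.
have b0 : 0 <= fine (mu B) by rewrite fine_ge0// measure_ge0.
have a0 : 0 <= fine (mu (F `&` B)) by rewrite fine_ge0// measure_ge0.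
have ab : fine (mu (F `&` B)) <= fine (mu B) by exact: fine_le.
(* If the ball had measure [0], the quotient would carry no information; the inclusion [a <= b] then
   gives the bound. *)
move: (fine _) (fine _) b0 a0 ab => b a; rewrite le_eqVlt => /predU1P[<-|b0] a0 ab h.
  by rewrite mulr0 //; lra.
move: h; rewrite sub0r normrN ger0_norm ?divr_ge0 ?(ltW b0)// ltr_pdivrMr//.
exact: ltW.
Qed.

Lemma very_thin_shells (F : set X) (e : R) : measurable F -> very_thin_at_infinity F -> 0 < e ->
  exists J, forall J', (J <= J')%N -> thin_shells mu coord F e J'.
Proof.
move=> mF tF e0; have c0 : 0 < (4 * d%:R) ^+ d :> R by rewrite exprn_gt0// mulr_gt0// ltr0n.
(* Compensates for the factor lost in [thin_shells_qball] between balls and mesh cubes. *)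
have e'0 : 0 < e / (4 * d%:R) ^+ d by rewrite divr_gt0.
have [J hJ] := very_thin_qball mF tF e'0; exists J => J' JJ.
rewrite -[e](divfK (lt0r_neq0 c0)); apply: (thin_shells_qball E hd mF (ltW e'0)).
exact: hJ.
Qed.
End very_thin.

Section linearity.
Context (R : realType) (d : nat).
Local Notation C := R[i].
Implicit Types f g : Rn R d -> C.

Lemma re_affine (a : C) f g : re (fun x => a * f x + g x) =
  fun x => (complex.Re a * re f x - complex.Im a * im f x) + re g x.
Proof. by apply/funext => x; rewrite /re /im; case: a (f x) (g x) => a b [c e] []. Qed.

Lemma im_affine (a : C) f g : im (fun x => a * f x + g x) =
  fun x => (complex.Re a * im f x + complex.Im a * re f x) + im g x.
Proof. by apply/funext => x; rewrite /re /im; case: a (f x) (g x) => a b [c e] []. Qed.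
End linearity.

Theorem theorem1p3 (R : realType) (d : nat) (hd : (1 <= d)%N)
    (E F : set (Rn R d)) (mE : measurable E) (mF : measurable F)
    (tE : very_thin_at_infinity E) (tF : very_thin_at_infinity F) :
  compact_operator_L2 (fun f => Q_ F (P_ E f)).
Proof.
pose Eu := @lebesgue_euclidean R d.
pose T (f : Rn R d -> R[i]) := Q_ F (P_ E f).
have spec f : cLp 2%:E f -> concentration (@lebesgue R d) (@Defs.coord R d) F E (re f) (im f) (re (T f)) (im (T f)).
  by move=> Lf; exact: Q_P_concentration.
have LT f : cLp 2%:E f -> cLp 2%:E (T f).
  move=> Lf; apply: (cLp2E _).2; have [g1 [g2 [_ [h _ _]]]] := spec f Lf; exact: h.
have Laff (a : R[i]) (f g : Rn R d -> R[i]) : cLp 2%:E f -> cLp 2%:E g -> cLp 2%:E (fun x => a * f x + g x).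
  move=> /cLp2E[f1 f2] /cLp2E[g1 g2]; apply: (cLp2E _).2; rewrite re_affine im_affine.
  split; first exact: (L2D (L2B (L2Z _ f1) (L2Z _ f2)) g1).
  exact: (L2D (L2D (L2Z _ f2) (L2Z _ f1)) g2).
split.
  split => // [f g Lf Lg|a f g Lf Lg].
    move=> /(L2dist_eq0 Lf Lg)[e1 e2]; apply/(L2dist_eq0 (LT f Lf) (LT g Lg)).
    have [[f1 f2] [g1 g2]] := ((cLp2E f).1 Lf, (cLp2E g).1 Lg).
    exact: (concentration_eq Eu mF mE f1 f2 g1 g2 (spec f Lf) (spec g Lg)).
  have Lh := Laff a f g Lf Lg.
  apply/(L2dist_eq0 (LT _ Lh) (Laff a _ _ (LT f Lf) (LT g Lg))).
  have [l1 l2] := (cLp2E _).1 Lh.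
  have := concentrationD Eu (concentrationZ Eu (complex.Re a) (complex.Im a) (spec f Lf)) (spec g Lg).
  (* Both sides of the linearity claim represent the operator at the same input, so
     [concentration_eq] identifies them. *)
  have s := spec _ Lh; rewrite -!re_affine -!im_affine => s'.
  have z w : N2 (@lebesgue R d) (fun x => w x - w x) = 0%E.
    rewrite -[RHS](@integral0 _ _ _ (@lebesgue R d) setT); apply: eq_integral => x _.
    by rewrite subrr expr0n.
  exact: (concentration_eq Eu mF mE l1 l2 l1 l2 s s' (z _) (z _)).
move=> f Lf [M hM].
have thin e : 0 < e -> exists J, thin_shells (@lebesgue R d) (@Defs.coord R d) F e J /\
    thin_shells (@lebesgue R d) (@Defs.coord R d) E e J.
  move=> e0; have [J1 h1] := very_thin_shells hd mF tF e0; have [J2 h2] := very_thin_shells hd mE tE e0.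
  by exists (maxn J1 J2); split; [apply: h1; exact: leq_maxl|apply: h2; exact: leq_maxr].
have Lr n : L2 (@lebesgue R d) (re (f n)) by have [] := (cLp2E _).1 (Lf n).
have Li n : L2 (@lebesgue R d) (im (f n)) by have [] := (cLp2E _).1 (Lf n).
have bound n := cn_le (cLp2_meas (Lf n)) (hM n).
have [k [k1 [s1 [s2 [L1 L2 c1 c2]]]]] := concentration_compact Eu mF mE hd thin Lr Li
  (fun n => (bound n).1) (fun n => (bound n).2) (fun n => spec _ (Lf n)).
have Lg : cLp 2%:E (fun x : Rn R d => s1 x +i* s2 x) by apply: (cLp2E _).2.
exists k, (fun x => s1 x +i* s2 x); split => //.
apply/(cvg_L2dist (fun n => cLp2_meas (LT _ (Lf (k n)))) (cLp2_meas Lg)); split.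
  exact: c1.
exact: c2.
Qed.
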